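(* Let $T$ be a norm on $\mathbf R^3$ with smooth Wulff shape $W=\{T=1\}$ of positive curvature, and let $X:\Sigma\to\mathbf R^3$ be a smooth immersed oriented surface with nowhere vanishing Gauss curvature. Let $\nu$ be its Gauss map and $q=X\cdot\nu$ its support function, considered (via the Gauss map) locally as a function on $S^2$. Then $X$ is a critical point of the anisotropic Laguerre functional $$\mathcal L[X]=\frac14\int_\Sigma\Bigl(\frac1{\lambda_1}-\frac1{\lambda_2}\Bigr)^2\,dW$$ if and only if $q$ satisfies $$F[q]:=\frac{1}{K_W}\,\mathrm{tr}\bigl((D^2\eta+\eta I)(D^2\tau+\tau I)^{-1}\bigr)-2(\hat\Delta+2)q=0,$$ where $$\eta:=\mathrm{tr}\bigl((D^2q+qI)(D^2\tau+\tau I)^{-1}\bigr)=-\frac1{\lambda_1}-\frac1{\lambda_2}.$$ Moreover $F[q]=0$ is a fourth order linear elliptic equation for $q$.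
   Context: $T^*(u)=\sup_{T(\xi)=1}\langle u,\xi\rangle$ is the dual norm of $T$, and $\tau:=T^*|_{S^2}$ is the support function of $W$. The Wulff shape is parameterized by the inverse of its Gauss map as $\nu\mapsto D\tau+\tau\nu$, with differential $D^2\tau+\tau I$ (positive definite). $K_W$ is the Gauss curvature of $W$, considered as a function on $S^2$ via this parameterization, so $\det(D^2\tau+\tau I)=1/K_W$. For a smooth immersed oriented surface $X:\Sigma\to\mathbf R^3$, $\nu:\Sigma\to S^2$ is the unit normal such that $dX(e_1),dX(e_2),\nu$ is positively oriented for positively oriented $e_1,e_2$. The Cahn-Hoffman field $\xi:\Sigma\to W$ sends $p$ to the point of $W$ whose outward unit normal is $\nu(p)$, i.e. $\xi=(D\tau+\tau\nu)\circ\nu$. The anisotropic principal curvatures $\lambda_1,\lambda_2$ (real) are defined by $d\xi(e_i)=-\lambda_i\,dX(e_i)$ for a basis $e_1,e_2$ of principal directions; they are nonzero since the curvature of $X$ does not vanish. $dW$ is the area form (measure) of the pull-back metric $d\xi\cdot d\xi$ on $\Sigma$; it equals $(1/K_W)\,d\sigma$, with $d\sigma$ the area form of $S^2$ pulled back by $\nu$. Since the curvature is nonvanishing, $\nu$ is a local diffeomorphism, and $\Sigma$ is given the pulled-back round metric of $S^2$; $D$, $D^2$, $\hat\Delta$ and $I$ are the gradient, Hessian (as an endomorphism), Laplacian and identity for the round metric on $S^2$, applied to functions on $\Sigma$ through $\nu$. Functions on $S^2$ such as $\tau,K_W$ are regarded as functions on $\Sigma$ through $\nu$. Then $X=Dq+q\nu$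 and $dX=D^2q+qI$. Critical point: for every $\dot q\in C_c^\infty(\Sigma)$ (support in the interior of $\Sigma$), consider the variation $X_\epsilon=Dq_\epsilon+q_\epsilon\nu$ with $q_\epsilon=q+\epsilon\dot q$ (for small $|\epsilon|$ these are immersions with the same Gauss map and nonvanishing curvature). $X$ is critical if, for every such $\dot q$, the derivative at $\epsilon=0$ of the Laguerre integral of $X_\epsilon$ over a compact set containing the support of $\dot q$ in its interior is zero. *)

(* Defs.v *)
From HB Require Import structures.
From mathcomp Require Import all_boot all_order all_algebra.
From mathcomp Require Import all_classical all_reals all_analysis.
Import Order.TTheory GRing.Theory Num.Theory.
Import numFieldNormedType.Exports.

Set Implicit Arguments.
Unset Strict Implicit.
Unset Printing Implicit Defensive.

Local Open Scope classical_set_scope.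
Local Open Scope ring_scope.

(* The library norm on 'rV[R]_3 is the sup norm (used here only through the
   topology and differentiability); the Euclidean structure of R^3 is explicit. *)
Definition dot (R : realType) (u v : 'rV[R]_3) : R := (u *m v^T) 0 0.

Definition enorm (R : realType) (u : 'rV[R]_3) : R := Num.sqrt (dot u u).

Definition normalize (R : realType) (u : 'rV[R]_3) : 'rV[R]_3 :=
  (enorm u)^-1 *: u.

(* Indices are added in 'I_3, that is, modulo 3. *)
Definition cross (R : realType) (u v : 'rV[R]_3) : 'rV[R]_3 :=
  \row_(k < 3) (u 0 (k + 1) * v 0 (k + 2) - u 0 (k + 2) * v 0 (k + 1)).

Section Smoothness.
Context {R : realType} {V W : normedModType R}.

Fixpoint Cn (n : nat) (O : set V) (f : V -> W) : Prop :=
  if n is m.+1 then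
    (forall x, O x -> differentiable f x) /\ forall v, Cn m O ('D_v f)
  else forall x, O x -> {for x, continuous f}.

(* C^oo on an arbitrary subset A: near every point of A, f is the restriction
   of a C^oo function defined on an open set. *)
Definition smooth_on (A : set V) (f : V -> W) : Prop :=
  forall x, A x -> exists (O : set V) (g : V -> W),
    [/\ open O, O x, forall n, Cn n O g & forall y, O y -> A y -> f y = g y].

(* Directional derivative of f at x along v, the increment staying in A: it is
   'D_v f x in the interior of A, and a one-sided derivative at the boundary of
   a half-plane. *)
Definition derive_in (A : set V) (f : V -> W) (x v : V) : W :=
  lim ((fun h : R => h^-1 *: (f (h *: v + x) - f x))
        @ within [set h : R | A (h *: v + x)] 0^').

End Smoothness.

Definition halfplane (R : realType) : set (R * R) := [set x | 0 <= x.2].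

Definition frame (R : realType) (i : 'I_2) : R * R :=
  ((i == 0)%:R, (i == 1)%:R).

Definition det2 (R : realType) (a b : R * R) : R := a.1 * b.2 - a.2 * b.1.

(* Oriented smooth surfaces, possibly with boundary. Charts are given by their
   inverses par i, from a relatively open subset dom i of the closed half-plane
   onto an open subset of the surface, with coordinate maps crd i. *)
Record surface (R : realType) := Surface {
  carrier :> ptopologicalType;
  idx : Type;
  dom : idx -> set (R * R);
  par : idx -> R * R -> carrier;
  crd : idx -> carrier -> R * R;
  chart_at : carrier -> idx;
  surface_hausdorff : hausdorff_space carrier;
  surface_second_countable : @second_countable carrier;
  dom_open : forall i, exists2 O : set (R * R), open O & dom i = O `&` @halfplane R;
  par_open : forall i, open (par i @` dom i);
  par_continuous : forall i, {within dom i, continuous (par i)};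
  crd_continuous : forall i, {within par i @` dom i, continuous (crd i)};
  parK : forall i x, dom i x -> crd i (par i x) = x;
  chart_atP : forall p, (par (chart_at p) @` dom (chart_at p)) p;
  transition_smooth : forall i j,
    smooth_on (dom j `&` par j @^-1` (par i @` dom i)) (crd i \o par j);
  transition_oriented : forall i j x,
    dom j x -> (par i @` dom i) (par j x) ->
    let dpsi e := derive_in (dom j `&` par j @^-1` (par i @` dom i))
                    (crd i \o par j) x e in
    0 < det2 (dpsi (frame R 0)) (dpsi (frame R 1))
}.

Section Surfaces.
Context {R : realType} (S : surface R).

Definition manifold_interior : set S :=
  [set p | exists i x, [/\ dom i x, 0 < x.2 & par i x = p]].

Definition smooth {W : normedModType R} (f : S -> W) : Prop :=
  forall i, smooth_on (dom i) (f \o @par R S i).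

(* The differential of f at p. Tangent vectors at p are represented by their
   components e : R * R in the chart chart_at p. *)
Definition tdiff {W : normedModType R} (f : S -> W) (p : S) (e : R * R) : W :=
  let i := chart_at p in derive_in (dom i) (f \o @par R S i) (crd i p) e.

Definition immersion (X : S -> 'rV[R]_3) : Prop :=
  forall p e, tdiff X p e = 0 -> e = 0.

Definition gauss_map (X : S -> 'rV[R]_3) (p : S) : 'rV[R]_3 :=
  normalize (cross (tdiff X p (frame R 0)) (tdiff X p (frame R 1))).

(* The determinant of d nu with respect to dX. *)
Definition gauss_curvature (X : S -> 'rV[R]_3) (p : S) : R :=
  get [set k : R | forall a b, cross (tdiff (gauss_map X) p a)
                                     (tdiff (gauss_map X) p b)
                             = k *: cross (tdiff X p a) (tdiff X p b)].

Definition support_function (X : S -> 'rV[R]_3) (p : S) : R :=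
  dot (X p) (gauss_map X p).

(* mu is the area measure of the pull-back metric dY . dY. The density
   sqrt (det g) in every chart determines mu, as S is second countable. *)
Definition area_measure (Y : S -> 'rV[R]_3)
    (mu : {measure set (g_sigma_algebraType (@open S)) -> \bar R}) : Prop :=
  forall (i : idx S) (A : set (measurableTypeR R * measurableTypeR R)),
    measurable A -> A `<=` dom i ->
    let dY x k := derive_in (dom i) (Y \o @par R S i) x (frame R k) in
    mu (par i @` A) =
    (\int[(@lebesgue_measure R \x @lebesgue_measure R)%E]_(x in A)
      (Num.sqrt (\det (\matrix_(k < 2, l < 2) dot (dY x k) (dY x l))))%:E)%E.

(* Calculus for the round metric of S^2 pulled back by a local diffeomorphism
   nu : S -> S^2. Vectors tangent to S^2 at nu p are elements of R^3, and
   endomorphisms of the tangent plane are given by their matrices in the basis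
   d nu (frame 0), d nu (frame 1), the images of the basis vectors being the
   columns. *)
Section Round.
Variable nu : S -> 'rV[R]_3.

Definition round_metric (p : S) : 'M[R]_2 :=
  \matrix_(i, j) dot (tdiff nu p (frame R i)) (tdiff nu p (frame R j)).

(* <grad f, d nu e> = df e for all e *)
Definition grad (f : S -> R) (p : S) : 'rV[R]_3 :=
  \sum_i \sum_j (invmx (round_metric p) i j * tdiff f p (frame R j))
                *: tdiff nu p (frame R i).

(* The Hessian sends d nu e to the covariant derivative of grad f along e,
   that is, to the tangential projection of d (grad f) e; its coordinates are
   obtained from the scalar products with the d nu (frame i). *)
Definition hess (f : S -> R) (p : S) : 'M[R]_2 :=
  invmx (round_metric p) *m
  \matrix_(i, j) dot (tdiff nu p (frame R i)) (tdiff (grad f) p (frame R j)).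

Definition laplacian (f : S -> R) (p : S) : R := \tr (hess f p).

End Round.

(* Linear differential operators of order m with smooth coefficients, whose
   principal symbol vanishes at no nonzero covector. *)
Definition linear_elliptic_operator (m : nat) (P : (S -> R) -> S -> R) : Prop :=
  forall i : idx S, exists a : nat -> nat -> R * R -> R,
  let pd1 (u : R * R -> R) := fun x => derive_in (dom i) u x (frame R 0) in
  let pd2 (u : R * R -> R) := fun x => derive_in (dom i) u x (frame R 1) in
  [/\ forall j k, smooth_on (dom i) (a j k),
      forall f : S -> R, smooth f -> forall x, dom i x ->
        P f (par i x) =
        \sum_(j < m.+1) \sum_(k < m.+1 | (j + k <= m)%N)
          a j k x * iter j pd1 (iter k pd2 (f \o @par R S i)) x
    & forall x, dom i x -> forall z : R * R, z != 0 ->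
        \sum_(j < m.+1) a j (m - j)%N x * z.1 ^+ j * z.2 ^+ (m - j) != 0].

End Surfaces.

Section Wulff.
Context {R : realType} (T : 'rV[R]_3 -> R).

Definition is_norm : Prop :=
  [/\ forall x, T x = 0 -> x = 0,
      forall (a : R) x, T (a *: x) = `|a| * T x
    & forall x y, T (x + y) <= T x + T y].

Definition wulff_shape : set 'rV[R]_3 := [set x | T x = 1].

Definition wulff_normal (x : 'rV[R]_3) : 'rV[R]_3 :=
  normalize (\row_(i < 3) 'D_(delta_mx 0 i) T x).

(* The Gauss curvature of wulff_shape at its point x: the determinant of the
   differential of wulff_normal on the tangent plane. *)
Definition wulff_curvature (x : 'rV[R]_3) : R :=
  get [set k : R | forall a b,
    dot (wulff_normal x) a = 0 -> dot (wulff_normal x) b = 0 ->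
    cross ('D_a wulff_normal x) ('D_b wulff_normal x) = k *: cross a b].

Definition dual_norm (u : 'rV[R]_3) : R :=
  sup [set dot u x | x in wulff_shape].

Definition wulff_point (u : 'rV[R]_3) : 'rV[R]_3 :=
  get [set x | wulff_shape x /\ wulff_normal x = u].

Definition smooth_positively_curved_wulff : Prop :=
  smooth_on [set x | x != 0] T /\
  forall x, wulff_shape x -> 0 < wulff_curvature x.

Context (S : surface R).

Definition cahn_hoffman (X : S -> 'rV[R]_3) (p : S) : 'rV[R]_3 :=
  wulff_point (gauss_map X p).

Definition anisotropic_principal_curvatures (X : S -> 'rV[R]_3) (p : S)
    : R * R :=
  get [set l : R * R | exists e1 e2 : R * R,
    [/\ det2 e1 e2 != 0,
        tdiff (cahn_hoffman X) p e1 = - l.1 *: tdiff X p e1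
      & tdiff (cahn_hoffman X) p e2 = - l.2 *: tdiff X p e2]].

(* The Laguerre integral of X over K. The argument dA is meant to send an
   immersion Y to the area measure of the metric dY . dY (see area_measure);
   it is applied to the Cahn-Hoffman field of X. *)
Definition laguerre
    (dA : (S -> 'rV[R]_3) ->
          {measure set (g_sigma_algebraType (@open S)) -> \bar R})
    (X : S -> 'rV[R]_3) (K : set S) : R :=
  4^-1 * Rintegral (dA (cahn_hoffman X)) K
           (fun p => let l := anisotropic_principal_curvatures X p in
                     (l.1^-1 - l.2^-1) ^+ 2).

Definition laguerre_variation (X : S -> 'rV[R]_3) (qdot : S -> R) (eps : R) (p : S)
    : 'rV[R]_3 :=
  let nu := gauss_map X in
  let q := fun p' => support_function X p' + eps * qdot p' in
  grad nu q p + q p *: nu p.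

Definition laguerre_critical
    (dA : (S -> 'rV[R]_3) ->
          {measure set (g_sigma_algebraType (@open S)) -> \bar R})
    (X : S -> 'rV[R]_3) : Prop :=
  forall qdot : S -> R, smooth qdot ->
  let supp := closure [set p | qdot p != 0] in
  compact supp -> supp `<=` @manifold_interior R S ->
  forall K : set S, compact K -> supp `<=` interior K ->
  is_derive (0 : R) (1 : R)
    (fun eps => laguerre dA (laguerre_variation X qdot eps) K) (0 : R).

(* Functions on S^2 such as the dual norm and the curvature of the Wulff shape
   are pulled back to S by nu. *)
Section Operator.
Variable nu : S -> 'rV[R]_3.

Definition wulff_matrix (p : S) : 'M[R]_2 :=
  hess nu (dual_norm \o nu) p + (dual_norm (nu p))%:M.

Definition aniso_trace (f : S -> R) (p : S) : R :=
  \tr ((hess nu f p + (f p)%:M) *m invmx (wulff_matrix p)).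

Definition laguerre_operator (q : S -> R) (p : S) : R :=
  (wulff_curvature (wulff_point (nu p)))^-1 *
    aniso_trace (aniso_trace q) p
  - 2 * (laplacian nu q p + 2 * q p).

End Operator.

End Wulff.

(* Main.v *)
(* Let Y_f = grad f + f nu be the surface with Gauss map nu and support function
   f, so that dY_f = A_f d nu with A_f = D^2 f + f I, and let
   m(f, g) = tr (adj A_f A_g) be the polarization of 2 det A_f. In a chart,
   m(f, g) det (nu, d_0 nu, d_1 nu) is
   det (nu, d_0 Y_f, d_1 Y_g) + det (nu, d_0 Y_g, d_1 Y_f). Since dY_f and dY_g
   are tangent, h det (nu, dY_f, dY_g) = det (Y_h, dY_f, dY_g), and Leibniz' rule
   shows that h m(f, g) - f m(h, g) is a divergence.

   The Cahn-Hoffman field is Y_tau, hence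
   tr (A_f A_tau^-1) = m(f, tau) / det A_tau with det A_tau = 1 / K_W, and
   F[q] = m(eta, tau) - 2 m(q, 1). A variation of q changes neither nu nor dW, and
   (1/l1 - 1/l2)^2 = eta^2 - 4 det A_q / det A_tau is quadratic in q. Its first
   variation along f is 2 (eta m(f, tau) - 2 m(f, q)) times the area form of S^2,
   which is 2 f F[q] up to a divergence. A partition of unity reduces the
   integration by parts to squares in charts, and f = (bump) F[q] gives the
   converse. The Wulff point of u is the inverse image of u, up to scaling, under
   x -> T(x) grad T(x), a bijection of R^3 minus 0 with invertible differential,
   hence is smooth in u.

   The principal symbol of f -> m(f, tau) is a multiple of the second fundamental
   form of W, which is definite; that of F is a multiple of its square. *)
Require Import Defs.
From HB Require Import structures.
From mathcomp Require Import all_boot all_order all_algebra.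
From mathcomp Require Import all_classical all_reals all_analysis.
From mathcomp Require Import measurable_realfun ring lra.
Import Order.TTheory GRing.Theory Num.Theory.
Import numFieldNormedType.Exports.

Set Implicit Arguments.
Unset Strict Implicit.
Unset Printing Implicit Defensive.

Local Open Scope classical_set_scope.
Local Open Scope ring_scope.

(** * Vectors of R^3 *)

(** Objects on the surface are given pointwise in the frame of [chart_at p], which varies with [p]
    without any regularity, so they cannot be differentiated as written. The way out is that
    [grad f + f nu] is determined by its scalar products with [nu] and the two [d nu], which
    identifies it with an explicit expression in any fixed chart. Hessian matrices remain
    frame-dependent. Their polarized determinant is smooth, being the quotient of two chart
    densities that change by the same Jacobian; traces, determinants and the operator are expressed
    through it.

    The surface may have a boundary. [derive_in] is then a one-sided limit, and its rules are proved
    by passing to a smooth extension to an open set, on whose choice the value does not depend.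

    Curvatures, Wulff points and principal curvatures are chosen by [get], so a witness must be
    found before their defining property is available. The Gauss curvature may be negative: the area
    form of the sphere then enters through an absolute value, and integration by parts is done on
    squares where its sign is constant. *)

Lemma sum3E (V : nmodType) (F : 'I_3 -> V) : \sum_i F i = F 0 + F 1 + F 2.
Proof.
by rewrite !big_ord_recl big_ord0 addr0 addrA;
  congr (F _ + F _ + F _); apply/val_inj.
Qed.

Section DotCross.
Context {R : realType}.
Implicit Types u v w : 'rV[R]_3.

Lemma dotE u v : dot u v = u 0 0 * v 0 0 + u 0 1 * v 0 1 + u 0 2 * v 0 2.
Proof.
by rewrite /dot mxE sum3E !mxE.
Qed.

Lemma crossE u v : ((cross u v 0 0 = u 0 1 * v 0 2 - u 0 2 * v 0 1) *
  (cross u v 0 1 = u 0 2 * v 0 0 - u 0 0 * v 0 2) *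
  (cross u v 0 2 = u 0 0 * v 0 1 - u 0 1 * v 0 0))%type.
Proof.
by split; [split|]; rewrite /cross mxE;
  congr (_ * _ - _ * _); congr (_ 0 _); apply/val_inj.
Qed.

Lemma rV3P u v : u 0 0 = v 0 0 -> u 0 1 = v 0 1 -> u 0 2 = v 0 2 -> u = v.
Proof.
move=> e0 e1 e2; apply/rowP => -[[|[|[|//]]] i].
- by rewrite (_ : Ordinal i = 0)//; apply/val_inj.
- by rewrite (_ : Ordinal i = 1)//; apply/val_inj.
- by rewrite (_ : Ordinal i = 2)//; apply/val_inj.
Qed.

End DotCross.

(** Identities between vectors become polynomial identities between coordinates. *)
Ltac vec3 := first [apply: rV3P | idtac];
  rewrite ?(dotE, crossE, mxE); try ring.

Section DotCrossTheory.
Context {R : realType}.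
Implicit Types u v w a b : 'rV[R]_3.

Lemma dotC u v : dot u v = dot v u. Proof. vec3. Qed.
Lemma dotDl u v w : dot (u + v) w = dot u w + dot v w. Proof. vec3. Qed.
Lemma dotDr u v w : dot w (u + v) = dot w u + dot w v. Proof. vec3. Qed.
Lemma dotZl k u v : dot (k *: u) v = k * dot u v. Proof. vec3. Qed.
Lemma dotZr k u v : dot u (k *: v) = k * dot u v. Proof. vec3. Qed.
Lemma dotNl u v : dot (- u) v = - dot u v. Proof. vec3. Qed.
Lemma dotBl u v w : dot (u - v) w = dot u w - dot v w. Proof. vec3. Qed.
Lemma dotBr u v w : dot w (u - v) = dot w u - dot w v. Proof. vec3. Qed.
Lemma dot0l u : dot 0 u = 0. Proof. vec3. Qed.
Lemma dot0r u : dot u 0 = 0. Proof. vec3. Qed.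
Lemma crossDl u v w : cross (u + v) w = cross u w + cross v w.
Proof. vec3. Qed.
Lemma crossDr u v w : cross w (u + v) = cross w u + cross w v.
Proof. vec3. Qed.
Lemma crossZl k u v : cross (k *: u) v = k *: cross u v. Proof. vec3. Qed.
Lemma crossZr k u v : cross u (k *: v) = k *: cross u v. Proof. vec3. Qed.
Lemma cross0l u : cross 0 u = 0. Proof. vec3. Qed.
Lemma cross0r u : cross u 0 = 0. Proof. vec3. Qed.
Lemma crossvv u : cross u u = 0. Proof. vec3. Qed.
Lemma dot_crossl u v : dot (cross u v) u = 0. Proof. vec3. Qed.
Lemma dot_crossr u v : dot (cross u v) v = 0. Proof. vec3. Qed.
Lemma dot_cross_rot u v w : dot u (cross v w) = dot v (cross w u).
Proof. vec3. Qed.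

Lemma dot_cross_cross a b u v :
  dot (cross a b) (cross u v) = dot a u * dot b v - dot a v * dot b u.
Proof. vec3. Qed.

Lemma cross_cross u v w : cross u (cross v w) = dot u w *: v - dot u v *: w.
Proof. vec3. Qed.

Lemma dotvv_ge0 u : 0 <= dot u u.
Proof. by rewrite dotE !addr_ge0// -expr2 sqr_ge0. Qed.

Lemma dotvv_eq0 u : dot u u = 0 -> u = 0.
Proof.
rewrite dotE => /eqP; rewrite paddr_eq0 ?addr_ge0 -?expr2 ?sqr_ge0//.
rewrite paddr_eq0 ?sqr_ge0// !sqrf_eq0 => /andP[/andP[/eqP e0 /eqP e1] /eqP e2].
by apply: rV3P; rewrite mxE.
Qed.

Lemma dotvv_gt0 u : u != 0 -> 0 < dot u u.
Proof.
move=> u0; rewrite lt_neqAle dotvv_ge0 andbT eq_sym.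
by apply: contra u0 => /eqP/dotvv_eq0/eqP.
Qed.

Lemma enorm_gt0 u : u != 0 -> 0 < enorm u.
Proof. by move=> u0; rewrite /enorm sqrtr_gt0 dotvv_gt0. Qed.

Lemma enorm_sqr u : enorm u ^+ 2 = dot u u.
Proof. by rewrite sqr_sqrtr// dotvv_ge0. Qed.

Lemma enormZ k u : enorm (k *: u) = `|k| * enorm u.
Proof.
rewrite /enorm dotZl dotZr mulrA -expr2 sqrtrM ?sqr_ge0// sqrtr_sqr//.
Qed.

Lemma dot_normalize u : u != 0 -> dot (normalize u) (normalize u) = 1.
Proof.
move=> /enorm_gt0/lt0r_neq0 u0.
by rewrite /normalize dotZl dotZr -enorm_sqr; field.
Qed.

Lemma normalizeZ k u : 0 < k -> normalize (k *: u) = normalize u.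
Proof.
move=> k0; have [->|/enorm_gt0/lt0r_neq0 u0] := eqVneq u 0; first by rewrite scaler0.
rewrite /normalize enormZ gtr0_norm// scalerA; congr (_ *: _).
by field; rewrite u0 lt0r_neq0.
Qed.

Lemma normalizeE u : u = enorm u *: normalize u.
Proof.
have [->|/enorm_gt0/lt0r_neq0 u0] := eqVneq u 0.
  by rewrite /normalize !scaler0.
by rewrite /normalize scalerA divff// scale1r.
Qed.

(** Expansion of [y] in the basis reciprocal to [a], [u], [v]. It is the formula behind [envelope],
    and it gives uniqueness from three scalar products. *)
Lemma cramer3 a u v y : dot a (cross u v) *: y =
  dot y a *: cross u v + dot y u *: cross v a + dot y v *: cross a u.
Proof. vec3. Qed.

Lemma cramer3_unique a u v y z : dot a (cross u v) != 0 ->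
  dot y a = dot z a -> dot y u = dot z u -> dot y v = dot z v -> y = z.
Proof.
move=> J ea eu ev; apply: (scalerI J).
by rewrite !cramer3 ea eu ev.
Qed.

(** [cross a b] is normal, hence a multiple of [n], so only the component of [y] along [n]
    contributes. *)
Lemma det_tangent n y a b : dot n n = 1 -> dot n a = 0 -> dot n b = 0 ->
  dot y (cross a b) = dot y n * dot n (cross a b).
Proof.
move=> n1 na nb; have H : cross n (cross a b) = 0.
  by rewrite cross_cross na nb !scale0r subr0.
have : cross n (cross n (cross a b)) = 0 by rewrite H cross0r.
rewrite cross_cross n1 scale1r => /eqP; rewrite subr_eq0 => /eqP E.
by rewrite -{1}E dotZr mulrC.
Qed.

Lemma cross_lin2 u v (x y z w : R) : cross (x *: u + y *: v) (z *: u + w *: v) =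
  (x * w - y * z) *: cross u v.
Proof. vec3. Qed.

Lemma lin2_comb u v (a b x y z w : R) :
  a *: (x *: u + y *: v) + b *: (z *: u + w *: v) =
  (a * x + b * z) *: u + (a * y + b * w) *: v.
Proof. by rewrite !scalerDr !scalerA addrACA -!scalerDl. Qed.

End DotCrossTheory.

#[local] Opaque dot cross.

(** * Smooth functions *)

Section Differentiability.
Context {R : realType}.
Implicit Types V W Z : normedModType R.

Lemma differentiable_eps V W (f : V -> W) x : differentiable f x ->
  forall e : R, 0 < e ->
  \forall h \near (0 : V), `|f (h + x) - (f x + 'd f x h)| <= e * `|h|.
Proof. by move=> /diff_locally /eqaddoP H e e0; exact: H. Qed.

Lemma eps_differentiable V W (f : V -> W) x (df : {linear V -> W}) :
  continuous df ->
  (forall e : R, 0 < e ->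
    \forall h \near (0 : V), `|f (h + x) - (f x + df h)| <= e * `|h|) ->
  differentiable f x /\ 'd f x = df :> (V -> W).
Proof.
move=> dfc H.
have E : f \o shift x = cst (f x) + df +o_ 0 id.
  by apply/eqaddoP => e e0; exact: H.
have dE := diff_unique dfc E.
split=> //; apply/diff_locallyP; split; first by rewrite dE.
by rewrite E dE.
Qed.

Lemma near_eq_differentiable V W (f g : V -> W) x :
  (\forall y \near x, f y = g y) -> differentiable f x -> differentiable g x.
Proof.
move=> fg df.
have fgx : f x = g x by exact: nbhs_singleton fg.
have [|//] := @eps_differentiable V W g x ('d f x) (diff_continuous df) _.
move=> e e0; have := differentiable_eps df e0.
move: fg; rewrite (near_shift 0)/= subr0; apply: filterS2 => h /= <-.
by rewrite fgx.
Qed.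

Lemma scale_is_bilinear W :
  bilinear_for
    (GRing.Scale.Law.clone _ _ *:%R _) (GRing.Scale.Law.clone _ _ *:%R _)
    (fun (k : R^o) (w : W) => k *: w).
Proof.
split=> [u'|u] a x y /=; first by rewrite scalerDl -scalerA.
by rewrite scalerDr !scalerA mulrC.
Qed.

Lemma differentiable_scale V W (k : V -> R) (f : V -> W) x :
  differentiable k x -> differentiable f x ->
  differentiable (fun y => k y *: f y) x /\
  forall v, 'D_v (fun y => k y *: f y) x = k x *: 'D_v f x + 'D_v k x *: f x.
Proof.
move=> dk df.
pose sM := bilinear_isBilinear.Build R R^o W W _ _ (fun k w => k *: w)
  (@scale_is_bilinear W).
pose s : {bilinear R^o -> W -> W} := HB.pack (fun (k : R^o) (w : W) => k *: w) sM.
have dp := differentiable_pair dk df.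
have ds : differentiable (fun p : R^o * W => s p.1 p.2) (k x, f x).
  by apply: differentiable_bilin => ?; exact: scale_continuous.
have -> : (fun y => k y *: f y) = (fun p => s p.1 p.2) \o (fun y => (k y, f y)).
  by [].
split; first exact: differentiable_comp.
move=> v; rewrite deriveE; last exact: differentiable_comp.
have -> : 'd ((fun p => s p.1 p.2) \o (fun y => (k y, f y))) x v =
    'd (fun p : R^o * W => s p.1 p.2) (k x, f x) ('d (fun y => (k y, f y)) x v).
  by rewrite (diff_comp dp ds).
have -> : 'd (fun y => (k y, f y)) x v = ('d k x v, 'd f x v).
  by rewrite (diff_pair dk df).
have sc' : continuous (fun p : R^o * W => s p.1 p.2) by exact: scale_continuous.
have -> := @diff_bilin _ _ _ _ s (k x, f x) sc'.
by rewrite -(deriveE v dk) -(deriveE v df).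
Qed.

Lemma derive_comp V W Z (f : V -> W) (g : W -> Z) x v :
  differentiable f x -> differentiable g (f x) ->
  'D_v (g \o f) x = 'D_('D_v f x) g (f x).
Proof.
move=> df dg; rewrite !deriveE//; last exact: differentiable_comp.
by rewrite diff_comp.
Qed.

Lemma derive_linear V W (f : V -> W) x (df : differentiable f x) a u v :
  'D_(a *: u + v) f x = a *: 'D_u f x + 'D_v f x.
Proof. by rewrite !deriveE// linearP. Qed.

End Differentiability.

Section CnTheory.
Context {R : realType}.
Implicit Types V W Z : normedModType R.

Lemma Cn_continuous V W n (O : set V) (f : V -> W) : Cn n O f ->
  forall x, O x -> {for x, continuous f}.
Proof.
by case: n => [//|n] /= [df _] x Ox; apply: differentiable_continuous; exact: df.
Qed.

Lemma CnSP V W n (O : set V) (f : V -> W) : Cn n.+1 O f ->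
  (forall x, O x -> differentiable f x) /\ (forall v, Cn n O ('D_v f)).
Proof. by []. Qed.

Lemma CnS V W n (O : set V) (f : V -> W) : Cn n.+1 O f -> Cn n O f.
Proof.
elim: n f => [|n IH] f /=; first exact: (@Cn_continuous _ _ 1).
by move=> [df H]; split=> // v; apply: IH; exact: H.
Qed.

Lemma Cn_sub V W n (O O' : set V) (f : V -> W) :
  O' `<=` O -> Cn n O f -> Cn n O' f.
Proof.
move=> sub; elim: n f => [|n IH] f /=; first by move=> H x /sub; exact: H.
by move=> [df H]; split=> [x /sub|v]; [exact: df|exact: IH].
Qed.

Lemma Cn_cst V W n (O : set V) (c : W) : Cn n O (fun _ => c).
Proof.
elim: n c => [|n IH] c /=; first by move=> x _; exact: cvg_cst.
split=> [x _|v]; first exact: differentiable_cst.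
rewrite (_ : 'D_v _ = fun=> 0) //; apply/funext => x.
exact: derive_cst.
Qed.

Lemma Cn_id n V (O : set V) : Cn n O (@id V).
Proof.
case: n => [|n] /=; first by move=> x _; exact: cvg_id.
split=> [x _|v]; first by [].
rewrite (_ : 'D_v id = fun=> v); first exact: Cn_cst.
by apply/funext => x; rewrite derive_id.
Qed.

Section OpenDomain.
Context V (O : set V) (oO : open O).

Let open_near (P : V -> Prop) x : (forall y, O y -> P y) -> O x ->
  \forall y \near x, P y.
Proof.
by move=> H Ox; near=> y; apply: H; near: y; exact: open_nbhs_nbhs.
Unshelve. all: by end_near. Qed.

(** On an open set, functions that agree have the same directional derivatives, so the induction
    hypothesis applies to these. *)
Lemma Cn_eq W n (f g : V -> W) :
  (forall x, O x -> f x = g x) -> Cn n O f -> Cn n O g.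
Proof.
elim: n f g => [|n IH] f g fg.
  move=> H x Ox; rewrite /prop_for/continuous_at -fg//.
  apply: cvg_trans (H x Ox); apply: near_eq_cvg.
  exact: open_near.
have fgn x : O x -> \forall y \near x, f y = g y by exact: open_near.
move=> /= [df H]; split=> [x Ox|v].
  exact: near_eq_differentiable (fgn x Ox) (df x Ox).
apply: (IH ('D_v f)) => // x Ox; exact: near_eq_derive (fgn x Ox).
Qed.

(** [Cn] speaks of the function ['D_v f] on all of [V]; here a formula valid on [O] is enough. Most
    inductions on the order go through this form. *)
Lemma CnS_of W n (f : V -> W) (df : V -> V -> W) :
  (forall x, O x -> differentiable f x) ->
  (forall x v, O x -> 'D_v f x = df v x) -> (forall v, Cn n O (df v)) ->
  Cn n.+1 O f.
Proof.
move=> dif fE H; split=> // v; apply: Cn_eq (H v) => x Ox.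
by rewrite fE.
Qed.

Lemma Cn_linear W Z n (f : V -> W) (L : {linear W -> Z}) :
  continuous L -> Cn n O f -> Cn n O (fun x => L (f x)).
Proof.
move=> cL; have dL w : differentiable L w by exact: linear_differentiable.
elim: n f => [|n IH] f H.
  by move=> x Ox; apply: continuous_comp; [exact: H|exact: cL].
have [df H'] := CnSP H.
apply: (CnS_of (df := fun v x => L ('D_v f x))) => [x Ox|x v Ox|v].
- by apply: (@differentiable_comp _ _ _ _ f L); [exact: df|].
- rewrite -[LHS]/('D_v (L \o f) x) derive_comp//; last exact: df.
  by rewrite deriveE// diff_lin.
- exact: IH.
Qed.

Lemma CnD W n (f g : V -> W) : Cn n O f -> Cn n O g -> Cn n O (fun x => f x + g x).
Proof.
elim: n f g => [|n IH] f g.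
  by move=> Hf Hg x Ox; apply: continuousD; [exact: Hf|exact: Hg].
move=> /CnSP[df Hf] /CnSP[dg Hg].
apply: (CnS_of (df := fun v x => 'D_v f x + 'D_v g x)) => [x Ox|x v Ox|v].
- by apply: differentiableD; [exact: df|exact: dg].
- by apply: deriveD; apply: diff_derivable; [exact: df|exact: dg].
- exact: IH.
Qed.

Lemma Cn_scale W n (k : V -> R) (f : V -> W) :
  Cn n O k -> Cn n O f -> Cn n O (fun x => k x *: f x).
Proof.
elim: n k f => [|n IH] k f.
  by move=> Hf Hg x Ox; apply: continuousZ; [exact: Hf|exact: Hg].
move=> Hk Hf; have [dk Hk'] := CnSP Hk; have [df Hf'] := CnSP Hf.
have D x (Ox : O x) := differentiable_scale (dk x Ox) (df x Ox).
apply: (CnS_of (df := fun v x => k x *: 'D_v f x + 'D_v k x *: f x)).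
- by move=> x /D[].
- by move=> x v /D[_ ->].
- by move=> v; apply: CnD; apply: IH => //; exact: CnS.
Qed.

Lemma CnM n (k f : V -> R) : Cn n O k -> Cn n O f -> Cn n O (fun x => k x * f x).
Proof. exact: Cn_scale. Qed.

Lemma CnN W n (f : V -> W) : Cn n O f -> Cn n O (fun x => - f x).
Proof.
move=> H; apply: (@Cn_eq _ _ (fun x => (-1 : R) *: f x)) => [x _|].
  by rewrite scaleN1r.
by apply: Cn_scale => //; exact: Cn_cst.
Qed.

Lemma CnB W n (f g : V -> W) : Cn n O f -> Cn n O g -> Cn n O (fun x => f x - g x).
Proof. by move=> Hf Hg; apply: CnD => //; exact: CnN. Qed.

Lemma Cn_sum W n (I : Type) (r : seq I) (f : I -> V -> W) :
  (forall i, Cn n O (f i)) -> Cn n O (fun x => \sum_(i <- r) f i x).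
Proof.
move=> H; elim: r => [|i r IH].
  by apply: Cn_eq (Cn_cst n O (0 : W)) => x _; rewrite big_nil.
apply: Cn_eq (CnD (H i) IH) => x _; by rewrite big_cons.
Qed.

(** The derivative is again written with the inverse of the same [f], one order lower, so [f] stays
    fixed in the induction. [Cn_sqrt] and [inverse_smooth] rest on the same bootstrapping. *)
Lemma CnV n (f : V -> R) : (forall x, O x -> f x != 0) -> Cn n O f ->
  Cn n O (fun x => (f x)^-1).
Proof.
move=> f0; elim: n => [|n IH].
  by move=> Hf x Ox; apply: cvgV; [exact: f0|exact: Hf].
move=> Hf; have [df Hf'] := CnSP Hf.
apply: (CnS_of (df := fun v x => - ((f x)^-1 * (f x)^-1) * 'D_v f x)).
- by move=> x Ox; apply: differentiableV; [exact: df|exact: f0].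
- move=> x v Ox; rewrite deriveV ?f0//; last exact: diff_derivable (df x Ox).
  by rewrite -expr2 exprVn.
- move=> v; apply: CnM => //; apply: CnN; apply: CnM; apply: IH; exact: CnS.
Qed.

(* The derivative of the composite is expanded in a basis [e] with coordinates
   [c], so that every partial derivative of [g] is taken in a fixed direction. *)
Lemma Cn_comp_basis W Z n (I : finType) (e : I -> W) (c : I -> {linear W -> R})
    (f : V -> W) (g : W -> Z) (P : set W) :
  (forall w, w = \sum_i c i w *: e i) -> (forall i, continuous (c i)) ->
  (forall x, O x -> P (f x)) -> Cn n O f -> Cn n P g ->
  Cn n O (fun x => g (f x)).
Proof.
move=> eE cc fP; elim: n g => [|n IH] g.
  by move=> Hf Hg x Ox; apply: continuous_comp; [exact: Hf|exact/Hg/fP].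
move=> Hf Hg; have [df Hf'] := CnSP Hf; have [dg Hg'] := CnSP Hg.
apply: (CnS_of (df := fun v x => \sum_i c i ('D_v f x) *: 'D_(e i) g (f x))).
- by move=> x Ox; apply: differentiable_comp; [exact: df|exact/dg/fP].
- move=> x v Ox; have dgx := dg _ (fP _ Ox).
  rewrite -[LHS]/('D_v (g \o f) x) derive_comp//; last exact: df.
  rewrite deriveE// {1}(eE ('D_v f x)) linear_sum; apply: eq_bigr => i _.
  by rewrite linearZ -deriveE.
- move=> v; apply: Cn_sum => i; apply: Cn_scale; first exact: Cn_linear.
  exact: (IH ('D_(e i) g) (CnS Hf) (Hg' _)).
Qed.

End OpenDomain.

End CnTheory.

Section CnCoordinates.
Context {R : realType}.
Implicit Types V W Z : normedModType R.

Lemma fst_linear : linear (@fst R R). Proof. by []. Qed.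
Lemma snd_linear : linear (@snd R R). Proof. by []. Qed.

Definition fst_lin : {linear (R * R)%type -> R} :=
  HB.pack (@fst R R) (GRing.isLinear.Build _ _ _ _ _ fst_linear).
Definition snd_lin : {linear (R * R)%type -> R} :=
  HB.pack (@snd R R) (GRing.isLinear.Build _ _ _ _ _ snd_linear).
Definition pair_coord (i : 'I_2) := if i == 0 then fst_lin else snd_lin.

Lemma frame_sum (x : R * R) : x = \sum_i pair_coord i x *: frame R i.
Proof.
rewrite big_ord_recl big_ord1 /pair_coord/=; case: x => x y /=.
rewrite /frame/= /GRing.scale/= /scale_pair /GRing.add/= /add_pair/=.
by congr (_, _); rewrite /GRing.scale/= ?mulr0 ?mulr1 ?addr0 ?add0r.
Qed.

Lemma frame_decomp (x : R * R) : x = x.1 *: frame R 0 + x.2 *: frame R 1.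
Proof. by rewrite {1}(frame_sum x) big_ord_recl big_ord1. Qed.

Lemma pair_coord_continuous i : continuous (pair_coord i).
Proof.
by rewrite /pair_coord; case: ifP => _ x; [exact: cvg_fst|exact: cvg_snd].
Qed.

Lemma row_coord_linear n (i : 'I_n) : linear (fun u : 'rV[R]_n => u 0 i).
Proof. by move=> a u v; rewrite !mxE. Qed.

Definition row_coord n (i : 'I_n) : {linear 'rV[R]_n -> R} :=
  HB.pack (fun u : 'rV[R]_n => u 0 i)
    (GRing.isLinear.Build _ _ _ _ _ (@row_coord_linear n i)).

Lemma row_coord_continuous n (i : 'I_n) : continuous (row_coord i).
Proof. exact: coord_continuous. Qed.

Variables (V : normedModType R) (O : set V) (oO : open O).

Lemma Cn_comp_pair Z n (f : V -> R * R) (g : R * R -> Z) (P : set (R * R)) :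
  (forall x, O x -> P (f x)) -> Cn n O f -> Cn n P g -> Cn n O (fun x => g (f x)).
Proof. exact: (Cn_comp_basis oO frame_sum pair_coord_continuous). Qed.

Lemma Cn_comp_row Z m n (f : V -> 'rV[R]_m) (g : 'rV[R]_m -> Z)
    (P : set 'rV[R]_m) :
  (forall x, O x -> P (f x)) -> Cn n O f -> Cn n P g -> Cn n O (fun x => g (f x)).
Proof.
apply: (Cn_comp_basis oO (e := fun i => delta_mx 0 i) (c := @row_coord m)).
  by move=> w; exact: row_sum_delta.
exact: row_coord_continuous.
Qed.

Lemma Cn_comp_real Z n (f : V -> R) (g : R -> Z) (P : set R) :
  (forall x, O x -> P (f x)) -> Cn n O f -> Cn n P g -> Cn n O (fun x => g (f x)).
Proof.
apply: (Cn_comp_basis oO (e := fun _ : 'I_1 => 1 : R) (c := fun _ => (idfun : {linear R -> R}))).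
  by move=> w; rewrite big_ord1 /= /GRing.scale/= mulr1.
by move=> _ x; exact: cvg_id.
Qed.

Lemma Cn_coord m n (f : V -> 'rV[R]_m) (i : 'I_m) :
  Cn n O f -> Cn n O (fun x => f x 0 i).
Proof. exact: (Cn_linear oO (@row_coord_continuous m i)). Qed.

Lemma Cn_fst n (f : V -> R * R) : Cn n O f -> Cn n O (fun x => (f x).1).
Proof. exact: (Cn_linear oO (@pair_coord_continuous 0)). Qed.

Lemma Cn_snd n (f : V -> R * R) : Cn n O f -> Cn n O (fun x => (f x).2).
Proof. exact: (Cn_linear oO (@pair_coord_continuous 1)). Qed.

Lemma Cn_row m n (f : V -> 'I_m -> R) : (forall i, Cn n O (f ^~ i)) ->
  Cn n O (fun x => \row_i f x i).
Proof.
move=> H; apply: (@Cn_eq _ _ _ oO _ n (fun x => \sum_i f x i *: delta_mx 0 i)).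
  move=> x _; rewrite [RHS]row_sum_delta; apply: eq_bigr => i _.
  by rewrite mxE.
apply: Cn_sum => // i; apply: Cn_scale => //; exact: Cn_cst.
Qed.

Lemma Cn_sqrt n (f : V -> R) : (forall x, O x -> 0 < f x) -> Cn n O f ->
  Cn n O (fun x => Num.sqrt (f x)).
Proof.
move=> f0; elim: n => [|n IH].
  by move=> Hf x Ox; apply: continuous_comp; [exact: Hf|exact: sqrt_continuous].
move=> Hf; have [df Hf'] := CnSP Hf.
have ds x : O x -> differentiable (Num.sqrt : R -> R) (f x).
  move=> Ox; apply/derivable1_diffP.
  by have [] := is_derive1_sqrt (f0 x Ox).
apply: (CnS_of oO (df := fun v x => (2 * Num.sqrt (f x))^-1 * 'D_v f x)).
- by move=> x Ox; apply: (@differentiable_comp _ _ _ _ f); [exact: df|exact: ds].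
- move=> x v Ox; rewrite -[LHS]/('D_v (Num.sqrt \o f) x).
  rewrite (derive_comp v (df x Ox) (ds x Ox)) (deriveE _ (ds x Ox)).
  rewrite -['D_v f x]mulr1 -[_ * 1]/('D_v f x *: 1) linearZ/= -(deriveE _ (ds x Ox)).
  by have [_ ->] := is_derive1_sqrt (f0 x Ox); rewrite /GRing.scale/= mulrC mulr1.
- move=> v; apply: CnM => //; apply: CnV => //.
    by move=> x Ox; rewrite mulf_neq0// gt_eqF// sqrtr_gt0 f0.
  by apply: CnM => //; [exact: Cn_cst|apply: IH; exact: CnS].
Qed.

End CnCoordinates.

Section SmoothOn.
Context {R : realType}.
Implicit Types V W Z : normedModType R.

Lemma near_open (T : topologicalType) (Q : T -> Prop) x :
  (\forall y \near x, Q y) -> exists U, [/\ open U, U x & U `<=` Q].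
Proof. by rewrite -nbhs_nearE nbhsE => -[U [oU Ux] sub]; exists U. Qed.

Lemma Cn_local V W n (O : set V) (f : V -> W) :
  (forall x, O x -> exists U, [/\ open U, U x & Cn n U f]) -> Cn n O f.
Proof.
elim: n f => [|n IH] f H.
  by move=> x /H [U [oU Ux Hf]]; exact: Hf.
split=> [x /H [U [oU Ux Hf]]|v]; first by have [df _] := CnSP Hf; exact: df.
apply: IH => x /H [U [oU Ux Hf]].
by exists U; split=> //; have [_] := CnSP Hf.
Qed.

Lemma smooth_on_open V W (O : set V) (f : V -> W) :
  open O -> (forall n, Cn n O f) -> smooth_on O f.
Proof. by move=> oO Hf x Ox; exists O, f. Qed.

Lemma smooth_on_openP V W (O : set V) (f : V -> W) :
  open O -> smooth_on O f -> forall n, Cn n O f.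
Proof.
move=> oO Hf n; apply: Cn_local => x Ox.
have [U [g [oU Ux Hg fg]]] := Hf x Ox.
exists (O `&` U); split; [exact: openI|by []|].
apply: (@Cn_eq _ _ _ (openI oO oU) _ n g).
  by move=> y [Oy Uy]; rewrite fg.
by apply: Cn_sub (Hg n) => y [].
Qed.

Lemma smooth_on_sub V W (A B : set V) (f : V -> W) :
  B `<=` A -> smooth_on A f -> smooth_on B f.
Proof.
move=> BA Hf x Bx; have [ O [g [oO Ox Hg fg]]] := Hf x (BA _ Bx).
by exists O, g; split=> // y Oy /BA Ay; exact: fg.
Qed.

Lemma smooth_on_eq V W (A : set V) (f g : V -> W) :
  (forall x, A x -> f x = g x) -> smooth_on A f -> smooth_on A g.
Proof.
move=> fg Hf x Ax; have [ O [h [oO Ox Hh fh]]] := Hf x Ax.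
by exists O, h; split=> // y Oy Ay; rewrite -fg ?fh.
Qed.

Lemma smooth_on_local V W (A : set V) (f : V -> W) :
  (forall x, A x -> exists O, [/\ open O, O x & smooth_on (A `&` O) f]) ->
  smooth_on A f.
Proof.
move=> H x Ax; have [ O [oO Ox Hf]] := H x Ax.
have [U [g [oU Ux Hg fg]]] := Hf x (conj Ax Ox).
exists (O `&` U), g; split; [exact: openI|by []| |].
  by move=> n; apply: Cn_sub (Hg n) => y [].
by move=> y [Oy Uy] Ay; apply: fg.
Qed.

(** Only the values of [f] on [A] are known to lie in [P]; those of an extension may leave it, so
    its open domain is shrunk by continuity. *)
Lemma smooth_on_lift V W Z (A : set V) (P : set W) (F : W -> Z) (f : V -> W) :
  open P ->
  (forall (O : set V) g, open O -> (forall x, O x -> P (g x)) ->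
    (forall n, Cn n O g) -> forall n, Cn n O (fun x => F (g x))) ->
  (forall x, A x -> P (f x)) -> smooth_on A f -> smooth_on A (fun x => F (f x)).
Proof.
move=> oP HF fP Hf x Ax; have [ O [g [oO Ox Hg fg]]] := Hf x Ax.
have [U [oU Ux sU gP]] : exists U, [/\ open U, U x, U `<=` O &
    forall y, U y -> P (g y)].
  have : \forall y \near x, O y /\ P (g y).
    near=> y; split; first by near: y; exact: open_nbhs_nbhs.
    near: y; apply: (Cn_continuous (Hg 0%N) Ox); apply: open_nbhs_nbhs.
    by split=> //; rewrite -fg //; exact: fP.
  move=> /near_open[U [oU Ux sub]].
  by exists U; split=> // y /sub[].
exists U, (fun x => F (g x)); split=> //.
  by apply: HF => // n; exact: Cn_sub (Hg n).
by move=> y /sU Oy Ay; rewrite fg.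
Unshelve. all: by end_near. Qed.

Lemma smooth_on_common V W Z (A : set V) (f : V -> W) (g : V -> Z) x :
  smooth_on A f -> smooth_on A g -> A x ->
  exists O f' g', [/\ open O, O x, forall n, Cn n O f', forall n, Cn n O g' &
    (forall y, O y -> A y -> f y = f' y) /\ (forall y, O y -> A y -> g y = g' y)].
Proof.
move=> Hf Hg Ax; have [ O [f' [oO Ox Hf' ff']]] := Hf x Ax.
have [ O2 [g' [oO2 O2x Hg' gg']]] := Hg x Ax.
exists (O `&` O2), f', g'; split; [exact: openI|by []| | |].
- by move=> n; apply: Cn_sub (Hf' n) => y [].
- by move=> n; apply: Cn_sub (Hg' n) => y [].
- by split=> y [? ?] ?; [exact: ff'|exact: gg'].
Qed.

Lemma smooth_on_lift2 V W1 W2 Z (A : set V) (F : W1 -> W2 -> Z)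
    (f : V -> W1) (g : V -> W2) :
  (forall (O : set V) f g, open O -> (forall n, Cn n O f) ->
    (forall n, Cn n O g) -> forall n, Cn n O (fun x => F (f x) (g x))) ->
  smooth_on A f -> smooth_on A g -> smooth_on A (fun x => F (f x) (g x)).
Proof.
move=> HF Hf Hg x Ax.
have [ O [f' [g' [oO Ox Hf' Hg' [ff' gg']]]]] := smooth_on_common Hf Hg Ax.
exists O, (fun x => F (f' x) (g' x)); split=> //; first exact: HF.
by move=> y Oy Ay; rewrite ff'// gg'.
Qed.

Lemma smooth_on_cst V W (A : set V) (c : W) : smooth_on A (fun _ => c).
Proof.
move=> x _; exists setT, (fun=> c); split=> //; first exact: openT.
by move=> n; exact: Cn_cst.
Qed.

Lemma smooth_on_comp V Z (A : set V) (B : set (R * R)) (f : V -> R * R)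
    (g : R * R -> Z) :
  (forall x, A x -> B (f x)) -> smooth_on A f -> smooth_on B g ->
  smooth_on A (fun x => g (f x)).
Proof.
move=> fB Hf Hg x Ax.
have [ O [f' [oO Ox Hf' ff']]] := Hf x Ax.
have [P [g' [oP Pfx Hg' gg']]] := Hg _ (fB _ Ax).
have [U [oU Ux sU UP]] : exists U, [/\ open U, U x, U `<=` O &
    forall y, U y -> P (f' y)].
  have : \forall y \near x, O y /\ P (f' y).
    near=> y; split; first by near: y; exact: open_nbhs_nbhs.
    near: y; apply: (Cn_continuous (Hf' 0%N) Ox); apply: open_nbhs_nbhs.
    by split=> //; rewrite -ff'.
  move=> /near_open[U [oU Ux sub]].
  by exists U; split=> // y /sub[].
exists U, (fun x => g' (f' x)); split=> //.
  move=> n; apply: (@Cn_comp_pair _ _ _ oU _ n _ _ P) => //.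
  exact: Cn_sub (Hf' n).
move=> y Uy Ay; have Oy := sU _ Uy; rewrite ff'// gg'//; first exact: UP.
by rewrite -ff'//; exact: fB.
Unshelve. all: by end_near. Qed.

Section Algebra.
Variables (V : normedModType R) (A : set V).

Lemma smooth_onD W (f g : V -> W) :
  smooth_on A f -> smooth_on A g -> smooth_on A (fun x => f x + g x).
Proof.
by apply: (smooth_on_lift2 (F := +%R)) => O f' g' oO H1 H2 n; exact: CnD.
Qed.

Lemma smooth_onB W (f g : V -> W) :
  smooth_on A f -> smooth_on A g -> smooth_on A (fun x => f x - g x).
Proof.
by apply: (smooth_on_lift2 (F := fun a b => a - b)) => O f' g' oO H1 H2 n; exact: CnB.
Qed.

Lemma smooth_on_scale W (k : V -> R) (f : V -> W) :
  smooth_on A k -> smooth_on A f -> smooth_on A (fun x => k x *: f x).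
Proof.
by apply: (@smooth_on_lift2 V R W W A (fun a b => a *: b)) => O f' g' oO H1 H2 n; exact: Cn_scale.
Qed.

Lemma smooth_onM (f g : V -> R) :
  smooth_on A f -> smooth_on A g -> smooth_on A (fun x => f x * g x).
Proof. exact: smooth_on_scale. Qed.

Lemma smooth_onN W (f : V -> W) : smooth_on A f -> smooth_on A (fun x => - f x).
Proof.
apply: (smooth_on_lift (P := setT)) => //; first exact: openT.
by move=> O g oO _ Hg n; exact: CnN.
Qed.

Lemma smooth_on_sum W I (r : seq I) (f : I -> V -> W) :
  (forall i, smooth_on A (f i)) -> smooth_on A (fun x => \sum_(i <- r) f i x).
Proof.
move=> H; elim: r => [|i r IH].
  by apply: (smooth_on_eq _ (smooth_on_cst (0 : W))) => x _; rewrite big_nil.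
by apply: (smooth_on_eq _ (smooth_onD (H i) IH)) => x _; rewrite big_cons.
Qed.

Lemma smooth_onV (f : V -> R) : (forall x, A x -> f x != 0) ->
  smooth_on A f -> smooth_on A (fun x => (f x)^-1).
Proof.
apply: (smooth_on_lift (P := [set x | x != 0])); first exact: open_neq.
by move=> O g oO g0 Hg n; exact: CnV.
Qed.

Lemma smooth_on_sqrt (f : V -> R) : (forall x, A x -> 0 < f x) ->
  smooth_on A f -> smooth_on A (fun x => Num.sqrt (f x)).
Proof.
apply: (smooth_on_lift (P := [set x : R | 0 < x]) (F := Num.sqrt)); first exact: open_gt.
by move=> O g oO g0 Hg n; exact: Cn_sqrt.
Qed.

Lemma smooth_on_coord n (f : V -> 'rV[R]_n) i :
  smooth_on A f -> smooth_on A (fun x => f x 0 i).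
Proof.
apply: (smooth_on_lift (P := setT) (F := fun u : 'rV[R]_n => u 0 i)) => //.
  exact: openT.
by move=> O g oO _ Hg m; exact: Cn_coord.
Qed.

Lemma smooth_on_fst (f : V -> R * R) :
  smooth_on A f -> smooth_on A (fun x => (f x).1).
Proof.
apply: (smooth_on_lift (P := setT) (F := fst)) => //; first exact: openT.
by move=> O g oO _ Hg m; exact: Cn_fst.
Qed.

Lemma smooth_on_snd (f : V -> R * R) :
  smooth_on A f -> smooth_on A (fun x => (f x).2).
Proof.
apply: (smooth_on_lift (P := setT) (F := snd)) => //; first exact: openT.
by move=> O g oO _ Hg m; exact: Cn_snd.
Qed.

Lemma smooth_on_row n (f : V -> 'I_n -> R) : (forall i, smooth_on A (f ^~ i)) ->
  smooth_on A (fun x => \row_i f x i).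
Proof.
move=> H; apply: (@smooth_on_eq _ _ _ (fun x => \sum_i f x i *: delta_mx 0 i)).
  move=> x _; rewrite [RHS]row_sum_delta; apply: eq_bigr => i _.
  by rewrite mxE.
by apply: smooth_on_sum => i; apply: smooth_on_scale => //; exact: smooth_on_cst.
Qed.

End Algebra.

End SmoothOn.

(** * Derivatives in a half-plane *)

Section DeriveIn.
Context {R : realType}.
Implicit Types V W Z : normedModType R.

Lemma cvg_line V (x v : V) : (fun h : R => h *: v + x) @ (0 : R) --> x.
Proof.
rewrite -[X in _ --> X]add0r -[X in _ --> X + _](scale0r v).
by apply: cvgD; [exact: cvgZr_tmp|exact: cvg_cst].
Qed.

(** Makes the filter of increments in [derive_in] proper; along an improper filter the limit would
    carry no information. *)
Definition approachable V (A : set V) (x v : V) :=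
  forall e : R, 0 < e -> exists h : R, [/\ h != 0, `|h| < e & A (h *: v + x)].

(** The difference quotients within [A] are eventually those of the extension, so every extension
    has the same derivative; [approachable] gives uniqueness of the limit. *)
Lemma derive_inE V W (A U : set V) (f g : V -> W) x v :
  open U -> U x -> A x -> (forall y, U y -> A y -> f y = g y) ->
  differentiable g x -> approachable A x v -> derive_in A f x v = 'D_v g x.
Proof.
move=> oU Ux Ax fg dg ap.
have PF : ProperFilter (within [set h : R | A (h *: v + x)] 0^').
  apply: Build_ProperFilter_ex => P; rewrite /within/= /dnbhs/within/=.
  move=> /nbhs_ballP[e /= e0 He].
  have [h [h0 he Ah]] := ap e e0.
  exists h; apply: He => //; rewrite /ball/= sub0r normrN //.
apply/cvg_lim => //.
have Dg : (fun h : R => h^-1 *: (g (h *: v + x) - g x)) @ 0^' --> 'D_v g x.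
  exact: (@diff_derivable _ _ _ g x v dg).
apply: cvg_trans (cvg_within_filter _ Dg); apply: near_eq_cvg.
have nU : \forall h \near (0 : R), U (h *: v + x).
  by apply: cvg_line; apply: open_nbhs_nbhs.
rewrite /within/= /dnbhs/within/=; apply: filterS nU => h Uh _ Ah.
by rewrite /= !fg.
Qed.

Definition relopen (A : set (R * R)) :=
  exists2 U : set (R * R), open U & A = U `&` @halfplane R.

Lemma relopenIopen (A U : set (R * R)) : relopen A -> open U -> relopen (A `&` U).
Proof.
move=> [U' oU' ->] oU; exists (U `&` U'); first exact: openI.
by rewrite setIC setIA.
Qed.

(** Increments of both signs are allowed in [derive_in]: at a boundary point a positive one stays in
    the half-plane if [v.2 >= 0], a negative one if [v.2 < 0]. *)
Lemma relopen_approachable A x v : relopen A -> A x -> approachable A x v.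
Proof.
move=> [U oU ->] [Ux x2] e e0.
have /nbhs_ballP[d /= d0 Hd] : \forall h \near (0 : R), U (h *: v + x).
  by apply: cvg_line; apply: open_nbhs_nbhs.
have [m [m0 me md]] : exists m : R, [/\ 0 < m, m < e & m < d].
  exists (Num.min d e / 2).
  have m0 : 0 < Num.min d e by rewrite lt_min d0 e0.
  have me : Num.min d e <= e by rewrite ge_min lexx orbT.
  have md : Num.min d e <= d by rewrite ge_min lexx.
  by split; lra.
have [v2|v2] := leP 0 v.2.
  exists m; split; [by rewrite gt_eqF|by rewrite gtr0_norm|split].
    by apply: Hd; rewrite /ball/= sub0r normrN gtr0_norm.
  by rewrite /halfplane/= addr_ge0// mulr_ge0// ltW.
exists (- m); split; [by rewrite oppr_eq0 gt_eqF|by rewrite normrN gtr0_norm|split].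
  by apply: Hd; rewrite /ball/= sub0r opprK gtr0_norm.
by rewrite /halfplane/= addr_ge0// mulr_le0// ?oppr_le0 ltW.
Qed.

End DeriveIn.

(** * Symmetry of second derivatives *)

Section Schwarz.
Context {R : realType}.
Implicit Types V : normedModType R.

(* The second difference of [g] along [u] and [v] is [h^2 D_v D_u g + o(h^2)],
   by the mean value theorem along [u], and it is symmetric in [u] and [v]. *)
Lemma second_difference V (O : set V) (g : V -> R) x u v : open O -> O x ->
  (forall y, O y -> differentiable g y) -> differentiable ('D_u g) x ->
  forall e : R, 0 < e -> \forall h \near (0 : R)^'+,
  `|g (h *: u + h *: v + x) - g (h *: u + x) - g (h *: v + x) + g x -
    h ^+ 2 * 'D_v ('D_u g) x| <= e * h ^+ 2.
Proof.
move=> oO Ox dg dDg e e0.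
(* [C] controls the increments: [s *: u + t *: v] has norm at most [h * C] for [s] and [t] in
   [[0, h]]. The tolerance [e / (2 * C)] then makes each of the two errors at most [e / 2 * h]. *)
pose C := `|u| + `|v| + 1.
have C0 : 0 < C by rewrite /C ltr_wpDl// addr_ge0.
have [d d0 Hd] : exists2 d : R, 0 < d & forall w, `|w| < d -> O (w + x) /\
    `|'D_u g (w + x) - ('D_u g x + 'd ('D_u g) x w)| <= e / (2 * C) * `|w|.
  have e'0 : 0 < e / (2 * C) by rewrite divr_gt0// mulr_gt0.
  have H1 := differentiable_eps dDg e'0.
  have H2 : \forall w \near (0 : V), O (w + x).
    have : \forall y \near x, O y by exact: open_nbhs_nbhs.
    by rewrite (near_shift 0)/= subr0.
  have /nbhs_ballP[d /= d0 Hd] : \forall w \near (0 : V), O (w + x) /\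
    `|'D_u g (w + x) - ('D_u g x + 'd ('D_u g) x w)| <= e / (2 * C) * `|w|.
    by near=> w; split; near: w.
  exists d => // w wd; apply: Hd.
  by rewrite -ball_normE /ball_/= sub0r normrN.
near=> h.
have h0 : 0 < h by near: h; exact: nbhs_right_gt.
have hd : h * C < d.
  by rewrite -ltr_pdivlMr//; near: h; apply: nbhs_right_lt; rewrite divr_gt0.
have small s t : 0 <= s <= h -> 0 <= t <= h -> `|s *: u + t *: v| <= h * C.
  move=> /andP[s0 sh] /andP[t0 th].
  rewrite (le_trans (ler_normD _ _))// !normrZ !ger0_norm// /C !mulrDr mulr1.
  have := ler_wpM2r (normr_ge0 u) sh; have := ler_wpM2r (normr_ge0 v) th; lra.
pose phi s := g (s *: u + (h *: v + x)) - g (s *: u + x).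
pose dphi s := 'D_u g (s *: u + (h *: v + x)) - 'D_u g (s *: u + x).
have dline w s : O (s *: u + w) ->
    is_derive s 1 (fun s => g (s *: u + w)) ('D_u g (s *: u + w)).
  move=> Os.
  have dl : differentiable (fun s : R => s *: u + w) s.
    by apply: differentiableD; [exact: differentiableZl|exact: differentiable_cst].
  have E : 'D_1 (fun s : R => s *: u + w) s = u.
    rewrite deriveD; [|exact: diff_derivable (differentiableZl _ _)|exact: derivable_cst].
    rewrite derive_cst addr0 deriveE; last exact: differentiableZl.
    by rewrite diffZl// diff_val scale1r.
  have dg' := dg _ Os.
  apply: DeriveDef.
    apply: diff_derivable; exact: (differentiable_comp dl dg').
  by have := derive_comp (1 : R) dl dg'; rewrite E.
have Os t s : t = 0 \/ t = h -> 0 <= s <= h -> O (s *: u + (t *: v + x)).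
  move=> th sh; rewrite addrA; apply: (Hd _ _).1.
  apply: le_lt_trans hd; apply: small => //.
  by case: th => ->; rewrite ?lexx ?ltW.
have Os0 s : 0 <= s <= h -> O (s *: u + x).
  by move=> /(Os 0 s (or_introl erefl)); rewrite scale0r add0r.
have Dphi s : 0 <= s <= h -> is_derive s 1 phi (dphi s).
  move=> sh; apply: is_deriveB.
    by apply: dline; apply: Os => //; right.
  by apply: dline; exact: Os0.
have [c /andP[c0 ch]] : exists2 c, 0 < c < h & phi h - phi 0 = dphi c * (h - 0).
  have [] := @MVT R phi dphi 0 h h0.
  - move=> s; rewrite in_itv/= => /andP[s0 sh].
    by apply: Dphi; rewrite !ltW.
  - apply: derivable_within_continuous => s; rewrite in_itv/= => sh.
    by have [] := Dphi s sh.
  - by move=> c; rewrite in_itv/= => ch E; exists c.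
rewrite /phi !scale0r !add0r subr0 => E.
have -> : g (h *: u + h *: v + x) - g (h *: u + x) - g (h *: v + x) + g x =
    dphi c * h by rewrite -E addrA; ring.
have cc : 0 <= c <= h by rewrite !ltW.
have hh : 0 <= h <= h by rewrite lexx ltW.
have zz : (0:R) <= 0 <= h by rewrite lexx ltW.
have S1 := small c h cc hh; have S2 := small c 0 cc zz.
rewrite scale0r addr0 in S2.
have [_ H1] := Hd _ (le_lt_trans S1 hd); have [_ H2] := Hd _ (le_lt_trans S2 hd).
have P : 0 <= e / (2 * C) by rewrite ltW// divr_gt0// mulr_gt0.
have K : e / (2 * C) * (h * C) = e / 2 * h by field; exact: lt0r_neq0.
have E1 : e / (2 * C) * `|c *: u + h *: v| <= e / 2 * h.
  by rewrite -K ler_wpM2l.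
have E2 : e / (2 * C) * `|c *: u| <= e / 2 * h.
  by rewrite -K ler_wpM2l.
have {E1} H1 := le_trans H1 E1; have {E2} H2 := le_trans H2 E2.
have -> : dphi c * h - h ^+ 2 * 'D_v ('D_u g) x =
    h * (dphi c - h * 'D_v ('D_u g) x) by ring.
rewrite normrM (gtr0_norm h0).
have -> : e * h ^+ 2 = h * (e * h) by ring.
rewrite ler_pM2l// /dphi (deriveE v dDg) addrA.
have L1 : 'd ('D_u g) x (c *: u + h *: v) =
    c * 'd ('D_u g) x u + h * 'd ('D_u g) x v by rewrite linearD !linearZ.
have L2 : 'd ('D_u g) x (c *: u) = c * 'd ('D_u g) x u by rewrite linearZ.
move: H1 H2; rewrite L1 L2.
set A := 'D_u g _; set B := 'D_u g _; set D := 'D_u g _.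
move=> H1 H2.
have -> : A - D - h * 'd ('D_u g) x v = 
  (A - (B + (c * 'd ('D_u g) x u + h * 'd ('D_u g) x v))) -
  (D - (B + c * 'd ('D_u g) x u)) by ring.
rewrite (le_trans (ler_normB _ _))// (le_trans (lerD H1 H2))//; lra.
Unshelve. all: by end_near. Qed.

Lemma close_quotients (t a b k e : R) : 0 < k -> `|t - k * a| <= e * k ->
  `|t - k * b| <= e * k -> `|b - a| <= 2 * e.
Proof.
move=> k0 Ha Hb; rewrite -(ler_pM2l k0) -{1}(gtr0_norm k0) -normrM.
have -> : k * (b - a) = (t - k * a) - (t - k * b) by ring.
by rewrite (le_trans (ler_normB _ _))// (le_trans (lerD Ha Hb))//; lra.
Qed.

(** Both iterated derivatives approximate the same symmetric second difference, so they differ by at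
    most [2 * e], while [e] is a quarter of their assumed distance. *)
Lemma derive_comm V (O : set V) (g : V -> R) x u v : open O -> O x ->
  Cn 2 O g -> 'D_u ('D_v g) x = 'D_v ('D_u g) x.
Proof.
move=> oO Ox /CnSP[dg H].
have dD w : differentiable ('D_w g) x by have [dDg _] := CnSP (H w); exact: dDg.
apply/eqP/negPn/negP => ne.
pose e := `|'D_u ('D_v g) x - 'D_v ('D_u g) x| / 4.
have e0 : 0 < e by rewrite divr_gt0// normr_gt0 subr_eq0.
have Huv := second_difference (u := u) v oO Ox dg (dD u) e0.
have Hvu := second_difference (u := v) u oO Ox dg (dD v) e0.
have [h [[H1 H2] h0]] :=
  filter_ex (filterI (filterI Huv Hvu) (nbhs_right_gt (0 : R))).
rewrite /= in h0.
move: H2; rewrite (addrC (h *: v)); set S := g _; set A := g _; set B := g _.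
rewrite -[S - A - B]addrA -[- A - B]opprD (addrC A) opprD addrA => H2.
have h2 : 0 < h ^+ 2 by rewrite exprn_gt0.
have := close_quotients h2 H1 H2.
have -> : `|'D_u ('D_v g) x - 'D_v ('D_u g) x| = 4 * e by rewrite /e; field.
by clear -e0; lra.
Qed.

End Schwarz.

Section SmoothVectors.
Context {R : realType} (V : normedModType R) (A : set V).

Lemma smooth_on_dot (f g : V -> 'rV[R]_3) :
  smooth_on A f -> smooth_on A g -> smooth_on A (fun x => dot (f x) (g x)).
Proof.
move=> Hf Hg; apply: (smooth_on_eq (f := fun x => f x 0 0 * g x 0 0 +
  f x 0 1 * g x 0 1 + f x 0 2 * g x 0 2)) => [x _|]; first by rewrite dotE.
by do 2?[apply: smooth_onD]; apply: smooth_onM; exact: smooth_on_coord.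
Qed.

Lemma smooth_on_cross (f g : V -> 'rV[R]_3) :
  smooth_on A f -> smooth_on A g -> smooth_on A (fun x => cross (f x) (g x)).
Proof.
move=> Hf Hg; apply: (@smooth_on_row _ _ _ _ (fun x k =>
  f x 0 (k + 1) * g x 0 (k + 2) - f x 0 (k + 2) * g x 0 (k + 1))) => k.
by apply: smooth_onB; apply: smooth_onM; exact: smooth_on_coord.
Qed.

Lemma smooth_on_normalize (f : V -> 'rV[R]_3) : (forall x, A x -> f x != 0) ->
  smooth_on A f -> smooth_on A (fun x => normalize (f x)).
Proof.
move=> f0 Hf; apply: smooth_on_scale => //; apply: smooth_onV.
  by move=> x Ax; rewrite gt_eqF// enorm_gt0// f0.
apply: smooth_on_sqrt; last exact: smooth_on_dot.
by move=> x Ax; rewrite dotvv_gt0// f0.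
Qed.

End SmoothVectors.

(** * Calculus of derivatives on relatively open sets *)

Section DeriveRules.
Context {R : realType} (A : set (R * R)) (rA : relopen A).
Implicit Types V W Z : normedModType R.

Lemma derive_in_ext W (f g : R * R -> W) U x v : open U -> U x -> A x ->
  (forall y, U y -> A y -> f y = g y) -> differentiable g x ->
  derive_in A f x v = 'D_v g x.
Proof.
by move=> oU Ux Ax fg dg; apply: (derive_inE oU Ux Ax fg dg (relopen_approachable v rA Ax)).
Qed.

(** A single extension computes [derive_in] at all nearby points of [A], hence iterated derivatives
    as well. The rules below are transported from open sets through it. *)
Lemma smooth_on_extend W (f : R * R -> W) x : smooth_on A f -> A x ->
  exists U g, [/\ open U, U x, forall n, Cn n U g,
    forall y, U y -> A y -> f y = g y &
    forall y v, U y -> A y -> derive_in A f y v = 'D_v g y].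
Proof.
move=> Hf Ax; have [U [g [oU Ux Hg fg]]] := Hf x Ax.
exists U, g; split=> // y v Uy Ay; apply: (derive_in_ext v oU Uy Ay fg).
by have [dg _] := CnSP (Hg 1%N); exact: dg.
Qed.

Lemma smooth_on_extend2 W Z (f : R * R -> W) (h : R * R -> Z) x :
  smooth_on A f -> smooth_on A h -> A x ->
  exists U g k, [/\ [/\ open U, U x & (differentiable g x /\ differentiable k x)],
    forall y, U y -> A y -> f y = g y, forall y, U y -> A y -> h y = k y,
    forall v, derive_in A f x v = 'D_v g x & forall v, derive_in A h x v = 'D_v k x].
Proof.
move=> Hf Hh Ax; have [U [g [oU Ux Hg fg Dg]]] := smooth_on_extend Hf Ax.
have [U' [k [oU' Ux' Hk hk Dk]]] := smooth_on_extend Hh Ax.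
exists (U `&` U'), g, k; split=> [||||v].
- split; [exact: openI|by []|].
  have [dg _] := CnSP (Hg 1%N); have [dk _] := CnSP (Hk 1%N).
  by split; [exact: dg|exact: dk].
- by move=> y [Uy _]; exact: fg.
- by move=> y [_ Uy]; exact: hk.
- by move=> v; exact: Dg.
- exact: Dk.
Qed.

Lemma smooth_on_derive W (f : R * R -> W) v :
  smooth_on A f -> smooth_on A (fun x => derive_in A f x v).
Proof.
move=> Hf x Ax; have [U [g [oU Ux Hg fg Dg]]] := smooth_on_extend Hf Ax.
exists U, ('D_v g); split=> // [n|y Uy Ay]; last exact: Dg.
by have [_] := CnSP (Hg n.+1).
Qed.

Lemma derive_in_eq W (f g : R * R -> W) x v : (forall y, A y -> f y = g y) ->
  A x -> derive_in A f x v = derive_in A g x v.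
Proof.
move=> fg Ax; rewrite /derive_in; congr (lim _).
rewrite eqEsubset; split; apply: near_eq_cvg; rewrite near_withinE;
  near=> h => /= Ah; by rewrite !fg.
Unshelve. all: by end_near. Qed.

Lemma derive_in_linear W (f : R * R -> W) x a u v : smooth_on A f -> A x ->
  derive_in A f x (a *: u + v) = a *: derive_in A f x u + derive_in A f x v.
Proof.
move=> Hf Ax; have [U [g [oU Ux Hg fg Dg]]] := smooth_on_extend Hf Ax.
rewrite !Dg// derive_linear//.
by have [dg _] := CnSP (Hg 1%N); exact: dg.
Qed.

Lemma derive_in_frame W (f : R * R -> W) x v : smooth_on A f -> A x ->
  derive_in A f x v =
  v.1 *: derive_in A f x (frame R 0) + v.2 *: derive_in A f x (frame R 1).
Proof.
move=> Hf Ax; rewrite {1}(frame_decomp v) derive_in_linear//; congr (_ + _).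
rewrite -[_ *: frame R 1]addr0 derive_in_linear//.
have := derive_in_linear (-1) 0 0 Hf Ax.
by rewrite !scaleN1r oppr0 addr0 addNr => ->; rewrite addr0.
Qed.

Lemma derive_in_cst W (c : W) x v : A x -> derive_in A (fun _ => c) x v = 0.
Proof.
move=> Ax; rewrite (@derive_in_ext _ _ (fun _ => c) setT)//.
- exact: derive_cst.
- exact: openT.
Qed.

Lemma derive_inD W (f g : R * R -> W) x v :
  smooth_on A f -> smooth_on A g -> A x ->
  derive_in A (fun x => f x + g x) x v = derive_in A f x v + derive_in A g x v.
Proof.
move=> Hf Hg Ax.
have [U [f' [g' [[oU Ux [df dg]] ff gg Df Dg]]]] := smooth_on_extend2 Hf Hg Ax.
rewrite Df Dg (@derive_in_ext _ _ (fun x => f' x + g' x) U)//.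
- by apply: deriveD; exact: diff_derivable.
- by move=> y Uy Ay; rewrite ff// gg.
- exact: differentiableD.
Qed.

Lemma derive_in_scale W (k : R * R -> R) (f : R * R -> W) x v :
  smooth_on A k -> smooth_on A f -> A x ->
  derive_in A (fun x => k x *: f x) x v =
  k x *: derive_in A f x v + derive_in A k x v *: f x.
Proof.
move=> Hf Hg Ax.
have [U [f' [g' [[oU Ux [df dg]] ff gg Df Dg]]]] := smooth_on_extend2 Hf Hg Ax.
have [ds Ds] := differentiable_scale df dg.
rewrite Df Dg (@derive_in_ext _ _ (fun x => f' x *: g' x) U)//.
  by rewrite Ds ff// gg.
by move=> y Uy Ay; rewrite ff// gg.
Qed.

Lemma derive_inM (f g : R * R -> R) x v :
  smooth_on A f -> smooth_on A g -> A x ->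
  derive_in A (fun x => f x * g x) x v =
  f x * derive_in A g x v + derive_in A f x v * g x.
Proof. exact: derive_in_scale. Qed.

Lemma derive_inN W (f : R * R -> W) x v : smooth_on A f -> A x ->
  derive_in A (fun x => - f x) x v = - derive_in A f x v.
Proof.
move=> Hf Ax.
have -> : (fun x => - f x) = (fun x => (fun _ => -1 : R) x *: f x).
  by apply/funext => y; rewrite scaleN1r.
rewrite derive_in_scale//; last exact: smooth_on_cst.
by rewrite derive_in_cst// scale0r addr0 scaleN1r.
Qed.

Lemma derive_inB W (f g : R * R -> W) x v :
  smooth_on A f -> smooth_on A g -> A x ->
  derive_in A (fun x => f x - g x) x v = derive_in A f x v - derive_in A g x v.
Proof.
move=> Hf Hg Ax; rewrite derive_inD//; last exact: smooth_onN.
by rewrite derive_inN.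
Qed.

Lemma derive_in_compose W Z (f : R * R -> W) (F : W -> Z) x v :
  smooth_on A f -> A x -> differentiable F (f x) ->
  derive_in A (fun x => F (f x)) x v = 'D_(derive_in A f x v) F (f x).
Proof.
move=> Hf Ax; have [U [g [oU Ux Hg fg Dg]]] := smooth_on_extend Hf Ax.
have dg : differentiable g x by have [dg _] := CnSP (Hg 1%N); exact: dg.
rewrite fg// Dg// => dF; rewrite (@derive_in_ext _ _ (F \o g) U)//.
- exact: derive_comp.
- by move=> y Uy Ay /=; rewrite fg.
- exact: differentiable_comp.
Qed.

Lemma derive_in_coord n (f : R * R -> 'rV[R]_n) i x v : smooth_on A f -> A x ->
  derive_in A (fun x => f x 0 i) x v = (derive_in A f x v) 0 i.
Proof.
move=> Hf Ax.
have dc u : differentiable (row_coord i : 'rV[R]_n -> R) u.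
  by apply: linear_differentiable; exact: row_coord_continuous.
rewrite -[LHS]/(derive_in A (fun x => row_coord i (f x)) x v).
rewrite derive_in_compose// deriveE// diff_lin//.
exact: row_coord_continuous.
Qed.

Lemma derive_in_dot (f g : R * R -> 'rV[R]_3) x v :
  smooth_on A f -> smooth_on A g -> A x ->
  derive_in A (fun x => dot (f x) (g x)) x v =
  dot (derive_in A f x v) (g x) + dot (f x) (derive_in A g x v).
Proof.
move=> Hf Hg Ax; rewrite (derive_in_eq (g := fun x => f x 0 0 * g x 0 0 +
  f x 0 1 * g x 0 1 + f x 0 2 * g x 0 2))//; last by move=> y _; rewrite dotE.
have Hf' := @smooth_on_coord _ _ A _ f _ Hf; have Hg' := @smooth_on_coord _ _ A _ g _ Hg.
rewrite !derive_inD// ?derive_inM ?derive_in_coord//;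
  do ?[by do 3?[apply: smooth_onD|apply: smooth_onM]].
rewrite !dotE; ring.
Qed.

Lemma derive_in_cross (f g : R * R -> 'rV[R]_3) x v :
  smooth_on A f -> smooth_on A g -> A x ->
  derive_in A (fun x => cross (f x) (g x)) x v =
  cross (derive_in A f x v) (g x) + cross (f x) (derive_in A g x v).
Proof.
move=> Hf Hg Ax; apply/rowP => k.
rewrite -derive_in_coord//; last exact: smooth_on_cross.
rewrite (derive_in_eq (g := fun x => f x 0 (k + 1) * g x 0 (k + 2) -
  f x 0 (k + 2) * g x 0 (k + 1)))//; last by move=> y _; rewrite mxE.
have Hf' := @smooth_on_coord _ _ A _ f _ Hf; have Hg' := @smooth_on_coord _ _ A _ g _ Hg.
rewrite derive_inB// ?derive_inM ?derive_in_coord//; do ?[exact: smooth_onM].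
rewrite !mxE; ring.
Qed.

(** Chain rule for transition maps; the domain of the inner extension is shrunk until its image lies
    in the domain of the outer one. *)
Lemma derive_in_comp W (B : set (R * R)) (phi : R * R -> R * R)
    (f : R * R -> W) x v : relopen B -> (forall x, A x -> B (phi x)) ->
  smooth_on A phi -> smooth_on B f -> A x ->
  derive_in A (fun x => f (phi x)) x v =
  derive_in B f (phi x) (derive_in A phi x v).
Proof.
move=> rB AB Hphi Hf Ax.
have [U [g [oU Ux Hg fg Dg]]] := smooth_on_extend Hphi Ax.
have [P [k [oP Pfx Hk fk]]] := Hf _ (AB _ Ax).
have dg : differentiable g x by have [dg _] := CnSP (Hg 1%N); exact: dg.
have dk : differentiable k (phi x) by have [dk _] := CnSP (Hk 1%N); exact: dk.
rewrite (derive_inE oP Pfx (AB _ Ax) fk dk); last first.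
  by apply: relopen_approachable => //; exact: AB.
rewrite fg// in Pfx dk *; rewrite Dg//.
have [U' [oU' U'x U'U U'P]] : exists U', [/\ open U', U' x, U' `<=` U &
    forall y, U' y -> P (g y)].
  have : \forall y \near x, U y /\ P (g y).
    near=> y; split; first by near: y; exact: open_nbhs_nbhs.
    by near: y; apply: (Cn_continuous (Hg 0%N) Ux); apply: open_nbhs_nbhs.
  by move=> /near_open[U' [? ? sub]]; exists U'; split=> // y /sub[].
rewrite (@derive_in_ext _ _ (k \o g) U')//.
- exact: derive_comp.
- move=> y U'y Ay /=; have Uy := U'U _ U'y.
  by rewrite fg// fk//; [exact: U'P|rewrite -fg//; exact: AB].
- exact: differentiable_comp.
Unshelve. all: by end_near. Qed.

Lemma derive_in_sub W (B : set (R * R)) (f : R * R -> W) x v : relopen B ->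
  A `<=` B -> smooth_on B f -> A x -> derive_in A f x v = derive_in B f x v.
Proof.
move=> rB AB Hf Ax; have [P [k [oP Px Hk fk]]] := Hf _ (AB _ Ax).
have dk : differentiable k x by have [dk _] := CnSP (Hk 1%N); exact: dk.
rewrite (derive_inE oP Px (AB _ Ax) fk dk); last first.
  by apply: relopen_approachable => //; exact: AB.
by rewrite (@derive_in_ext _ _ k P)// => y Py /AB By; exact: fk.
Qed.

Lemma derive_in_comm (f : R * R -> R) x u v : smooth_on A f -> A x ->
  derive_in A (fun y => derive_in A f y u) x v =
  derive_in A (fun y => derive_in A f y v) x u.
Proof.
move=> Hf Ax; have [U [g [oU Ux Hg fg Dg]]] := smooth_on_extend Hf Ax.
have [_ Hg'] := CnSP (Hg 2%N).
have dg w : differentiable ('D_w g) x by have [dg _] := CnSP (Hg' w); exact: dg.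
have E a b : derive_in A (fun y => derive_in A f y a) x b = 'D_b ('D_a g) x.
  exact: (derive_in_ext b oU Ux Ax (fun y Uy Ay => Dg y a Uy Ay) (dg a)).
rewrite !E; exact: (derive_comm v u oU Ux (Hg 2%N)).
Qed.

Lemma derive_in_comm_row n (f : R * R -> 'rV[R]_n) x u v : smooth_on A f -> A x ->
  derive_in A (fun y => derive_in A f y u) x v =
  derive_in A (fun y => derive_in A f y v) x u.
Proof.
move=> Hf Ax; apply/rowP => i.
have H w y : A y -> (derive_in A f y w) 0 i = derive_in A (fun y => f y 0 i) y w.
  by move=> Ay; rewrite derive_in_coord.
have E a b : (derive_in A (fun y => derive_in A f y a) x b) 0 i =
    derive_in A (fun y => derive_in A (fun y => f y 0 i) y a) x b.
  rewrite -(derive_in_coord i b (smooth_on_derive a Hf) Ax).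
  exact: derive_in_eq (H a) Ax.
exact: etrans (etrans (E u v) (derive_in_comm u v (smooth_on_coord i Hf) Ax))
  (esym (E v u)).
Qed.

End DeriveRules.

#[local] Opaque derive_in frame.

(** * Envelopes in a chart *)

(* Locked, because comparing two partial derivatives by unfolding them is very
   expensive. *)
HB.lock Definition pd0 (R : realType) (W : normedModType R) (A : set (R * R))
  (f : R * R -> W) (x : R * R) : W := derive_in A f x (frame R 0).
HB.lock Definition pd1 (R : realType) (W : normedModType R) (A : set (R * R))
  (f : R * R -> W) (x : R * R) : W := derive_in A f x (frame R 1).

Lemma pd0E (R : realType) (W : normedModType R) (A : set (R * R))
  (f : R * R -> W) x : derive_in A f x (frame R 0) = pd0 A f x.
Proof. by rewrite pd0.unlock. Qed.

Lemma pd0_fun (R : realType) (W : normedModType R) (A : set (R * R))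
  (f : R * R -> W) : (fun x => derive_in A f x (frame R 0)) = pd0 A f.
Proof. by apply/funext => x; rewrite pd0E. Qed.

Lemma pd1E (R : realType) (W : normedModType R) (A : set (R * R))
  (f : R * R -> W) x : derive_in A f x (frame R 1) = pd1 A f x.
Proof. by rewrite pd1.unlock. Qed.

Lemma pd1_fun (R : realType) (W : normedModType R) (A : set (R * R))
  (f : R * R -> W) : (fun x => derive_in A f x (frame R 1)) = pd1 A f.
Proof. by apply/funext => x; rewrite pd1E. Qed.

Section ChartGeometry.
Context {R : realType} (A : set (R * R)) (rA : relopen A).
Variable n : R * R -> 'rV[R]_3.

Local Notation pd0 := (pd0 A).
Local Notation pd1 := (pd1 A).

(** The signed area density of the round metric pulled back by [n]. When [n] is the Gauss map of an
    immersion read in an oriented chart, its sign is that of the Gauss curvature. *)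
Definition jac x := dot (n x) (cross (pd0 n x) (pd1 n x)).

(* The surface with Gauss map [n] and support function [u]. *)
Definition envelope (u : R * R -> R) x : 'rV[R]_3 :=
  (jac x)^-1 *: (u x *: cross (pd0 n x) (pd1 n x) +
    pd0 u x *: cross (pd1 n x) (n x) + pd1 u x *: cross (n x) (pd0 n x)).

Definition mixed (f g : R * R -> R) x :=
  dot (n x) (cross (pd0 (envelope f) x) (pd1 (envelope g) x) +
             cross (pd0 (envelope g) x) (pd1 (envelope f) x)).

Hypothesis Sn : smooth_on A n.
Hypothesis n1 : forall x, A x -> dot (n x) (n x) = 1.
Hypothesis J0 : forall x, A x -> jac x != 0.

Lemma smooth_on_pd0 (W : normedModType R) (f : R * R -> W) :
  smooth_on A f -> smooth_on A (pd0 f).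
Proof.
by rewrite -pd0_fun; exact: smooth_on_derive.
Qed.

Lemma smooth_on_pd1 (W : normedModType R) (f : R * R -> W) :
  smooth_on A f -> smooth_on A (pd1 f).
Proof.
by rewrite -pd1_fun; exact: smooth_on_derive.
Qed.

Lemma pd_comm (f : R * R -> R) x : smooth_on A f -> A x ->
  pd1 (pd0 f) x = pd0 (pd1 f) x.
Proof.
move=> Sf Ax; have := derive_in_comm rA (frame R 0) (frame R 1) Sf Ax.
by rewrite pd0_fun pd1_fun pd0E pd1E.
Qed.

Lemma pd_comm_row k (f : R * R -> 'rV[R]_k) x : smooth_on A f -> A x ->
  pd1 (pd0 f) x = pd0 (pd1 f) x.
Proof.
move=> Sf Ax; have := derive_in_comm_row rA (frame R 0) (frame R 1) Sf Ax.
by rewrite pd0_fun pd1_fun pd0E pd1E.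
Qed.

Lemma smooth_on_jac : smooth_on A jac.
Proof.
apply: smooth_on_dot => //; apply: smooth_on_cross.
  exact: smooth_on_pd0.
exact: smooth_on_pd1.
Qed.

Lemma smooth_on_envelope u : smooth_on A u -> smooth_on A (envelope u).
Proof.
move=> Su; have S0 := smooth_on_pd0 Sn; have S1 := smooth_on_pd1 Sn.
have U0 := smooth_on_pd0 Su; have U1 := smooth_on_pd1 Su.
apply: smooth_on_scale; first exact: smooth_onV J0 smooth_on_jac.
apply: smooth_onD; first apply: smooth_onD;
  apply: smooth_on_scale => //; exact: smooth_on_cross.
Qed.

Lemma smooth_on_mixed f g : smooth_on A f -> smooth_on A g ->
  smooth_on A (mixed f g).
Proof.
move=> /smooth_on_envelope Sf /smooth_on_envelope Sg.
have S0 := smooth_on_pd0 Sf; have S1 := smooth_on_pd1 Sf.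
have T0 := smooth_on_pd0 Sg; have T1 := smooth_on_pd1 Sg.
apply: smooth_on_dot => //; apply: smooth_onD; exact: smooth_on_cross.
Qed.

Lemma dot_n_derive x v : A x -> dot (n x) (derive_in A n x v) = 0.
Proof.
move=> Ax; have := derive_in_dot rA v Sn Sn Ax.
have -> : derive_in A (fun x => dot (n x) (n x)) x v = 0.
  by rewrite (derive_in_eq (g := fun=> 1 : R))// derive_in_cst.
by rewrite (dotC (derive_in A n x v)) => /eqP; rewrite -mulr2n eq_sym mulrn_eq0 => /eqP.
Qed.

Lemma dot_n_pd x : A x -> dot (n x) (pd0 n x) = 0 /\ dot (n x) (pd1 n x) = 0.
Proof. by move=> Ax; rewrite -pd0E -pd1E; split; exact: dot_n_derive. Qed.

Lemma dot_envelope u x : A x ->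
  [/\ dot (envelope u x) (n x) = u x, dot (envelope u x) (pd0 n x) = pd0 u x &
      dot (envelope u x) (pd1 n x) = pd1 u x].
Proof.
move=> Ax; have := J0 Ax; rewrite /envelope /jac.
move: (n x) (pd0 n x) (pd1 n x) => a b c j0.
by split; move: j0; rewrite !(dotE, crossE, mxE) => j0; field.
Qed.

Lemma envelope_unique u x y : A x -> dot y (n x) = u x ->
  dot y (pd0 n x) = pd0 u x -> dot y (pd1 n x) = pd1 u x -> y = envelope u x.
Proof.
move=> Ax e e0 e1; have [E E0 E1] := dot_envelope u Ax.
by apply: (cramer3_unique (J0 Ax)); rewrite ?E ?E0 ?E1.
Qed.

(** Differentiate [Y . n = u] and subtract [Y . d n = d u]. *)
Lemma derive_envelope_tangent u x : smooth_on A u -> A x ->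
  dot (n x) (pd0 (envelope u) x) = 0 /\ dot (n x) (pd1 (envelope u) x) = 0.
Proof.
move=> Su Ax; have SY := smooth_on_envelope Su.
have H v : derive_in A u x v = dot (derive_in A (envelope u) x v) (n x) +
    dot (envelope u x) (derive_in A n x v).
  rewrite -derive_in_dot//; apply: derive_in_eq => // y Ay.
  by have [-> _ _] := dot_envelope u Ay.
have [_ E0 E1] := dot_envelope u Ax.
have K v : dot (envelope u x) (derive_in A n x v) = derive_in A u x v ->
    dot (n x) (derive_in A (envelope u) x v) = 0.
  move=> e; have := H v; rewrite e => /esym/eqP.
  by rewrite -subr_eq0 addrK dotC => /eqP.
by rewrite -pd0E -pd1E; split; apply: K; rewrite ?pd0E ?pd1E.
Qed.

(** Differentiate [Y . d_0 n = d_0 u] along the second coordinate and [Y . d_1 n = d_1 u] along the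
    first: the second derivatives of [u] and [n] cancel. This is the self-adjointness of
    [D^2 u + u I]. *)
Lemma derive_envelope_sym u x : smooth_on A u -> A x ->
  dot (pd0 (envelope u) x) (pd1 n x) = dot (pd1 (envelope u) x) (pd0 n x).
Proof.
move=> Su Ax; have SY := smooth_on_envelope Su.
have E0 y (Ay : A y) : dot (envelope u y) (pd0 n y) = pd0 u y.
  by have [] := dot_envelope u Ay.
have E1 y (Ay : A y) : dot (envelope u y) (pd1 n y) = pd1 u y.
  by have [] := dot_envelope u Ay.
have H0 : pd1 (pd0 u) x = dot (pd1 (envelope u) x) (pd0 n x) +
    dot (envelope u x) (pd1 (pd0 n) x).
  rewrite -!pd1E -(derive_in_dot rA _ SY (smooth_on_pd0 Sn) Ax).
  by apply: derive_in_eq => // y /E0.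
have H1 : pd0 (pd1 u) x = dot (pd0 (envelope u) x) (pd1 n x) +
    dot (envelope u x) (pd0 (pd1 n) x).
  rewrite -!pd0E -(derive_in_dot rA _ SY (smooth_on_pd1 Sn) Ax).
  by apply: derive_in_eq => // y /E1.
have C := pd_comm Su Ax; have Cn := pd_comm_row Sn Ax.
apply: (addIr (dot (envelope u x) (pd0 (pd1 n) x))).
by rewrite -H1 -C H0 Cn.
Qed.

(* The 2-form [h det (n, dY_f, dY_g)] equals [det (Y_h, dY_f, dY_g)], because
   [dY_f] and [dY_g] are tangent; Leibniz' rule for [det (Y_h, Y_f, dY_g)] then
   exchanges [h] and [f] up to an exact form. *)
Lemma mixed_exact (f g h : R * R -> R) x : smooth_on A f -> smooth_on A g -> smooth_on A h -> A x ->
  h x * mixed f g x - f x * mixed h g x =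
  pd0 (fun y => dot (envelope h y) (cross (envelope f y) (pd1 (envelope g) y))) x -
  pd1 (fun y => dot (envelope h y) (cross (envelope f y) (pd0 (envelope g) y))) x.
Proof.
move=> Sf Sg Sh Ax.
have Yf := smooth_on_envelope Sf; have Yg := smooth_on_envelope Sg.
have Yh := smooth_on_envelope Sh.
have G0 := smooth_on_pd0 Yg; have G1 := smooth_on_pd1 Yg.
have L W v : smooth_on A W ->
  derive_in A (fun y => dot (envelope h y) (cross (envelope f y) (W y))) x v =
  dot (derive_in A (envelope h) x v) (cross (envelope f x) (W x)) +
  dot (envelope h x) (cross (derive_in A (envelope f) x v) (W x) +
    cross (envelope f x) (derive_in A W x v)).
  move=> SW; rewrite -(derive_in_cross rA v Yf SW Ax).
  by rewrite -(derive_in_dot rA v Yh (smooth_on_cross Yf SW) Ax).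
(* The second derivatives of [envelope g] in the two flux terms cancel by symmetry; what is left is
   an identity of determinants in first derivatives. *)
have C := pd_comm_row Yg Ax.
have T (u : R * R -> R) a b : smooth_on A u -> dot (n x) a = 0 -> dot (n x) b = 0 ->
    u x * dot (n x) (cross a b) = dot (envelope u x) (cross a b).
  move=> Su na nb; rewrite (det_tangent (envelope u x) (n1 Ax) na nb).
  by have [-> _ _] := dot_envelope u Ax.
have [f0 f1] := derive_envelope_tangent Sf Ax.
have [g0 g1] := derive_envelope_tangent Sg Ax.
have [h0 h1] := derive_envelope_tangent Sh Ax.
have := L _ (frame R 0) G1; have := L _ (frame R 1) G0.
rewrite !pd0E !pd1E C /mixed => -> ->.
rewrite !(dotDr, mulrDr) !T//.
move: (envelope f x) (envelope h x) => F H.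
move: (pd0 (envelope f) x) (pd1 (envelope f) x) => f_0 f_1.
move: (pd0 (envelope g) x) (pd1 (envelope g) x) => g_0 g_1.
move: (pd0 (envelope h) x) (pd1 (envelope h) x) => h_0 h_1.
vec3.
Qed.

End ChartGeometry.

(** * Charts and the round metric *)

HB.lock Definition td0 (R : realType) (S : surface R) (W : normedModType R)
  (f : S -> W) (p : S) : W := tdiff f p (frame R 0).
HB.lock Definition td1 (R : realType) (S : surface R) (W : normedModType R)
  (f : S -> W) (p : S) : W := tdiff f p (frame R 1).

Section SurfaceCharts.
Context {R : realType} (S : surface R).
Implicit Types (i : idx S) (p : S) (W : normedModType R).

Lemma td0E W (f : S -> W) p : tdiff f p (frame R 0) = td0 f p.
Proof. by rewrite td0.unlock. Qed.

Lemma td1E W (f : S -> W) p : tdiff f p (frame R 1) = td1 f p.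
Proof. by rewrite td1.unlock. Qed.

Definition crd_at p : R * R := crd (chart_at p) p.

Lemma crd_atP p : dom (chart_at p) (crd_at p) /\ par (chart_at p) (crd_at p) = p.
Proof.
have [x dx xp] := chart_atP p.
have -> : crd_at p = x by rewrite /crd_at -[in X in crd _ X]xp parK.
by [].
Qed.

Lemma dom_relopen i : relopen (dom i).
Proof. by have [U oU E] := dom_open i; exists U. Qed.

Lemma within_preimage_open (T U : topologicalType) (A : set T) (f : T -> U)
    (V : set U) : {within A, continuous f} -> open V ->
  exists2 O, open O & A `&` f @^-1` V = A `&` O.
Proof.
move=> /continuousP H oV; have := H V oV.
move=> /open_subspaceP[ O oO E].
by exists O => //; rewrite setIC -E setIC.
Qed.

Definition overlap i j := dom j `&` par j @^-1` (par i @` dom i).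

Lemma overlap_relopen i j : relopen (overlap i j).
Proof.
have [U oU E] := within_preimage_open (@par_continuous _ S j) (par_open i).
by rewrite /overlap E; apply: relopenIopen => //; exact: dom_relopen.
Qed.

Lemma tdiff_frame W (f : S -> W) p e : smooth f ->
  tdiff f p e = e.1 *: td0 f p + e.2 *: td1 f p.
Proof.
move=> Sf; rewrite -td0E -td1E; have [d _] := crd_atP p.
exact: (derive_in_frame (dom_relopen (chart_at p)) e (Sf (chart_at p)) d).
Qed.

(* The differential of the transition map between [i] and [chart_at]. *)
Lemma chart_change i x : dom i x -> exists a b : R * R, 0 < det2 a b /\
  forall W (f : S -> W), smooth f ->
    pd0 (dom i) (f \o par i) x = a.1 *: td0 f (par i x) + a.2 *: td1 f (par i x) /\
    pd1 (dom i) (f \o par i) x = b.1 *: td0 f (par i x) + b.2 *: td1 f (par i x).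
Proof.
move=> dx; set p := par i x; pose c := chart_at p.
have [dc pc] := crd_atP p.
pose B := overlap c i; have rB : relopen B by exact: overlap_relopen.
have Bx : B x by split => //; exists (crd_at p).
pose phi := crd c \o par i.
have Sphi : smooth_on B phi by move=> y; exact: transition_smooth.
have phiB y : B y -> dom c (phi y).
  by move=> [dy [z dz zy]]; rewrite /phi/= -zy parK.
have phiK y : B y -> par c (phi y) = par i y.
  by move=> [dy [z dz zy]]; rewrite /phi/= -zy parK.
exists (derive_in B phi x (frame R 0)), (derive_in B phi x (frame R 1)).
split; first by apply: (transition_oriented dx); exists (crd_at p).
move=> W f Sf.
have H v : derive_in (dom i) (f \o par i) x v = tdiff f p (derive_in B phi x v).
  rewrite -(derive_in_sub rB v (dom_relopen i) _ (Sf i) Bx); last by move=> y [].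
  rewrite (derive_in_eq (g := fun y => (f \o par c) (phi y)))//; last first.
    by move=> y By /=; rewrite phiK.
  by rewrite (derive_in_comp rB v (dom_relopen c) phiB Sphi (Sf c) Bx).
split.
  by rewrite -pd0E; apply: etrans (H (frame R 0)) _; exact: tdiff_frame.
by rewrite -pd1E; apply: etrans (H (frame R 1)) _; exact: tdiff_frame.
Qed.

End SurfaceCharts.

Lemma matrix2P (R : realType) (M N : 'M[R]_2) :
  M 0 0 = N 0 0 -> M 0 1 = N 0 1 -> M 1 0 = N 1 0 -> M 1 1 = N 1 1 -> M = N.
Proof.
have o2 (i : 'I_2) : i = 0 \/ i = 1.
  by case: i => -[|[|//]] h; [left|right]; apply/val_inj.
move=> e00 e01 e10 e11; apply/matrixP => i j.
by case: (o2 i) => ->; case: (o2 j) => ->.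
Qed.

Lemma sum2E (V : nmodType) (F : 'I_2 -> V) : \sum_i F i = F 0 + F 1.
Proof.
rewrite big_ord_recl big_ord1; congr (_ + F _); exact/val_inj.
Qed.

Lemma det2E (R : realType) (M : 'M[R]_2) :
  \det M = M 0 0 * M 1 1 - M 0 1 * M 1 0.
Proof.
rewrite (expand_det_row _ 0) sum2E /cofactor !det_mx11 !mxE/=.
rewrite expr0 expr1 mul1r mulN1r mulrN.
by congr (_ * M _ _ - _ * M _ _); exact/val_inj.
Qed.

Lemma mulmx2E (R : realType) (M N : 'M[R]_2) i j :
  (M *m N) i j = M i 0 * N 0 j + M i 1 * N 1 j.
Proof. by rewrite mxE sum2E. Qed.

Lemma invmx2E (R : realType) (M : 'M[R]_2) : \det M != 0 ->
  [/\ invmx M 0 0 = M 1 1 / \det M, invmx M 0 1 = - M 0 1 / \det M,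
      invmx M 1 0 = - M 1 0 / \det M & invmx M 1 1 = M 0 0 / \det M].
Proof.
move=> d0.
pose N : 'M[R]_2 := \matrix_(i, j)
  ((if i == 0 then if j == 0 then M 1 1 else - M 0 1
    else if j == 0 then - M 1 0 else M 0 0) / \det M).
have MN : M *m N = 1%:M.
  apply: matrix2P; rewrite mulmx2E !mxE/=; move: d0; rewrite det2E => d0; by field.
have MU : M \in unitmx by rewrite unitmxE unitfE.
have -> : invmx M = N by rewrite -[LHS]mulmx1 -MN mulKmx.
by rewrite !mxE.
Qed.

Section SphereCalculus.
Context {R : realType} (S : surface R) (nu : S -> 'rV[R]_3).
Implicit Types (i : idx S) (p : S).
Hypothesis Snu : smooth nu.
Hypothesis nu1 : forall p, dot (nu p) (nu p) = 1.
Hypothesis nuJ : forall p, dot (nu p) (cross (td0 nu p) (td1 nu p)) != 0.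

Definition gmap (f : S -> R) p : 'rV[R]_3 := grad nu f p + f p *: nu p.

Definition hessI (f : S -> R) p : 'M[R]_2 := hess nu f p + (f p)%:M.

(* [tr (adj A B)], the polarization of [2 det] *)
Definition mixdisc (f g : S -> R) p :=
  let A := hessI f p in let B := hessI g p in
  A 0 0 * B 1 1 + A 1 1 * B 0 0 - A 0 1 * B 1 0 - A 1 0 * B 0 1.

Lemma chart_unit i x : dom i x -> dot ((nu \o par i) x) ((nu \o par i) x) = 1.
Proof. by move=> _; exact: nu1. Qed.

(** The Jacobian of an oriented change of chart is positive, so the sign of [jac] depends on the
    point only. *)
Lemma chart_jac i x : dom i x -> exists a b : R * R,
  [/\ 0 < det2 a b,
    jac (dom i) (nu \o par i) x =
      det2 a b * dot (nu (par i x)) (cross (td0 nu (par i x)) (td1 nu (par i x))) &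
    forall (W : normedModType R) (f : S -> W), smooth f ->
    pd0 (dom i) (f \o par i) x = a.1 *: td0 f (par i x) + a.2 *: td1 f (par i x) /\
    pd1 (dom i) (f \o par i) x = b.1 *: td0 f (par i x) + b.2 *: td1 f (par i x)].
Proof.
move=> dx; have [a [b [ab H]]] := chart_change dx.
exists a, b; split=> //; have [E0 E1] := H _ _ Snu; rewrite /jac E0 E1 /det2 /=.
move: (nu _) (td0 nu _) (td1 nu _) => n u v; vec3.
Qed.

Lemma chart_jac_neq0 i x : dom i x -> jac (dom i) (nu \o par i) x != 0.
Proof.
move=> /chart_jac[a [b [ab -> _]]]; rewrite mulf_neq0//; exact: lt0r_neq0.
Qed.

Lemma dot_nu_td p : dot (nu p) (td0 nu p) = 0 /\ dot (nu p) (td1 nu p) = 0.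
Proof.
have [d e] := crd_atP p; rewrite -td0E -td1E.
have H := dot_n_derive (dom_relopen _) (@Snu (chart_at p)) (@chart_unit _) _ d.
by split; [have := H (frame R 0)|have := H (frame R 1)]; rewrite /= e.
Qed.

Lemma round_metricE p : [/\ round_metric nu p 0 0 = dot (td0 nu p) (td0 nu p),
  round_metric nu p 0 1 = dot (td0 nu p) (td1 nu p),
  round_metric nu p 1 0 = dot (td1 nu p) (td0 nu p) &
  round_metric nu p 1 1 = dot (td1 nu p) (td1 nu p)].
Proof. by split; rewrite mxE ?td0E ?td1E. Qed.

(** Lagrange's identity: the Gram determinant is the squared length of
    [cross (td0 nu p) (td1 nu p)], which is a normal vector. *)
Lemma det_round_metric p : \det (round_metric nu p) =
  dot (nu p) (cross (td0 nu p) (td1 nu p)) ^+ 2.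
Proof.
have [n0 n1] := dot_nu_td p.
rewrite det2E; have [-> -> -> ->] := round_metricE p.
have E := det_tangent (cross (td0 nu p) (td1 nu p)) (nu1 p) n0 n1.
rewrite expr2 -{1}(dotC (cross _ _)) -E dot_cross_cross.
by rewrite (dotC (td1 nu p) (td0 nu p)).
Qed.

Lemma det_round_metric_neq0 p : \det (round_metric nu p) != 0.
Proof. by rewrite det_round_metric expf_neq0. Qed.

Lemma dot_grad (f : S -> R) p : [/\ dot (grad nu f p) (nu p) = 0,
  dot (grad nu f p) (td0 nu p) = td0 f p & dot (grad nu f p) (td1 nu p) = td1 f p].
Proof.
have D := det_round_metric_neq0 p; have [n0 n1] := dot_nu_td p.
have [G00 G01 G10 G11] := round_metricE p.
have [i00 i01 i10 i11] := invmx2E D.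
rewrite /grad; under eq_bigr do rewrite sum2E.
rewrite sum2E (td0E nu p) (td1E nu p) (td0E f p) (td1E f p) i00 i01 i10 i11.
move: D; rewrite det2E G00 G01 G10 G11 {i00 i01 i10 i11 G00 G01 G10 G11}.
move: n0 n1; move: (nu p) (td0 nu p) (td1 nu p) (td0 f p) (td1 f p).
move=> n u v f0 f1; rewrite !(dotC n) (dotC v u) => n0 n1 D.
rewrite !dotDl !dotZl n0 n1 (dotC v u).
move: D; move: (dot u u) (dot u v) (dot v v) => a b c D.
by split; [ring|field|field].
Qed.

Lemma dot_gmap (f : S -> R) p : [/\ dot (gmap f p) (nu p) = f p,
  dot (gmap f p) (td0 nu p) = td0 f p & dot (gmap f p) (td1 nu p) = td1 f p].
Proof.
have [g0 g1 g2] := dot_grad f p.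
have [n0 n1] := dot_nu_td p.
rewrite /gmap; move: (grad nu f p) g0 g1 g2 => G g0 g1 g2.
have n2 := nu1 p; move: (nu p) (td0 nu p) (td1 nu p) n0 n1 n2 g0 g1 g2.
move=> n u v n0 n1 n2 g0 g1 g2.
by rewrite !dotDl !dotZl g0 g1 g2 n0 n1 n2 !mulr0 !addr0 mulr1 add0r.
Qed.

Lemma gmap_unique f p y : dot y (nu p) = f p -> dot y (td0 nu p) = td0 f p ->
  dot y (td1 nu p) = td1 f p -> y = gmap f p.
Proof.
have [g0 g1 g2] := dot_gmap f p => e0 e1 e2.
by apply: (cramer3_unique (nuJ p)); rewrite ?g0 ?g1 ?g2.
Qed.

(** Both sides have the same scalar products with [nu] and its derivatives. This replaces the frame
    of [chart_at p], which jumps with [p], by a fixed chart, and is how [gmap f] is seen to be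
    smooth. *)
Lemma gmap_chart f i x : smooth f -> dom i x ->
  gmap f (par i x) = envelope (dom i) (nu \o par i) (f \o par i) x.
Proof.
move=> Sf dx; have [a [b [ab _ H]]] := chart_jac dx.
have [g0 g1 g2] := dot_gmap f (par i x).
have [N0 N1] := H _ _ Snu; have [F0 F1] := H _ _ Sf.
apply: (envelope_unique (@chart_jac_neq0 i) dx); first exact: g0.
  by rewrite N0 F0 !dotDr !dotZr g1 g2.
by rewrite N1 F1 !dotDr !dotZr g1 g2.
Qed.

Lemma smooth_gmap f : smooth f -> smooth (gmap f).
Proof.
move=> Sf i; have SE := smooth_on_envelope (dom_relopen i) (@Snu i)
  (@chart_jac_neq0 i) (Sf i).
by apply: (smooth_on_eq _ SE) => x dx; rewrite -gmap_chart.
Qed.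

Lemma dot_nu_td_gmap f p : smooth f ->
  dot (nu p) (td0 (gmap f) p) = 0 /\ dot (nu p) (td1 (gmap f) p) = 0.
Proof.
move=> Sf; have [d e] := crd_atP p; set c := chart_at p.
have rA := dom_relopen c.
have [t0 t1] := derive_envelope_tangent rA (@Snu c) (@chart_jac_neq0 c) (Sf c) d.
have E v : tdiff (gmap f) p v =
    derive_in (dom c) (envelope (dom c) (nu \o par c) (f \o par c)) (crd_at p) v.
  by apply: derive_in_eq => // y dy; rewrite -gmap_chart.
rewrite -td0E -td1E (E (frame R 0)) (E (frame R 1)) pd0E pd1E.
by rewrite /= e in t0 t1.
Qed.

Lemma td_grad f p : smooth f ->
  (td0 (gmap f) p = tdiff (grad nu f) p (frame R 0) +
     (f p *: td0 nu p + td0 f p *: nu p)) /\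
  (td1 (gmap f) p = tdiff (grad nu f) p (frame R 1) +
     (f p *: td1 nu p + td1 f p *: nu p)).
Proof.
move=> Sf; have [d e] := crd_atP p; set c := chart_at p.
have rA := dom_relopen c.
(* Smoothness of [grad nu f] is obtained by subtraction, the sum [gmap f] being what is identified
   in charts. *)
have SG : smooth_on (dom c) (grad nu f \o par c).
  have := smooth_onB (smooth_gmap Sf (i := c))
    (smooth_on_scale (Sf c) (@Snu c)).
  by apply: smooth_on_eq => x dx; rewrite /gmap /= addrK.
have H v : tdiff (gmap f) p v = tdiff (grad nu f) p v +
    (f p *: tdiff nu p v + tdiff f p v *: nu p).
  have fe : f p = (f \o par c) (crd_at p) by rewrite /= e.
  have ne : nu p = (nu \o par c) (crd_at p) by rewrite /= e.
  have H1 := derive_inD rA v SG (smooth_on_scale (Sf c) (@Snu c)) d.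
  rewrite (derive_in_scale rA v (Sf c) (@Snu c) d) in H1.
  by rewrite fe ne; exact: H1.
by rewrite -!td0E -!td1E (H (frame R 0)) (H (frame R 1)).
Qed.

(** The part of [d (gmap f)] coming from [f nu] is [f d nu] up to a normal vector and adds [f] times
    the round metric; multiplication by the metric clears the inverse in [hess]. *)
Lemma hessI_dot f p : smooth f ->
  round_metric nu p *m hessI f p = \matrix_(i, j)
    dot (if i == 0 then td0 nu p else td1 nu p)
        (if j == 0 then td0 (gmap f) p else td1 (gmap f) p).
Proof.
move=> Sf; have D := det_round_metric_neq0 p.
have GU : round_metric nu p \in unitmx by rewrite unitmxE unitfE.
have [n0 n1] := dot_nu_td p; have [E0 E1] := td_grad p Sf.
rewrite /hessI /hess mulmxDr mulKVmx// mul_mx_scalar.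
have K u v w a b : dot (nu p) u = 0 -> dot u (v + (a *: w + b *: nu p)) =
    dot u v + a * dot u w.
  by move=> nu0; rewrite !dotDr !dotZr (dotC u (nu p)) nu0 mulr0 addr0.
by apply: matrix2P; rewrite !mxE/= ?E0 ?E1 K// ?td0E ?td1E.
Qed.

(* Column [j] of [hessI f p] gives the coordinates of [d (gmap f)] along
   [frame R j] in the basis of the [d nu]. *)
Lemma td_gmap f p : smooth f ->
  td0 (gmap f) p = hessI f p 0 0 *: td0 nu p + hessI f p 1 0 *: td1 nu p /\
  td1 (gmap f) p = hessI f p 0 1 *: td0 nu p + hessI f p 1 1 *: td1 nu p.
Proof.
move=> Sf; have := hessI_dot p Sf; move: (hessI f p) => A /matrixP GA.
have [n0 n1] := dot_nu_td p; have [t0 t1] := dot_nu_td_gmap p Sf.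
have [G00 G01 G10 G11] := round_metricE p.
have e00 := GA 0 0; have e01 := GA 0 1; have e10 := GA 1 0; have e11 := GA 1 1.
rewrite mulmx2E G00 G01 mxE/= in e00; rewrite mulmx2E G00 G01 mxE/= in e01.
rewrite mulmx2E G10 G11 mxE/= in e10; rewrite mulmx2E G10 G11 mxE/= in e11.
split; apply: (cramer3_unique (nuJ p)).
- by rewrite dotC t0 dotC dotDr !dotZr n0 n1 !mulr0 addr0.
- by rewrite dotC -e00 !dotDl !dotZl (dotC (td1 _ _)); ring.
- by rewrite dotC -e10 !dotDl !dotZl (dotC (td0 _ _) (td1 _ _)); ring.
- by rewrite dotC t1 dotC dotDr !dotZr n0 n1 !mulr0 addr0.
- by rewrite dotC -e01 !dotDl !dotZl (dotC (td1 _ _)); ring.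
- by rewrite dotC -e11 !dotDl !dotZl (dotC (td0 _ _) (td1 _ _)); ring.
Qed.

(** [mixed] and [jac] are both multiplied by [det2 a b] under a change of chart, so their quotient
    is the frame-free [mixdisc]. *)
Lemma mixed_chart f g i x : smooth f -> smooth g -> dom i x ->
  mixed (dom i) (nu \o par i) (f \o par i) (g \o par i) x =
  mixdisc f g (par i x) * jac (dom i) (nu \o par i) x.
Proof.
move=> Sf Sg dx; have [a [b [ab -> H]]] := chart_jac dx.
have L h : smooth h ->
    pd0 (dom i) (envelope (dom i) (nu \o par i) (h \o par i)) x =
      a.1 *: td0 (gmap h) (par i x) + a.2 *: td1 (gmap h) (par i x) /\
    pd1 (dom i) (envelope (dom i) (nu \o par i) (h \o par i)) x =
      b.1 *: td0 (gmap h) (par i x) + b.2 *: td1 (gmap h) (par i x).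
  move=> Sh; have [E0 E1] := H _ _ (smooth_gmap Sh).
  rewrite -E0 -E1 -!pd0E -!pd1E.
  by split; apply: derive_in_eq => // y dy /=; rewrite gmap_chart.
have [f0 f1] := L f Sf; have [g0 g1] := L g Sg.
have [F0 F1] := td_gmap (par i x) Sf; have [G0 G1] := td_gmap (par i x) Sg.
rewrite /mixed f0 f1 g0 g1 F0 F1 G0 G1 /mixdisc /det2.
move: (hessI f _) (hessI g _) (td0 nu _) (td1 nu _) => A B u v /=.
move: (nu (par i x)) (A 0 0) (A 0 1) (A 1 0) (A 1 1) => n A00 A01 A10 A11.
move: (B 0 0) (B 0 1) (B 1 0) (B 1 1) => B00 B01 B10 B11.
by rewrite !lin2_comb !cross_lin2 -scalerDl dotZr mulrA; congr (_ * _); ring.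
Qed.

(** The entries of [hessI] depend on the frame at each point and have no reason to vary smoothly;
    the invariant combination is smooth as a quotient of chart expressions. *)
Lemma smooth_mixdisc f g : smooth f -> smooth g -> smooth (mixdisc f g).
Proof.
move=> Sf Sg i.
have SM := smooth_on_mixed (dom_relopen i) (@Snu i) (@chart_jac_neq0 i)
  (Sf i) (Sg i).
have SJ := smooth_onV (@chart_jac_neq0 i) (smooth_on_jac (dom_relopen i) (@Snu i)).
apply: (smooth_on_eq _ (smooth_onM SM SJ)) => x dx.
by rewrite mixed_chart// mulfK// chart_jac_neq0.
Qed.

End SphereCalculus.

(** * The Gauss map of an immersed surface *)

Section GaussMap.
Context {R : realType} (S : surface R) (X : S -> 'rV[R]_3).
Implicit Types (i : idx S) (p : S).
Hypothesis SX : smooth X.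
Hypothesis X_imm : immersion X.

Lemma cross_td_neq0 p : cross (td0 X p) (td1 X p) != 0.
Proof.
apply/eqP => c0.
have H e : e.1 *: td0 X p + e.2 *: td1 X p = 0 -> e = 0.
  by move=> E; apply: (X_imm (p := p)); rewrite tdiff_frame.
have [v0|v0] := eqVneq (td1 X p) 0.
  have /(congr1 snd)/eqP : (0, 1) = 0 :> R * R.
    by apply: H; rewrite v0 /= scale0r scaler0 addr0.
  by rewrite oner_eq0.
have E : cross (td1 X p) (cross (td0 X p) (td1 X p)) = 0 by rewrite c0 cross0r.
(* For [u = td0 X p] and [v = td1 X p], the vector [v x (u x v) = (v . v) u - (v . u) v] would be
   zero: a relation between the two tangent vectors with nonzero coefficient [v . v]. *)
have /(congr1 fst)/eqP : (dot (td1 X p) (td1 X p),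
    - dot (td1 X p) (td0 X p)) = 0 :> R * R.
  by apply: H; rewrite /= scaleNr -cross_cross.
by rewrite gt_eqF// dotvv_gt0.
Qed.

Lemma gauss_mapE p : gauss_map X p = normalize (cross (td0 X p) (td1 X p)).
Proof. by rewrite /gauss_map td0E td1E. Qed.

Lemma gauss_map_unit p : dot (gauss_map X p) (gauss_map X p) = 1.
Proof. by rewrite gauss_mapE dot_normalize// cross_td_neq0. Qed.

Lemma cross_td_gauss_map p :
  cross (td0 X p) (td1 X p) = enorm (cross (td0 X p) (td1 X p)) *: gauss_map X p.
Proof. by rewrite gauss_mapE -normalizeE. Qed.

Lemma dot_gauss_map_td p :
  dot (gauss_map X p) (td0 X p) = 0 /\ dot (gauss_map X p) (td1 X p) = 0.
Proof.
by rewrite gauss_mapE /normalize !dotZl dot_crossl dot_crossr !mulr0.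
Qed.

(** In another chart the cross product of the derivatives is multiplied by [det2 a b], positive by
    orientation, which [normalize] does not see. *)
Lemma smooth_gauss_map : smooth (gauss_map X).
Proof.
move=> i.
have S0 := smooth_on_pd0 (dom_relopen i) (SX (i := i)).
have S1 := smooth_on_pd1 (dom_relopen i) (SX (i := i)).
have E x : dom i x -> exists2 k, 0 < k &
    cross (pd0 (dom i) (X \o par i) x) (pd1 (dom i) (X \o par i) x) =
    k *: cross (td0 X (par i x)) (td1 X (par i x)).
  move=> dx; have [a [b [ab H]]] := chart_change dx.
  have [-> ->] := H _ _ SX.
  by exists (det2 a b); rewrite // cross_lin2 /det2.
apply: (smooth_on_eq _ (smooth_on_normalize _ (smooth_on_cross S0 S1))).
  by move=> x dx /=; have [k k0 ->] := E x dx; rewrite normalizeZ// gauss_mapE.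
move=> x dx; have [k k0 ->] := E x dx.
by rewrite scaler_eq0 gt_eqF// cross_td_neq0.
Qed.

Lemma dot_gauss_map_tdnu p : dot (gauss_map X p) (td0 (gauss_map X) p) = 0 /\
  dot (gauss_map X p) (td1 (gauss_map X) p) = 0.
Proof. exact: dot_nu_td smooth_gauss_map gauss_map_unit p. Qed.

Hypothesis X_curved : forall p, gauss_curvature X p != 0.

(** [gauss_curvature] is chosen by [get], so a factor between the two cross products must be found
    first: both are normal, and that of [X] is nonzero. *)
Lemma gauss_map_immersive p :
  dot (gauss_map X p) (cross (td0 (gauss_map X) p) (td1 (gauss_map X) p)) != 0.
Proof.
set nu := gauss_map X; set k := gauss_curvature X p.
have [n0 n1] := dot_gauss_map_tdnu p.
have tang u v : dot (nu p) u = 0 -> dot (nu p) v = 0 ->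
    cross u v = dot (nu p) (cross u v) *: nu p.
  move=> nu0 nv0; have H : cross (nu p) (cross u v) = 0.
    by rewrite cross_cross nu0 nv0 !scale0r subr0.
  have : cross (nu p) (cross (nu p) (cross u v)) = 0 by rewrite H cross0r.
  rewrite cross_cross gauss_map_unit scale1r => /eqP.
  by rewrite subr_eq0 => /eqP.
pose e := enorm (cross (td0 X p) (td1 X p)).
have e0 : 0 < e by rewrite enorm_gt0// cross_td_neq0.
have [k' Hk'] : exists k' : R, cross (td0 nu p) (td1 nu p) =
    k' *: cross (td0 X p) (td1 X p).
  exists (dot (nu p) (cross (td0 nu p) (td1 nu p)) / e).
  by rewrite cross_td_gauss_map -/e scalerA divfK ?lt0r_neq0//; exact: tang.
have Hk : cross (td0 nu p) (td1 nu p) = k *: cross (td0 X p) (td1 X p).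
  have P : forall a b, cross (tdiff nu p a) (tdiff nu p b) =
      k *: cross (tdiff X p a) (tdiff X p b).
    apply: (@getPex _ [set k : R | forall a b, cross (tdiff nu p a) (tdiff nu p b)
      = k *: cross (tdiff X p a) (tdiff X p b)]).
    exists k' => a b.
    rewrite !(tdiff_frame p _ smooth_gauss_map) !(tdiff_frame p _ SX).
    by rewrite !cross_lin2 Hk' !scalerA mulrC.
  by have := P (frame R 0) (frame R 1); rewrite !td0E !td1E.
rewrite Hk cross_td_gauss_map 2!dotZr /nu gauss_map_unit mulr1 mulf_neq0//.
  exact: X_curved.
by rewrite lt0r_neq0.
Qed.

Lemma smooth_support_function : smooth (support_function X).
Proof. by move=> i; apply: smooth_on_dot; [exact: SX|exact: smooth_gauss_map]. Qed.

(** [d X] is tangent, so [d q = X . d nu]; thus [X] has the three scalar products that characterize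
    [gmap]. *)
Lemma gmap_support_function p : gmap (gauss_map X) (support_function X) p = X p.
Proof.
have SN := smooth_gauss_map; have Sq := smooth_support_function.
apply/esym/(gmap_unique SN gauss_map_unit gauss_map_immersive) => //.
all: have [d e] := crd_atP p; set c := chart_at p in d e.
all: have [x0 x1] := dot_gauss_map_td p.
all: have H v := derive_in_dot (dom_relopen c) v (SX (i := c)) (SN c) d.
- have := H (frame R 0); rewrite -/(tdiff X p _) -/(tdiff (gauss_map X) p _).
  rewrite /= e td0E td0E (dotC (td0 X p)) x0 add0r => <-.
  by rewrite -td0E.
- have := H (frame R 1); rewrite -/(tdiff X p _) -/(tdiff (gauss_map X) p _).
  rewrite /= e td1E td1E (dotC (td1 X p)) x1 add0r => <-.
  by rewrite -td1E.
Qed.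

End GaussMap.

(** * Smoothness of inverse functions *)

Section InverseSmooth.
Context {R : realType}.

Lemma Cn_det (V : normedModType R) (O : set V) (oO : open O) n m
    (A : V -> 'M[R]_m) : (forall i j, Cn n O (fun x => A x i j)) ->
  Cn n O (fun x => \det (A x)).
Proof.
move=> HA.
have Hprod (I : Type) (r : seq I) (F : I -> V -> R) :
    (forall i, Cn n O (F i)) -> Cn n O (fun x => \prod_(i <- r) F i x).
  move=> HF; elim: r => [|i r IH].
    by apply: (Cn_eq oO _ (Cn_cst n O (1 : R))) => x _; rewrite big_nil.
  by apply: (Cn_eq oO _ (CnM oO (HF i) IH)) => x _; rewrite big_cons.
apply: Cn_sum => // s; apply: CnM => //; first exact: Cn_cst.
exact: Hprod.
Qed.

Lemma Cn_invmx (V : normedModType R) (O : set V) (oO : open O) n m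
    (A : V -> 'M[R]_m) : (forall x, O x -> \det (A x) != 0) ->
  (forall i j, Cn n O (fun x => A x i j)) ->
  forall i j, Cn n O (fun x => invmx (A x) i j).
Proof.
move=> dA HA i j.
apply: (@Cn_eq _ _ _ oO _ _ (fun x => (\det (A x))^-1 *
  ((-1) ^+ (j + i) * \det (row' j (col' i (A x)))))) => [x Ox|].
  by rewrite /invmx unitmxE unitfE dA// !mxE /cofactor.
apply: CnM => //; first by apply: CnV => //; exact: Cn_det.
apply: CnM => //; first exact: Cn_cst.
apply: Cn_det => // k l.
by apply: (Cn_eq oO _ (HA (lift j k) (lift i l))) => x _; rewrite !mxE.
Qed.

Lemma mulmxr_continuous m (B : 'M[R]_m) : continuous (fun w : 'rV[R]_m => w *m B).
Proof.
have H : Cn 0 setT (fun w : 'rV[R]_m => w *m B); last first.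
  by move=> w; exact: (Cn_continuous H Logic.I).
apply: (@Cn_eq _ _ _ openT _ _ (fun w : 'rV[R]_m => \row_j \sum_i w 0 i * B i j)).
  by move=> u _; apply/rowP => j; rewrite !mxE.
apply: (Cn_row openT) => j; apply: (Cn_sum openT) => i.
by apply: (CnM openT); [apply: (Cn_coord openT); exact: Cn_id|exact: Cn_cst].
Qed.

Section Inverse.
Variables (m : nat) (P Q : set 'rV[R]_m) (Phi Psi : 'rV[R]_m -> 'rV[R]_m).

(** With [h = Psi (w + u) - Psi u], the expansion of [Phi] reads [w = 'd Phi h + o(h)]. Applying the
    inverse [M] of the differential gives [M w - h = o(h)], where continuity of [Psi] makes [h]
    small; it remains to replace [o(h)] by [o(w)]. *)
Lemma inverse_differentiable u : differentiable Phi (Psi u) ->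
  jacobian Phi (Psi u) \in unitmx -> {for u, continuous Psi} ->
  (\forall w \near u, Phi (Psi w) = w) ->
  differentiable Psi u /\ forall v, 'D_v Psi u = v *m invmx (jacobian Phi (Psi u)).
Proof.
set x0 := Psi u; set A := jacobian Phi x0 => dPhi uA cPsi PK.
pose M : {linear 'rV[R]_m -> 'rV[R]_m} := mulmxr (invmx A).
have ME w : M w = w *m invmx A by [].
have cM : continuous M by exact: mulmxr_continuous.
have [k k0 Mk] := linear_lipschitz cM.
have LE h : 'd Phi x0 h = h *m A.
  by rewrite /A /jacobian mul_rV_lin1.
have ML h : M ('d Phi x0 h) = h by rewrite LE ME mulmxK.
have Phix0 : Phi x0 = u by exact: nbhs_singleton PK.
have [] := @eps_differentiable R _ _ Psi u M cM.
  move=> e e0.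
  (* The first bound makes |M w - h| at most |h| / 2, which is absorbed to give |h| <= 2 k |w|; the
     second then turns the error [d * k] |h| into at most [e] |w|. *)
  pose d := Num.min (2 * k)^-1 (e / (2 * k * k)).
  have d0 : 0 < d by rewrite lt_min invr_gt0 divr_gt0 ?mulr_gt0.
  have dk : d * k <= 2^-1.
    rewrite -ler_pdivlMr// (le_trans (_ : d <= (2 * k)^-1)) ?ge_min ?lexx//.
    by rewrite invfM.
  have de : d * k * (2 * k) <= e.
    have : d <= e / (2 * k * k) by rewrite ge_min lexx orbT.
    rewrite ler_pdivlMr ?mulr_gt0// => H; apply: le_trans H.
    by rewrite le_eqVlt; apply/orP; left; apply/eqP; ring.
  have nPsi : \forall w \near (0 : 'rV[R]_m), 
      `|Phi (Psi (w + u) - x0 + x0) - (Phi x0 + 'd Phi x0 (Psi (w + u) - x0))|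
      <= d * `|Psi (w + u) - x0|.
    have c1 : {for u, continuous (fun y => Psi y - x0)}.
      by apply: continuousB; [exact: cPsi|exact: cst_continuous].
    have c0 : (fun y => Psi y - x0) @ u --> x0 - x0 by exact: c1.
    rewrite subrr in c0.
    have H : \forall y \near u,
      `|Phi (Psi y - x0 + x0) - (Phi x0 + 'd Phi x0 (Psi y - x0))|
      <= d * `|Psi y - x0| by exact: (c0 _ (differentiable_eps dPhi d0)).
    by move: H; rewrite (near_shift 0)/= subr0.
  have nPK : \forall w \near (0 : 'rV[R]_m), Phi (Psi (w + u)) = w + u.
    by move: PK; rewrite (near_shift 0)/= subr0.
  move: nPsi nPK; apply: filterS2 => w; set h := Psi (w + u) - x0.
  rewrite /h subrK -/h => H E; move: H; rewrite E Phix0 opprD addrA addrK => H.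
  have H1 : `|M w - h| <= d * k * `|h|.
    rewrite -{1}(ML h) -linearB (le_trans (Mk _))// (mulrC d) -mulrA.
    by rewrite ler_wpM2l// ltW.
  have H2 : `|h| <= 2 * k * `|w|.
    have A1 : `|h| <= `|M w| + `|M w - h|.
      by rewrite -{1}(subKr (M w) h) (le_trans (ler_normB _ _)).
    have A2 := Mk w.
    have A3 : d * k * `|h| <= 2^-1 * `|h| by rewrite ler_wpM2r.
    by lra.
  rewrite opprD addrA -/h distrC (le_trans H1)//.
  rewrite (le_trans (ler_wpM2l _ H2))//; first by rewrite ltW// mulr_gt0.
  by rewrite mulrA ler_wpM2r.
by move=> dPsi E; split; [exact: dPsi|move=> v; rewrite (deriveE v dPsi) E].
Qed.

Hypotheses (oP : open P) (oQ : open Q).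
Hypothesis HPhi : forall n, Cn n P Phi.
Hypothesis QP : forall u, Q u -> P (Psi u).
Hypothesis cPsi : forall u, Q u -> {for u, continuous Psi}.
Hypothesis PhiK : forall u, Q u -> Phi (Psi u) = u.
Hypothesis JPhi : forall u, Q u -> jacobian Phi (Psi u) \in unitmx.

(** The derivative of [Psi] is an algebraic expression in the Jacobian of [Phi] at [Psi u], so
    regularity of order [n] of [Psi] yields order [n.+1]. *)
Lemma inverse_smooth n : Cn n Q Psi.
Proof.
have dPhi x : P x -> differentiable Phi x.
  by have [d _] := CnSP (HPhi 1%N); exact: d.
have dPsi u : Q u -> differentiable Psi u /\
    forall v, 'D_v Psi u = v *m invmx (jacobian Phi (Psi u)).
  move=> Qu; apply: inverse_differentiable; [exact/dPhi/QP|exact: JPhi|exact: cPsi|].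
  by near=> w; apply: PhiK; near: w; exact: open_nbhs_nbhs.
elim: n => [|n IH]; first exact: cPsi.
apply: (CnS_of oQ (df := fun v u => v *m invmx (jacobian Phi (Psi u)))).
- by move=> u /dPsi[].
- by move=> u v /dPsi[_ ->].
- move=> v.
  apply: (@Cn_eq _ _ _ oQ _ _ (fun u => \row_j \sum_i
    v 0 i * invmx (jacobian Phi (Psi u)) i j)).
    by move=> u _; apply/rowP => j; rewrite !mxE.
  apply: Cn_row => // j; apply: Cn_sum => // i; apply: CnM => //.
    exact: Cn_cst.
  apply: Cn_invmx => // [u Qu|k l]; first by rewrite -unitfE -unitmxE JPhi.
  apply: (@Cn_eq _ _ _ oQ _ _ (fun u => ('D_(delta_mx 0 k) Phi (Psi u)) 0 l)).
    move=> u Qu; rewrite (deriveEjacobian _ (dPhi _ (QP Qu))).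
    by rewrite -rowE mxE.
  have [_ HD] := CnSP (HPhi n.+1).
  exact: (Cn_coord oQ l (Cn_comp_row oQ QP IH (HD (delta_mx 0 k)))).
Unshelve. all: by end_near. Qed.

End Inverse.

End InverseSmooth.

(** * The Wulff shape *)

Section Limits.
Context {R : realType}.
Implicit Types V W : normedModType R.

Lemma derive_at_right V W (f : V -> W) x v : derivable f x v ->
  (fun h : R => h^-1 *: (f (h *: v + x) - f x)) @ 0^'+ --> 'D_v f x.
Proof. by move=> df; apply: cvg_dnbhs_at_right; exact: df. Qed.

Lemma derive_ge V (f : V -> R) x v c : derivable f x v ->
  (forall h, 0 < h -> h < 1 -> c * h <= f (h *: v + x) - f x) -> c <= 'D_v f x.
Proof.
move=> df H; apply: (cvgr_to_ge (derive_at_right df)).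
near=> h; have h0 : 0 < h by near: h; exact: nbhs_right_gt.
rewrite [X in _ <= X]mulrC ler_pdivlMr//; exact: H.
Unshelve. all: by end_near. Qed.

Lemma derive_le V (f : V -> R) x v c : derivable f x v ->
  (forall h, 0 < h -> h < 1 -> f (h *: v + x) - f x <= c * h) -> 'D_v f x <= c.
Proof.
move=> df H; apply: (cvgr_to_le (derive_at_right df)).
near=> h; have h0 : 0 < h by near: h; exact: nbhs_right_gt.
rewrite [X in X <= _]mulrC ler_pdivrMr//; exact: H.
Unshelve. all: by end_near. Qed.

Lemma derive_constant V W (f : V -> W) x v : derivable f x v ->
  (forall h : R, 0 < h -> h < 1 -> f (h *: v + x) = f x) -> 'D_v f x = 0.
Proof.
move=> df H; apply: (cvg_unique (@norm_hausdorff _ _) (derive_at_right df)).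
rewrite /=; apply: cvg_near_cst; near=> h.
by rewrite H ?subrr ?scaler0.
Unshelve. all: by end_near. Qed.

Lemma coord_le_norm n (x : 'rV[R]_n) i : `|x 0 i| <= `|x|.
Proof.
rewrite [X in _ <= X]/Num.norm/= mx_normrE.
exact: (le_bigmax _ (fun ij => `|x ij.1 ij.2|) (0, i)).
Qed.

Lemma dot_le_norm (x u : 'rV[R]_3) : dot x u <= 3 * `|x| * `|u|.
Proof.
have H i : x 0 i * u 0 i <= `|x| * `|u|.
  rewrite (le_trans (ler_norm _))// normrM ler_pM//; exact: coord_le_norm.
rewrite dotE; have := H 0; have := H 1; have := H 2; lra.
Qed.

End Limits.

Section NormCalculus.
Context {R : realType} (T : 'rV[R]_3 -> R).
Hypothesis T_norm : is_norm T.
Hypothesis T_smooth : smooth_on [set x | x != 0] T.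

Lemma norm0 : T 0 = 0.
Proof. by have [_ H _] := T_norm; rewrite -(scale0r 0) H normr0 mul0r. Qed.

Lemma normN x : T (- x) = T x.
Proof. by have [_ H _] := T_norm; rewrite -scaleN1r H normrN1 mul1r. Qed.

Lemma norm_pos x : x != 0 -> 0 < T x.
Proof.
move=> x0; have [H1 _ H3] := T_norm.
have : 0 <= T x by have := H3 x (- x); rewrite subrr norm0 normN; lra.
rewrite le_eqVlt => /orP[/eqP e|//].
by move: x0; rewrite (H1 x)// eqxx.
Qed.

Lemma norm_ge0 x : 0 <= T x.
Proof. by have [->|/norm_pos/ltW//] := eqVneq x 0; rewrite norm0. Qed.

Lemma normZ_pos c x : 0 < c -> T (c *: x) = c * T x.
Proof. by move=> c0; have [_ -> _] := T_norm; rewrite gtr0_norm. Qed.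

Lemma open_neq0 : open [set x : 'rV[R]_3 | x != 0].
Proof.
rewrite (_ : [set x | _] = ~` [set 0]); last first.
  by apply/seteqP; split=> x /= /eqP.
apply/closed_openC/accessible_closed_set1/hausdorff_accessible.
exact: norm_hausdorff.
Qed.

Lemma norm_Cn n : Cn n [set x | x != 0] T.
Proof. exact: smooth_on_openP open_neq0 T_smooth n. Qed.

Lemma norm_differentiable x : x != 0 -> differentiable T x.
Proof. by move=> x0; have [d _] := CnSP (norm_Cn 1%N); exact: d. Qed.

Definition ngrad (x : 'rV[R]_3) : 'rV[R]_3 := \row_i 'D_(delta_mx 0 i) T x.

Lemma ngrad_Cn n : Cn n [set x | x != 0] ngrad.
Proof.
apply: (Cn_row open_neq0) => i.
by have [_] := CnSP (norm_Cn n.+1).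
Qed.

Lemma ngrad_differentiable x : x != 0 -> differentiable ngrad x.
Proof. by move=> x0; have [d _] := CnSP (ngrad_Cn 1%N); exact: d. Qed.

Lemma derive_norm x v : x != 0 -> 'D_v T x = dot v (ngrad x).
Proof.
move=> x0; have dT := norm_differentiable x0.
rewrite deriveE// {1}(row_sum_delta v) linear_sum/= dotE !mxE sum3E.
by rewrite !(deriveE _ dT) !linearZ.
Qed.

Lemma subgradient x y : x != 0 -> dot y (ngrad x) <= T y.
Proof.
move=> x0; rewrite -derive_norm//; apply: derive_le.
  exact: diff_derivable (norm_differentiable x0).
move=> h h0 _; have [_ _ H] := T_norm.
by rewrite lerBlDr (le_trans (H _ _))// normZ_pos// mulrC.
Qed.

Lemma euler x : x != 0 -> dot x (ngrad x) = T x.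
Proof.
move=> x0; apply/eqP; rewrite eq_le subgradient//= -derive_norm//.
apply: derive_ge; first exact: diff_derivable (norm_differentiable x0).
move=> h h0 _; have -> : h *: x + x = (h + 1) *: x by rewrite scalerDl scale1r.
rewrite normZ_pos; last by lra.
by rewrite mulrDl mul1r addrK mulrC.
Qed.

Lemma ngrad_neq0 x : x != 0 -> ngrad x != 0.
Proof.
move=> x0; apply/eqP => g0; have := euler x0.
by rewrite g0 dot0r; apply/eqP; rewrite lt_eqF// norm_pos.
Qed.

Lemma dot_separates (u v : 'rV[R]_3) : (forall w, dot w u = dot w v) -> u = v.
Proof.
move=> H; apply/eqP; rewrite -subr_eq0; apply/eqP; apply: dotvv_eq0.
by rewrite {2}(_ : u - v = u - v)// dotBr H subrr.
Qed.

(** The derivative of [T] at [x] along [v] dominates [dot v w]; used for [v] and [- v] this becomes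
    an equality. Gradients can thus be recognized without differentiating. *)
Lemma ngrad_unique x w : x != 0 -> (forall y, dot y w <= T y) ->
  dot x w = T x -> ngrad x = w.
Proof.
move=> x0 H E.
have G v : dot v w <= dot v (ngrad x).
  rewrite -derive_norm//; apply: derive_ge.
    exact: diff_derivable (norm_differentiable x0).
  move=> h h0 _; rewrite lerBrDr -E.
  by apply: le_trans (H _); rewrite dotDl dotZl mulrC.
apply: dot_separates => v; apply/eqP; rewrite eq_le G andbT.
by have := G (- v); rewrite (dotNl v w) (dotNl v (ngrad x)) lerN2.
Qed.

Lemma ngradZ c x : 0 < c -> x != 0 -> ngrad (c *: x) = ngrad x.
Proof.
move=> c0 x0; apply: ngrad_unique.
- by rewrite scaler_eq0 negb_or gt_eqF.
- by move=> y; exact: subgradient.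
- by rewrite dotZl euler// normZ_pos.
Qed.

Lemma norm_upper : exists2 C : R, 0 < C & forall x, T x <= C * `|x|.
Proof.
have [_ HZ HD] := T_norm.
exists (1 + T (delta_mx 0 0) + T (delta_mx 0 1) + T (delta_mx 0 2)).
  by rewrite !ltr_wpDr ?norm_ge0.
move=> x; have {1}-> : x = x 0 0 *: delta_mx 0 0 + x 0 1 *: delta_mx 0 1 +
    x 0 2 *: delta_mx 0 2 by apply: rV3P; rewrite !mxE/=; ring.
have H i : T (x 0 i *: delta_mx 0 i) <= T (delta_mx 0 i) * `|x|.
  by rewrite HZ mulrC ler_wpM2l ?norm_ge0// coord_le_norm.
rewrite (le_trans (HD _ _))// (le_trans (lerD (HD _ _) (lexx _)))//.
have := H 0; have := H 1; have := H 2; have := normr_ge0 x.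
by rewrite !mulrDl mul1r; lra.
Qed.

Lemma sphere_compact : compact [set x : 'rV[R]_3 | `|x| = 1].
Proof.
apply: bounded_closed_compact.
  exists 1; split; first exact: num_real.
  by move=> M M1 x /= ->; exact: ltW.
apply: (@preimage_closed _ _ (fun x : 'rV[R]_3 => `|x|) [set 1]).
  by move=> x _; exact: norm_continuous.
exact: closed_eq.
Qed.

Lemma norm_lower : exists2 c : R, 0 < c & forall x, c * `|x| <= T x.
Proof.
have e0 : `|const_mx 1 : 'rV[R]_3| != 0.
  rewrite normr_eq0; apply/eqP => /rowP/(_ 0); rewrite !mxE => /eqP.
  by rewrite oner_eq0.
have [] := @EVT_min_rV R 3 T [set x | `|x| = 1].
- exists (`|const_mx 1 : 'rV[R]_3|^-1 *: const_mx 1).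
  by rewrite /= normrZ normfV normr_id mulVf.
- exact: sphere_compact.
- apply: continuous_in_subspaceT => x; rewrite inE/= => x1.
  apply: differentiable_continuous; apply: norm_differentiable.
  by rewrite -normr_eq0 x1 oner_eq0.
move=> z; rewrite inE/= => z1 Hz; exists (T z).
  by apply: norm_pos; rewrite -normr_eq0 z1 oner_eq0.
move=> x; have [->|x0] := eqVneq x 0; first by rewrite normr0 mulr0 norm0.
have nx : 0 < `|x| by rewrite normr_gt0.
have := Hz (`|x|^-1 *: x); rewrite inE/= normrZ normfV normr_id mulVf ?gt_eqF//.
move=> /(_ erefl); rewrite normZ_pos ?invr_gt0// mulrC => H.
by rewrite -ler_pdivlMr.
Qed.

Lemma wulff_neq0 x : wulff_shape T x -> x != 0.
Proof.
move=> Tx; apply/eqP => x0; move: Tx; rewrite /wulff_shape/= x0 norm0.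
by move/eqP; rewrite eq_sym oner_eq0.
Qed.

Lemma wulff_normal_Cn n : Cn n [set x | x != 0] (wulff_normal T).
Proof.
have Sn : smooth_on [set x | x != 0] ngrad.
  by apply: smooth_on_open; [exact: open_neq0|exact: ngrad_Cn].
apply: (smooth_on_openP open_neq0 _ n).
exact: (smooth_on_normalize (fun x x0 => ngrad_neq0 x0) Sn).
Qed.

Lemma wulff_normal_differentiable x : x != 0 -> differentiable (wulff_normal T) x.
Proof. by move=> x0; have [d _] := CnSP (wulff_normal_Cn 1%N); exact: d. Qed.

Lemma wulff_normal_unit x : x != 0 -> dot (wulff_normal T x) (wulff_normal T x) = 1.
Proof. by move=> x0; rewrite dot_normalize// ngrad_neq0. Qed.

Lemma derive_dot (f g : 'rV[R]_3 -> 'rV[R]_3) x v : differentiable f x ->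
  differentiable g x ->
  'D_v (fun y => dot (f y) (g y)) x = dot ('D_v f x) (g x) + dot (f x) ('D_v g x).
Proof.
move=> df dg.
have c h i : differentiable h x -> is_derive x v (fun y => (h y : 'rV[R]_3) 0 i)
    (('D_v h x) 0 i).
  move=> dh; have dv := diff_derivable (v := v) dh.
  apply: DeriveDef; first by move/derivable_mxP : dv; apply.
  by rewrite derive_mx// mxE.
rewrite (_ : (fun y => _) = (fun y => f y 0 0) * (fun y => g y 0 0) +
  (fun y => f y 0 1) * (fun y => g y 0 1) +
  (fun y => f y 0 2) * (fun y => g y 0 2)); last first.
  by apply/funext => y; rewrite dotE.
have := is_deriveD (is_deriveD (is_deriveM (c f 0 df) (c g 0 dg))
  (is_deriveM (c f 1 df) (c g 1 dg))) (is_deriveM (c f 2 df) (c g 2 dg)).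
move=> [_ ->]; rewrite !dotE /GRing.scale/=; ring.
Qed.

Lemma wulff_normal_tangent x v : x != 0 ->
  dot (wulff_normal T x) ('D_v (wulff_normal T) x) = 0.
Proof.
move=> x0; have dN := wulff_normal_differentiable x0.
have : 'D_v (fun y => dot (wulff_normal T y) (wulff_normal T y)) x = 0.
  rewrite (near_eq_derive (g := fun=> 1 : R)) ?derive_cst//.
  near=> y; apply: wulff_normal_unit; near: y.
  by apply: open_nbhs_nbhs; split; [exact: open_neq0|].
rewrite derive_dot// (dotC ('D_v _ _)) => /eqP.
by rewrite -mulr2n mulrn_eq0 => /eqP.
Unshelve. all: by end_near. Qed.

(** The product [n x e_0] serves, unless [n] is parallel to [e_0], in which case [e_1] does. *)
Lemma exists_tangent (n : 'rV[R]_3) : n != 0 -> exists2 u, u != 0 & dot n u = 0.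
Proof.
move=> n0.
have [c0|c0] := eqVneq (cross n (delta_mx 0 0)) 0; last first.
  by exists (cross n (delta_mx 0 0)) => //; rewrite dotC dot_crossl.
exists (delta_mx 0 1).
  by apply/eqP => /rowP/(_ 1); rewrite !mxE/= => /eqP; rewrite oner_eq0.
have [_ c2] := crossE n (delta_mx 0 0).
move: c2; rewrite c0 !mxE/= => c2; rewrite dotE !mxE/=.
by rewrite !mulr0 mulr1 add0r addr0; move: c2; rewrite mulr0 mulr1 sub0r => /eqP;
  rewrite eq_sym oppr_eq0 => /eqP.
Qed.

Hypothesis T_curv : forall x, wulff_shape T x -> 0 < wulff_curvature T x.

Lemma tangent_cross (n u v : 'rV[R]_3) : dot n n = 1 -> dot n u = 0 ->
  dot n v = 0 -> cross u v = dot n (cross u v) *: n.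
Proof.
move=> n1 nu nv; have H : cross n (cross u v) = 0.
  by rewrite cross_cross nu nv !scale0r subr0.
have : cross n (cross n (cross u v)) = 0 by rewrite H cross0r.
by rewrite cross_cross n1 scale1r => /eqP; rewrite subr_eq0 => /eqP.
Qed.

(** [wulff_curvature] is chosen by [get]: a witness is read off on the orthogonal tangent basis [u],
    [cross N u], and bilinearity extends it to all tangent vectors. *)
Lemma wulff_curvatureP x a b : wulff_shape T x ->
  dot (wulff_normal T x) a = 0 -> dot (wulff_normal T x) b = 0 ->
  cross ('D_a (wulff_normal T) x) ('D_b (wulff_normal T) x) =
  wulff_curvature T x *: cross a b.
Proof.
move=> /wulff_neq0 x0; move: a b.
have dN := wulff_normal_differentiable x0.
set N := wulff_normal T x; have N1 : dot N N = 1 by exact: wulff_normal_unit.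
have N0 : N != 0 by apply/eqP => e; move/eqP: N1; rewrite e dot0l eq_sym oner_eq0.
have [u u0 Nu] := exists_tangent N0.
have uu := dotvv_gt0 u0.
pose w := cross N u.
have Nw : dot N w = 0 by rewrite dotC dot_crossl.
have uw : dot u w = 0 by rewrite dotC dot_crossr.
have ww : dot w w = dot u u.
  by rewrite dot_cross_cross N1 mul1r Nu mul0r subr0.
have Nuw : dot N (cross u w) = dot u u.
  by rewrite dot_cross_rot dot_cross_rot -/w.
have dec a : dot N a = 0 -> a = (dot a u / dot u u) *: u + (dot a w / dot u u) *: w.
  move=> Na; apply: (@cramer3_unique _ N u w).
  - by rewrite Nuw gt_eqF.
  - by rewrite dotC Na dotDl !dotZl !(dotC _ N) Nu Nw !mulr0 addr0.
  - by rewrite dotDl !dotZl (dotC w u) uw mulr0 addr0 divfK// gt_eqF.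
  - by rewrite dotDl !dotZl uw ww mulr0 add0r divfK// gt_eqF.
apply: (@getPex _ [set k : R | forall a b, dot N a = 0 -> dot N b = 0 ->
  cross ('D_a (wulff_normal T) x) ('D_b (wulff_normal T) x) = k *: cross a b]).
pose U := 'D_u (wulff_normal T) x; pose W := 'D_w (wulff_normal T) x.
exists (dot N (cross U W) / dot u u) => a b /dec-> /dec->.
move: (_ / _) (_ / _) (_ / _) (_ / _) => a1 a2 b1 b2.
have L c d : 'D_(c *: u + d *: w) (wulff_normal T) x = c *: U + d *: W.
  by rewrite /U /W !(deriveE _ dN) linearP linearZ.
have CW : cross U W = (dot N (cross U W) / dot u u) *: cross u w.
  rewrite (tangent_cross N1 Nu Nw) Nuw scalerA divfK ?gt_eqF//.
  by apply: tangent_cross => //; exact: wulff_normal_tangent.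
by rewrite 2!L !cross_lin2 {1}CW !scalerA mulrC.
Qed.

(* A direction in which the normal does not turn would make the Gauss
   curvature vanish. *)
Lemma wulff_normal_injective x v : wulff_shape T x ->
  dot (wulff_normal T x) v = 0 -> 'D_v (wulff_normal T) x = 0 -> v = 0.
Proof.
move=> Wx Nv D0; have x0 := wulff_neq0 Wx.
apply/eqP/negPn/negP => v0.
have N1 := wulff_normal_unit x0.
have Nw : dot (wulff_normal T x) (cross (wulff_normal T x) v) = 0.
  by rewrite dotC dot_crossl.
have := wulff_curvatureP Wx Nv Nw; rewrite D0 cross0l => /esym/eqP.
rewrite scaler_eq0 gt_eqF ?T_curv//= => /eqP.
rewrite cross_cross (dotC v) Nv scale0r subr0 => /eqP.
rewrite scaler_eq0 gt_eqF ?dotvv_gt0//= => /eqP N0.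
by move/eqP: N1; rewrite N0 dot0l eq_sym oner_eq0.
Qed.

Lemma derive_wulff_normal0 x v : x != 0 -> 'D_v ngrad x = 0 ->
  'D_v (wulff_normal T) x = 0.
Proof.
move=> x0 D0; have dg := ngrad_differentiable x0.
have dn : differentiable (@normalize R) (ngrad x).
  have Sn : smooth_on [set y | y != 0] (@normalize R).
    apply: (@smooth_on_normalize _ _ _ id) => //.
    by apply: smooth_on_open => [|n]; [exact: open_neq0|exact: Cn_id].
  have [d _] := CnSP (smooth_on_openP open_neq0 Sn 1%N).
  by apply: d; exact: ngrad_neq0.
rewrite -[LHS]/('D_v (@normalize R \o ngrad) x) (derive_comp v dg dn) D0.
exact: derive0.
Qed.

(** Strict convexity. After scaling to the Wulff shape, a common gradient is a supporting functional
    equal to 1 along the whole segment between the two points, so the gradient is constant there.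
    The normal then does not turn along the segment, which forces its direction to be zero. *)
Lemma ngrad_injective x y : x != 0 -> y != 0 -> T x = T y ->
  ngrad x = ngrad y -> x = y.
Proof.
move=> x0 y0 Txy gxy.
pose a := (T x)^-1; have a0 : 0 < a by rewrite invr_gt0 norm_pos.
have T1 : T (a *: x) = 1 by rewrite normZ_pos// mulVf// gt_eqF// norm_pos.
pose v := a *: y - a *: x.
have ax0 : a *: x != 0 by rewrite scaler_eq0 negb_or gt_eqF.
have gv : dot v (ngrad x) = 0.
  by rewrite dotBl !dotZl euler// gxy euler// Txy subrr.
have seg h : 0 < h -> h < 1 -> ngrad (h *: v + a *: x) = ngrad x.
  move=> h0 h1.
  have E : dot (h *: v + a *: x) (ngrad x) = 1.
    by rewrite dotDl dotZl gv mulr0 add0r dotZl euler// mulVf// gt_eqF// norm_pos.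
  have z0 : h *: v + a *: x != 0.
    by apply/eqP => z0; move/eqP: E; rewrite z0 dot0l eq_sym oner_eq0.
  apply: ngrad_unique => // [z|]; first exact: subgradient.
  apply/eqP; rewrite eq_le subgradient//= E.
  have -> : h *: v + a *: x = h *: (a *: y) + (1 - h) *: (a *: x).
    by rewrite /v scalerBr scalerBl scale1r -addrA (addrC (- _)).
  have [_ _ tri] := T_norm; rewrite (le_trans (tri _ _))//.
  rewrite !normZ_pos ?subr_gt0// -Txy /a mulVf ?gt_eqF ?norm_pos//; lra.
have v0 : v = 0.
  apply: (@wulff_normal_injective (a *: x)).
  - exact: T1.
  - by rewrite /wulff_normal /normalize dotZl dotC -/(ngrad _) ngradZ// gv mulr0.
  - apply: (derive_wulff_normal0 ax0); apply: derive_constant.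
      exact: diff_derivable (ngrad_differentiable ax0).
    by move=> h h0 h1; rewrite seg// ngradZ.
apply: (scalerI (lt0r_neq0 a0)); apply/eqP; rewrite eq_sym -subr_eq0.
by rewrite -/v v0.
Qed.

(* The gradient of [T ^+ 2 / 2] *)
Definition legendre (x : 'rV[R]_3) : 'rV[R]_3 := T x *: ngrad x.

Definition legendre_inv (u : 'rV[R]_3) : 'rV[R]_3 :=
  get [set x | x != 0 /\ legendre x = u].

Lemma legendre_Cn n : Cn n [set x | x != 0] legendre.
Proof. by apply: Cn_scale; [exact: open_neq0|exact: norm_Cn|exact: ngrad_Cn]. Qed.

(* [x] is obtained by maximizing [dot u y / T y]. *)
Lemma legendre_surj u : u != 0 -> exists x, x != 0 /\ legendre x = u.
Proof.
move=> u0; pose f y := dot u y * (T y)^-1.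
have Sf : smooth_on [set x | x != 0] f.
  apply: smooth_onM.
    apply: smooth_on_dot; first exact: smooth_on_cst.
    by apply: smooth_on_open => [|n]; [exact: open_neq0|exact: Cn_id].
  by apply: smooth_onV => // x x0; rewrite gt_eqF// norm_pos.
have [] := @EVT_max_rV R 3 f [set x | `|x| = 1].
- exists (`|u|^-1 *: u).
  by rewrite /= normrZ normfV normr_id mulVf// normr_eq0.
- exact: sphere_compact.
- apply: continuous_in_subspaceT => x; rewrite inE/= => x1.
  apply: (Cn_continuous (smooth_on_openP open_neq0 Sf 0%N)).
  by rewrite /= -normr_eq0 x1 oner_eq0.
move=> z; rewrite inE/= => z1 Hz.
have z0 : z != 0 by rewrite -normr_eq0 z1 oner_eq0.
have Tz := norm_pos z0.
have H y : dot u y <= f z * T y.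
  have [->|y0] := eqVneq y 0; first by rewrite dot0r norm0 mulr0.
  have ny : 0 < `|y| by rewrite normr_gt0.
  have := Hz (`|y|^-1 *: y); rewrite inE/= normrZ normfV normr_id mulVf ?gt_eqF//.
  move=> /(_ erefl); rewrite {1}/f dotZr normZ_pos ?invr_gt0// invfM invrK.
  rewrite mulrACA mulVf ?gt_eqF// mul1r.
  by rewrite ler_pdivrMr ?norm_pos.
have M0 : 0 < f z.
  have := H u; have := dotvv_gt0 u0; have := norm_pos u0 => a b c.
  by rewrite -(pmulr_lgt0 _ a) (lt_le_trans b).
have gz : ngrad z = (f z)^-1 *: u.
  apply: ngrad_unique => // [y|].
    by rewrite dotZr mulrC ler_pdivrMr// dotC mulrC.
  by rewrite dotZr dotC /f invfM invrK mulrAC mulVf ?mul1r//;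
    apply: contraTneq M0; rewrite /f => ->; rewrite mul0r ltxx.
(* [legendre] is homogeneous of degree one and [legendre z = (T z / f z) *: u], whence the scaling
   factor. *)
have c0 : 0 < f z / T z by exact: divr_gt0.
exists ((f z / T z) *: z); split.
  by rewrite scaler_eq0 negb_or z0 gt_eqF.
rewrite /legendre (normZ_pos z c0) (ngradZ c0 z0) divfK ?gt_eqF//.
by rewrite gz scalerA divff ?gt_eqF// scale1r.
Qed.

Lemma dot_legendre x : x != 0 -> dot x (legendre x) = T x ^+ 2.
Proof. by move=> x0; rewrite dotZr euler. Qed.

(** Pairing the common image with [y] gives [T y ^+ 2 <= T x * T y] by [subgradient]. By symmetry
    [T x = T y], and the gradients agree as well. *)
Lemma legendre_inj x y : x != 0 -> y != 0 -> legendre x = legendre y -> x = y.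
Proof.
move=> x0 y0 E; have Tx := norm_pos x0; have Ty := norm_pos y0.
have le a b : a != 0 -> b != 0 -> legendre a = legendre b -> T b <= T a.
  move=> a0 b0 ab; have := subgradient b a0.
  rewrite -(ler_pM2l (norm_pos a0)) -dotZr -/(legendre a) ab dot_legendre//.
  by rewrite expr2 ler_pM2r// norm_pos.
have Txy : T x = T y by apply/eqP; rewrite eq_le !le.
apply: ngrad_injective => //.
by apply: (scalerI (lt0r_neq0 Tx)); rewrite -/(legendre x) E Txy.
Qed.

Lemma legendre_invP u : u != 0 ->
  legendre_inv u != 0 /\ legendre (legendre_inv u) = u.
Proof.
move=> /legendre_surj[x Hx].
by apply: (@getPex _ [set x | x != 0 /\ legendre x = u]); exists x.
Qed.

Lemma legendre_invK x : x != 0 -> legendre x != 0 -> legendre_inv (legendre x) = x.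
Proof.
by move=> x0 /legendre_invP[z0 E]; apply: legendre_inj.
Qed.

Lemma legendre_neq0 x : x != 0 -> legendre x != 0.
Proof. by move=> x0; rewrite scaler_eq0 negb_or gt_eqF ?norm_pos ?ngrad_neq0. Qed.

(** A kernel vector [v] satisfies [T x *: 'D_v ngrad x + 'D_v T x *: ngrad x = 0]. Pairing with [x],
    where [dot x ('D_v ngrad x) = 0] by Euler's identity differentiated, gives ['D_v T x = 0] and
    then ['D_v ngrad x = 0]: a tangent direction in which the normal does not turn. *)
Lemma jacobian_legendre_unit x : x != 0 -> jacobian legendre x \in unitmx.
Proof.
move=> x0; have dT := norm_differentiable x0; have dg := ngrad_differentiable x0.
rewrite -row_free_unit; apply/inj_row_free => v vJ.
have [dL DL] := differentiable_scale dT dg.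
have E : T x *: 'D_v ngrad x + 'D_v T x *: ngrad x = 0.
  by rewrite -DL deriveEjacobian.
have xg : dot x ('D_v ngrad x) = 0.
  have di : differentiable (@id 'rV[R]_3) x by [].
  have := derive_dot v di dg; rewrite derive_id.
  rewrite (near_eq_derive (g := T)).
    by rewrite derive_norm// => /eqP; rewrite addrC -subr_eq subrr eq_sym => /eqP.
  near=> y; apply: euler; near: y.
  by apply: open_nbhs_nbhs; split; [exact: open_neq0|].
have Tv : 'D_v T x = 0.
  have := congr1 (dot x) E; rewrite dotDr !dotZr xg mulr0 add0r euler// dot0r.
  by move=> /eqP; rewrite mulf_eq0 (gt_eqF (norm_pos x0)) orbF => /eqP.
have Dg : 'D_v ngrad x = 0.
  move: E; rewrite Tv scale0r addr0 => /eqP.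
  by rewrite scaler_eq0 gt_eqF ?norm_pos//= => /eqP.
pose a := (T x)^-1; have a0 : 0 < a by rewrite invr_gt0 norm_pos.
have ax0 : a *: x != 0 by rewrite scaler_eq0 negb_or gt_eqF.
apply: (@wulff_normal_injective (a *: x)).
- by rewrite /wulff_shape/= normZ_pos// mulVf// gt_eqF// norm_pos.
- rewrite /wulff_normal /normalize dotZl dotC -/(ngrad _) ngradZ//.
  by rewrite -derive_norm// Tv mulr0.
- apply: (derive_wulff_normal0 ax0).
  have aK : a^-1 *: (a *: x) = x by rewrite scalerA mulVf ?scale1r// gt_eqF.
  have ds : differentiable (fun y : 'rV[R]_3 => a^-1 *: y) (a *: x).
    exact: differentiableZ.
  rewrite (near_eq_derive (g := ngrad \o (fun y => a^-1 *: y))); last first.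
    have a1 : 0 < a^-1 by rewrite invr_gt0.
    near=> y; apply/esym; apply: (ngradZ a1); near: y.
    by apply: open_nbhs_nbhs; split; [exact: open_neq0|].
  have dg' : differentiable ngrad (a^-1 *: (a *: x)) by rewrite aK.
  rewrite (derive_comp v ds dg') aK.
  have -> : 'D_v (fun y : 'rV[R]_3 => a^-1 *: y) (a *: x) = a^-1 *: v.
    by rewrite deriveZ// derive_id.
  by have := derive_linear dg a^-1 v 0; rewrite addr0 Dg scaler0 add0r derive0.
Unshelve. all: by end_near. Qed.

(** These bounds confine [legendre_inv] near a nonzero vector to a compact set away from the origin,
    where a cluster point can be found. *)
Lemma legendre_inv_bounds : exists c C : R, [/\ 0 < c, 0 < C &
  forall u, u != 0 -> `|legendre_inv u| <= c * `|u| /\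
    dot u u <= C * `|u| * `|legendre_inv u|].
Proof.
have [C C0 HC] := norm_upper; have [c c0 Hc] := norm_lower.
(* For [x = legendre_inv u] one has [T x ^+ 2 = dot x u] and [dot u u <= T x * T u]. The factor 3 is
   that of [dot_le_norm], the norm of the space being the sup norm. *)
exists (3 / c ^+ 2), (C ^+ 2); split; rewrite ?divr_gt0 ?exprn_gt0//.
move=> u u0; have [x0 E] := legendre_invP u0; move: (legendre_inv u) x0 E => x x0 E.
have nx : 0 < `|x| by rewrite normr_gt0.
split.
  have H1 : (c * `|x|) ^+ 2 <= 3 * `|x| * `|u|.
    rewrite (le_trans _ (dot_le_norm x u))// -E dot_legendre// ler_sqr ?nnegrE//.
    - by rewrite mulr_ge0 ?ltW.
    - exact: norm_ge0.
  rewrite mulrAC ler_pdivlMr ?exprn_gt0// -(ler_pM2r nx).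
  move: H1; rewrite exprMn; lra.
have -> : C ^+ 2 * `|u| * `|x| = (C * `|x|) * (C * `|u|) by ring.
rewrite -{1}E dotZl dotC.
apply: le_trans (ler_wpM2l (norm_ge0 x) (subgradient u x0)) _.
exact: ler_pM (norm_ge0 x) (norm_ge0 u) (HC x) (HC u).
Qed.

(* A cluster point [z] of [legendre_inv] at [u] is nonzero, and satisfies
   [legendre z = u] by continuity of [legendre]. *)
Lemma legendre_inv_continuous u : u != 0 -> {for u, continuous legendre_inv}.
Proof.
move=> u0; have [c [C [c0 C0 HcC]]] := legendre_inv_bounds.
have uu := dotvv_gt0 u0; have nu : 0 < `|u| by rewrite normr_gt0.
(* For [w] near [u], |w| < 2 |u| and [dot w w > dot u u / 2], so the bounds place |legendre_inv w|
   between [r] and [r']. At [u] itself both inequalities are strict, which makes [V] a neighbourhood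
   of [legendre_inv u]. *)
pose r := dot u u / (4 * C * `|u|); pose r' := 2 * c * `|u|.
have r0 : 0 < r by rewrite divr_gt0// !mulr_gt0.
pose V := [set x : 'rV[R]_3 | r <= `|x|] `&` [set x | `|x| <= r'].
have cV : compact V.
  apply: bounded_closed_compact.
    exists r'; split; first exact: num_real.
    by move=> M M1 x [_ /= Hx]; apply: le_trans Hx _; exact: ltW.
  apply: closedI.
    apply: (@preimage_closed _ _ (fun x : 'rV[R]_3 => `|x|) [set t | r <= t]).
      by move=> x _; exact: norm_continuous.
    exact: closed_ge.
  apply: (@preimage_closed _ _ (fun x : 'rV[R]_3 => `|x|) [set t | t <= r']).
    by move=> x _; exact: norm_continuous.
  exact: closed_le.
have V0 x : V x -> x != 0.
  by move=> [/= rx _]; rewrite -normr_gt0 (lt_le_trans r0).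
have nearu : \forall w \near u, w != 0 /\ V (legendre_inv w).
  have n0 : \forall w \near u, w != 0.
    by apply: open_nbhs_nbhs; split; [exact: open_neq0|].
  have n1 : \forall w \near u, `|w| < 2 * `|u|.
    have cu : {for u, continuous (fun w : 'rV[R]_3 => `|w|)} by exact: norm_continuous.
    by apply: (cu [set t | t < 2 * `|u|]); apply: open_nbhs_nbhs; split;
      [exact: open_lt|rewrite /=; lra].
  have n2 : \forall w \near u, dot u u / 2 < dot w w.
    have cu : {for u, continuous (fun w : 'rV[R]_3 => dot w w)}.
      have S : smooth_on setT (fun w : 'rV[R]_3 => dot w w).
        have Si : smooth_on setT (@id 'rV[R]_3).
          by apply: smooth_on_open => [|n]; [exact: openT|exact: Cn_id].
        exact: smooth_on_dot.
      exact: (Cn_continuous (smooth_on_openP openT S 0%N) Logic.I).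
    by apply: (cu [set t | dot u u / 2 < t]); apply: open_nbhs_nbhs; split;
      [exact: open_gt|rewrite /=; lra].
  near=> w.
  have w0 : w != 0 by near: w.
  have w1 : `|w| < 2 * `|u| by near: w.
  have w2 : dot u u / 2 < dot w w by near: w.
  split=> //; have [B1 B2] := HcC w w0; split=> /=.
    rewrite /r ler_pdivrMr ?mulr_gt0//.
    have : C * `|w| * `|legendre_inv w| <= C * (2 * `|u|) * `|legendre_inv w|.
      by rewrite ler_wpM2r// ler_wpM2l// ltW.
    move: B2 w2; clear; lra.
  rewrite (le_trans B1)// /r' -mulrA (mulrC 2) -mulrA (mulrC _ 2) ler_wpM2l// ltW//.
have [x0 Ex] := legendre_invP u0; have Vx : V (legendre_inv u).
  by have [] := nbhs_singleton nearu.
have [B1 B2] := HcC u u0.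
have nV : nbhs (legendre_inv u) V.
  have cn : {for legendre_inv u, continuous (fun w : 'rV[R]_3 => `|w|)}.
    exact: norm_continuous.
  have n1 : \forall x \near legendre_inv u, r < `|x|.
    apply: (cn [set t | r < t]); apply: open_nbhs_nbhs; split; first exact: open_gt.
    rewrite /= /r ltr_pdivrMr ?mulr_gt0//; move: B2 uu; clear; lra.
  have n2 : \forall x \near legendre_inv u, `|x| < r'.
    apply: (cn [set t | t < r']); apply: open_nbhs_nbhs; split; first exact: open_lt.
    rewrite /= (le_lt_trans B1)// /r' -mulrA ltr_pMl ?mulr_gt0//; lra.
  by near=> x; split; apply: ltW; near: x.
pose F := legendre_inv @ u.
have FV : F V by apply: filterS nearu => w [].
have clu z : cluster F z -> z = legendre_inv u.
  move=> Fz; have Vz : V z.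
    by apply: (compact_closed (@norm_hausdorff _ _) cV); move=> B Bz; exact: Fz.
  have z0 := V0 _ Vz.
  apply: legendre_inj => //; rewrite Ex.
  apply/esym/(@norm_hausdorff _ 'rV[R]_3) => A B Au Bz.
  have cl := Cn_continuous (legendre_Cn 0%N) z0.
  have FA : F (legendre @^-1` A).
    rewrite /F /=; near=> w; rewrite /=.
    have w0 : w != 0 by have [] : w != 0 /\ V (legendre_inv w) by near: w.
    by have [_ ->] := legendre_invP w0; near: w.
  have [y [Ay By]] := Fz _ _ FA (cl _ Bz).
  by exists (legendre y).
have PF : ProperFilter F by apply: fmap_proper_filter; exact: nbhs_pfilter.
apply: (compact_cluster_set1 (@norm_hausdorff _ _) cV nV PF FV).
apply/seteqP; split=> [z /clu//|z /= ->].
have [y [Vy cy]] := cV F PF FV.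
by rewrite -(clu y cy).
Unshelve. all: by end_near. Qed.

Lemma legendre_inv_Cn n : Cn n [set u | u != 0] legendre_inv.
Proof.
apply: (@inverse_smooth _ _ [set x | x != 0] _ legendre); [exact: open_neq0|exact: legendre_Cn|..].
- by move=> u /legendre_invP[].
- exact: legendre_inv_continuous.
- by move=> u /legendre_invP[].
- by move=> u /legendre_invP[x0 _]; exact: jacobian_legendre_unit.
Qed.

(** Uniqueness of the Wulff point comes from [legendre]: a point of the Wulff shape with normal [u],
    divided by the length of its gradient, is mapped to [u]. *)
Lemma wulff_point_legendre u : dot u u = 1 ->
  wulff_point T u = (T (legendre_inv u))^-1 *: legendre_inv u.
Proof.
move=> u1.
have u0 : u != 0 by apply/eqP => e; move/eqP: u1; rewrite e dot0l eq_sym oner_eq0.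
have uniq x : wulff_shape T x -> wulff_normal T x = u ->
    x = (T (legendre_inv u))^-1 *: legendre_inv u.
  move=> Wx Nx; have x0 := wulff_neq0 Wx.
  pose c := (enorm (ngrad x))^-1.
  have c0 : 0 < c by rewrite invr_gt0 enorm_gt0// ngrad_neq0.
  have E : legendre (c *: x) = u.
    rewrite /legendre (normZ_pos x c0) (ngradZ c0 x0) Wx mulr1.
    exact: Nx.
  have cx0 : c *: x != 0 by rewrite scaler_eq0 negb_or gt_eqF.
  have -> : legendre_inv u = c *: x by rewrite -E legendre_invK// legendre_neq0.
  by rewrite (normZ_pos x c0) Wx mulr1 scalerA mulVf ?scale1r// gt_eqF.
have [z0 E] := legendre_invP u0; move: uniq; set z := legendre_inv u in z0 E *.
move=> uniq; have a0 : 0 < (T z)^-1 by rewrite invr_gt0 norm_pos.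
have [Wx Nx] : [set x | wulff_shape T x /\ wulff_normal T x = u] (wulff_point T u).
  apply: (@getPex _ [set x | wulff_shape T x /\ wulff_normal T x = u]).
  exists ((T z)^-1 *: z); split.
    by rewrite /wulff_shape/= normZ_pos// mulVf// gt_eqF// norm_pos.
  rewrite /wulff_normal -/(ngrad _) (ngradZ a0 z0).
  rewrite -(normalizeZ (ngrad z) (norm_pos z0)) -/(legendre z) E.
  by rewrite /normalize /enorm u1 sqrtr1 invr1 scale1r.
exact: uniq.
Qed.

Lemma wulff_pointP u : dot u u = 1 ->
  wulff_shape T (wulff_point T u) /\ wulff_normal T (wulff_point T u) = u.
Proof.
move=> u1; rewrite wulff_point_legendre//.
have u0 : u != 0 by apply/eqP => e; move/eqP: u1; rewrite e dot0l eq_sym oner_eq0.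
have [z0 E] := legendre_invP u0; set z := legendre_inv u in z0 E *.
have a0 : 0 < (T z)^-1 by rewrite invr_gt0 norm_pos.
split; first by rewrite /wulff_shape/= normZ_pos// mulVf// gt_eqF// norm_pos.
rewrite /wulff_normal -/(ngrad _) (ngradZ a0 z0).
rewrite -(normalizeZ (ngrad z) (norm_pos z0)) -/(legendre z) E.
by rewrite /normalize /enorm u1 sqrtr1 invr1 scale1r.
Qed.

(** [u] is a positive multiple of the gradient of [T] at its Wulff point, so [subgradient] bounds
    [dot u y]. *)
Lemma dot_wulff_point_max u y : dot u u = 1 -> T y = 1 ->
  dot u y <= dot u (wulff_point T u).
Proof.
move=> u1 Ty; rewrite wulff_point_legendre//.
have u0 : u != 0 by apply/eqP => e; move/eqP: u1; rewrite e dot0l eq_sym oner_eq0.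
have [z0 E] := legendre_invP u0; set z := legendre_inv u in z0 E *.
have Tz := norm_pos z0.
rewrite -{1 2}E dotZr [in leRHS]dotC dot_legendre// dotZl.
rewrite expr2 mulKf ?gt_eqF// -[leRHS]mulr1 ler_pM2l// dotC -Ty.
exact: subgradient.
Qed.

Lemma dual_norm_wulff_point u : dot u u = 1 -> dual_norm T u = dot u (wulff_point T u).
Proof.
move=> u1; have [Wx _] := wulff_pointP u1.
apply/eqP; rewrite eq_le; apply/andP; split.
  apply: ge_sup; first by exists (dot u (wulff_point T u)), (wulff_point T u).
  by move=> _ [y Ty <-]; exact: dot_wulff_point_max.
apply: ub_le_sup; last by exists (wulff_point T u).
exists (dot u (wulff_point T u)) => _ [y Ty <-].
exact: dot_wulff_point_max.
Qed.

Lemma wulff_normal_ngrad x : ngrad x = enorm (ngrad x) *: wulff_normal T x.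
Proof. exact: normalizeE. Qed.

(** Agrees with [wulff_point T] at unit vectors, and is given on an open set of R^3, where
    smoothness can be stated by [Cn]. *)
Definition wulff_map (u : 'rV[R]_3) := (T (legendre_inv u))^-1 *: legendre_inv u.

Lemma wulff_map_Cn n : Cn n [set u | u != 0] wulff_map.
Proof.
have nz u : u != 0 -> legendre_inv u != 0 by move=> /legendre_invP[].
apply: Cn_scale; [exact: open_neq0| |exact: legendre_inv_Cn].
apply: CnV; first exact: open_neq0.
  by move=> u /nz z0; rewrite gt_eqF// norm_pos.
exact: (Cn_comp_row open_neq0 nz (legendre_inv_Cn n) (norm_Cn n)).
Qed.

End NormCalculus.

(** * The Cahn-Hoffman field *)

Section TdiffRules.
Context {R : realType} (S : surface R).
Implicit Types (p : S) (W Z : normedModType R).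

Lemma tdiff_compose W Z (f : S -> W) (F : W -> Z) p e : smooth f ->
  differentiable F (f p) -> tdiff (F \o f) p e = 'D_(tdiff f p e) F (f p).
Proof.
move=> Sf dF; have [d E] := crd_atP p; set c := chart_at p in d E.
have := derive_in_compose (F := F) (dom_relopen c) e (Sf c) d.
by rewrite /= E; apply.
Qed.

Lemma tdiff_dot (f g : S -> 'rV[R]_3) p e : smooth f -> smooth g ->
  tdiff (fun p => dot (f p) (g p)) p e =
  dot (tdiff f p e) (g p) + dot (f p) (tdiff g p e).
Proof.
move=> Sf Sg; have [d E] := crd_atP p; set c := chart_at p in d E.
have := derive_in_dot (dom_relopen c) e (Sf c) (Sg c) d.
by rewrite /= E.
Qed.

Lemma tdiff_cst W (w : W) p e : tdiff (fun _ : S => w) p e = 0.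
Proof.
have [d E] := crd_atP p.
exact: (derive_in_cst (dom_relopen _) w e d).
Qed.

Lemma smooth_comp_row m W (f : S -> 'rV[R]_m) (F : 'rV[R]_m -> W)
    (P : set 'rV[R]_m) : open P -> (forall n, Cn n P F) ->
  (forall p, P (f p)) -> smooth f -> smooth (F \o f).
Proof.
move=> oP HF fP Sf i.
apply: (smooth_on_lift (f := f \o par i) oP) => //.
  by move=> O g oO gP Hg n; exact: (Cn_comp_row oO gP (Hg n) (HF n)).
by move=> x _; exact: fP.
Qed.

Lemma smooth_dot (f g : S -> 'rV[R]_3) : smooth f -> smooth g ->
  smooth (fun p => dot (f p) (g p)).
Proof. by move=> Sf Sg i; exact: smooth_on_dot (Sf i) (Sg i). Qed.

End TdiffRules.

Section CahnHoffman.
Context {R : realType} (T : 'rV[R]_3 -> R) (S : surface R) (nu : S -> 'rV[R]_3).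
Implicit Types (i : idx S) (p : S).
Hypothesis T_norm : is_norm T.
Hypothesis T_smooth : smooth_on [set x | x != 0] T.
Hypothesis T_curv : forall x, wulff_shape T x -> 0 < wulff_curvature T x.
Hypothesis Snu : smooth nu.
Hypothesis nu1 : forall p, dot (nu p) (nu p) = 1.
Hypothesis nuJ : forall p, dot (nu p) (cross (td0 nu p) (td1 nu p)) != 0.

Definition wulff_field p := wulff_point T (nu p).
Local Notation xi := wulff_field.
Local Notation tau := (dual_norm T \o nu).

Lemma nu_neq0 p : nu p != 0.
Proof. by apply/eqP => e; have /eqP := nu1 p; rewrite e dot0l eq_sym oner_eq0. Qed.

Lemma smooth_wulff_field : smooth xi.
Proof.
have -> : xi = wulff_map T \o nu.
  by apply/funext => p; rewrite /wulff_field wulff_point_legendre.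
exact: (smooth_comp_row (@open_neq0 R)
  (wulff_map_Cn T_norm T_smooth T_curv) nu_neq0 Snu).
Qed.

Lemma smooth_dual_norm : smooth tau.
Proof.
have -> : tau = (fun p => dot (nu p) (xi p)).
  by apply/funext => p; rewrite /= dual_norm_wulff_point.
exact: smooth_dot Snu smooth_wulff_field.
Qed.

Lemma wulff_fieldP p : wulff_shape T (xi p) /\ wulff_normal T (xi p) = nu p.
Proof. exact: wulff_pointP. Qed.

(** Differentiate [T \o xi = 1]: the gradient of [T] at [xi p] is a positive multiple of [nu p]. *)
Lemma dot_nu_tdiff_wulff_field p e : dot (nu p) (tdiff xi p e) = 0.
Proof.
have [W N] := wulff_fieldP p; have x0 := wulff_neq0 T_norm W.
have := tdiff_compose (F := T) e smooth_wulff_field (norm_differentiable T_smooth x0).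
have -> : T \o xi = fun=> 1.
  by apply/funext => p'; have [] := wulff_fieldP p'.
rewrite tdiff_cst (derive_norm T_smooth)// wulff_normal_ngrad N dotZr => /esym/eqP.
rewrite mulf_eq0 gt_eqF ?enorm_gt0 ?ngrad_neq0//= => /eqP.
by rewrite dotC.
Qed.

(** In the derivative of [xi . nu] the term with [d xi] vanishes. Hence [xi] has the scalar products
    that characterize [gmap nu tau]. *)
Lemma tdiff_dual_norm p e : tdiff tau p e = dot (xi p) (tdiff nu p e).
Proof.
have -> : tau = (fun p => dot (xi p) (nu p)).
  by apply/funext => p'; rewrite /= dual_norm_wulff_point// dotC.
rewrite (tdiff_dot _ _ smooth_wulff_field Snu).
by rewrite (dotC (tdiff xi p e)) dot_nu_tdiff_wulff_field add0r.
Qed.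

Lemma gmap_dual_norm p : gmap nu tau p = xi p.
Proof.
apply/esym/(gmap_unique Snu nu1 nuJ).
- by rewrite /= dual_norm_wulff_point// dotC.
- by rewrite -!td0E tdiff_dual_norm.
- by rewrite -!td1E tdiff_dual_norm.
Qed.

Lemma td_wulff_field p :
  td0 xi p = wulff_matrix T nu p 0 0 *: td0 nu p + wulff_matrix T nu p 1 0 *: td1 nu p /\
  td1 xi p = wulff_matrix T nu p 0 1 *: td0 nu p + wulff_matrix T nu p 1 1 *: td1 nu p.
Proof.
have -> : xi = gmap nu tau by apply/funext => p'; rewrite gmap_dual_norm.
have := td_gmap (@Snu) nu1 nuJ p (@smooth_dual_norm).
by rewrite /hessI -/(wulff_matrix T nu p).
Qed.

(** [nu] is [wulff_normal T] composed with [xi], so [K_W] takes the cross product of the [d xi] to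
    that of the [d nu], and the determinant of [wulff_matrix] takes it back. *)
Lemma det_wulff_matrix p :
  wulff_curvature T (wulff_point T (nu p)) * \det (wulff_matrix T nu p) = 1.
Proof.
have [W N] := wulff_fieldP p; have x0 := wulff_neq0 T_norm W.
have dN := wulff_normal_differentiable T_norm T_smooth x0.
have E e : tdiff nu p e = 'D_(tdiff xi p e) (wulff_normal T) (xi p).
  rewrite -(tdiff_compose e smooth_wulff_field dN); congr tdiff.
  by apply/funext => p'; have [_ <-] := wulff_fieldP p'.
have t0 := dot_nu_tdiff_wulff_field p (frame R 0).
have t1 := dot_nu_tdiff_wulff_field p (frame R 1).
rewrite -N in t0 t1.
have := wulff_curvatureP T_norm T_smooth W t0 t1.
rewrite -!E !td0E !td1E; have [-> ->] := td_wulff_field p.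
rewrite cross_lin2 => H.
have := congr1 (dot (nu p)) H; rewrite 2!dotZr => H'.
apply: (mulIf (nuJ p)); rewrite mul1r [RHS]H' det2E /wulff_field; ring.
Qed.

(** Each Wulff point maximizes the scalar product with its own normal over the Wulff shape; the two
    inequalities are added. *)
Lemma dot_wulff_field_monotone p p' : 0 <= dot (xi p - xi p') (nu p - nu p').
Proof.
have [W N] := wulff_fieldP p; have [W' N'] := wulff_fieldP p'.
have H := dot_wulff_point_max T_norm T_smooth T_curv (nu1 p) W'.
have H' := dot_wulff_point_max T_norm T_smooth T_curv (nu1 p') W.
move: H H'; rewrite -!/(wulff_field _) !dotBl !dotBr.
rewrite (dotC (xi p)) (dotC (xi p')) (dotC (xi p')) (dotC (xi p)).
by move: (dot _ _) (dot _ _) (dot _ _) (dot _ _) => a b c d; lra.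
Qed.

(** Positivity of the Wulff curvature controls only the determinant of [wulff_matrix]. The sign of
    the form itself comes from monotonicity, passed to the limit in difference quotients. *)
Lemma dot_tdiff_wulff_field_ge0 p e : 0 <= dot (tdiff xi p e) (tdiff nu p e).
Proof.
have [d E] := crd_atP p; set c := chart_at p in d E; set x := crd_at p in d E.
have rA := dom_relopen c.
have [U [f [oU Ux Hf ff Df]]] := smooth_on_extend rA (smooth_wulff_field (i := c)) d.
have [V [g [oV Vx Hg gg Dg]]] := smooth_on_extend rA (@Snu c) d.
have -> : tdiff xi p e = 'D_e f x by exact: Df.
have -> : tdiff nu p e = 'D_e g x by exact: Dg.
have df : differentiable f x by have [df _] := CnSP (Hf 1%N); exact: df.
have dg : differentiable g x by have [dg _] := CnSP (Hg 1%N); exact: dg.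
have coord (h : R * R -> 'rV[R]_3) (dh : differentiable h x) (k : 'I_3) :
    (fun t : R => t^-1 * (h (t *: e + x) 0 k - h x 0 k)) @ 0^' --> ('D_e h x) 0 k.
  have dhi : derivable (fun y => h y 0 k) x e.
    by have /derivable_mxP := diff_derivable (v := e) dh; apply.
  rewrite (derive_mx (diff_derivable dh)) mxE; exact: dhi.
pose q t := t^-1 * (f (t *: e + x) 0 0 - f x 0 0) * (t^-1 * (g (t *: e + x) 0 0 - g x 0 0))
  + t^-1 * (f (t *: e + x) 0 1 - f x 0 1) * (t^-1 * (g (t *: e + x) 0 1 - g x 0 1))
  + t^-1 * (f (t *: e + x) 0 2 - f x 0 2) * (t^-1 * (g (t *: e + x) 0 2 - g x 0 2)).
have lim : q @ 0^' --> dot ('D_e f x) ('D_e g x).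
  by rewrite dotE; apply: cvgD; [apply: cvgD|]; apply: cvgM; exact: coord.
rewrite leNgt; apply/negP => neg.
have nq : \forall t \near 0^', q t < 0 by exact: (cvgr_lt _ lim _ neg).
have nUV : \forall t \near (0 : R), U (t *: e + x) /\ V (t *: e + x).
  by near=> t; split; near: t; apply: cvg_line; exact: open_nbhs_nbhs.
have /nbhs_ballP[r1 /= r10 H1] := nq.
have /nbhs_ballP[r2 /= r20 H2] := nUV.
have m0 : 0 < Num.min r1 r2 by rewrite lt_min r10 r20.
(* At a boundary point only increments of one sign may remain in the chart; either sign will do,
   since [q t] is the square of [t^-1] times the monotone product. *)
have [t [t0 tm dt]] := relopen_approachable e rA d m0.
move: tm; rewrite lt_min => /andP[t1 t2].
have qt : q t < 0 by apply: H1 => //; rewrite /ball/= sub0r normrN.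
have [Ut Vt] : U (t *: e + x) /\ V (t *: e + x).
  by apply: H2; rewrite /ball/= sub0r normrN.
have := dot_wulff_field_monotone (par c (t *: e + x)) (par c x).
rewrite -[xi _]/((xi \o par c) (t *: e + x)) -[xi (par c x)]/((xi \o par c) x).
rewrite -[nu _]/((nu \o par c) (t *: e + x)) -[nu (par c x)]/((nu \o par c) x).
rewrite !ff// !gg// => M.
have : q t = (t^-1) ^+ 2 * dot (f (t *: e + x) - f x) (g (t *: e + x) - g x).
  by rewrite dotE !mxE /q; ring.
move=> qE; move: qt; rewrite qE ltNge mulr_ge0//.
exact: sqr_ge0.
Unshelve. all: by end_near. Qed.

End CahnHoffman.

(** A symmetric form is diagonalized relative to a positive definite one by explicit eigenvectors.
    When [c12 != 0] the discriminant is a square plus a positive multiple of [c12 ^+ 2], so the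
    eigenvalues are real and distinct. *)
Lemma pencil_eigen (R : realType) (b11 b12 b22 h11 h12 h22 : R) :
  0 < h11 -> 0 < h11 * h22 - h12 * h12 ->
  exists (m e f : R * R), [/\ det2 e f != 0,
    b11 * e.1 + b12 * e.2 = m.1 * (h11 * e.1 + h12 * e.2) /\
    b12 * e.1 + b22 * e.2 = m.1 * (h12 * e.1 + h22 * e.2) &
    b11 * f.1 + b12 * f.2 = m.2 * (h11 * f.1 + h12 * f.2) /\
    b12 * f.1 + b22 * f.2 = m.2 * (h12 * f.1 + h22 * f.2)].
Proof.
move=> h1 D0; set D := h11 * h22 - _ in D0.
have hn : h11 != 0 by rewrite gt_eqF.
pose c12 := h11 * b12 - h12 * b11.
pose c22 := h12 ^+ 2 * b11 - 2 * h12 * h11 * b12 + h11 ^+ 2 * b22.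
pose h2 := h11 * D; have h20 : 0 < h2 by rewrite mulr_gt0.
have h2n : h2 != 0 by rewrite gt_eqF.
(* In the basis [(1, 0), (- h12, h11)] the form [h] is diagonal. *)
have key m x y : b11 * x + c12 * y = m * h11 * x ->
    c12 * x + c22 * y = m * h2 * y ->
    b11 * (x - h12 * y) + b12 * (h11 * y) = m * (h11 * (x - h12 * y) + h12 * (h11 * y)) /\
    b12 * (x - h12 * y) + b22 * (h11 * y) = m * (h12 * (x - h12 * y) + h22 * (h11 * y)).
  move=> E1 E2.
  have F1 : b11 * (x - h12 * y) + b12 * (h11 * y) =
      m * (h11 * (x - h12 * y) + h12 * (h11 * y)).
    have -> : b11 * (x - h12 * y) + b12 * (h11 * y) = b11 * x + c12 * y.
      by rewrite /c12; ring.
    by rewrite E1; ring.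
  split=> //; apply: (mulfI hn).
  have : c12 * x + c22 * y = m * h2 * y by [].
  have -> : h11 * (b12 * (x - h12 * y) + b22 * (h11 * y)) =
    (c12 * x + c22 * y) + h12 * (b11 * x + c12 * y) by rewrite /c12 /c22; ring.
  by rewrite E2 E1 /h2 /D => _; ring.
have [z|z] := eqVneq c12 0.
  exists (b11 / h11, c22 / h2), (1 - h12 * 0, h11 * 0), (0 - h12 * 1, h11 * 1).
  split.
  - by rewrite /det2/= !mulr0 subr0 mul0r subr0 mul1r mulr1.
  - by apply: key; rewrite /= z !(mulr0, mulr1, mul0r, addr0, add0r) ?divfK.
  - by apply: key; rewrite /= z !(mulr0, mulr1, mul0r, addr0, add0r) ?divfK.
pose s := Num.sqrt ((b11 * h2 - c22 * h11) ^+ 2 + 4 * (h11 * h2 * c12 ^+ 2)).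
have c2 : 0 < c12 ^+ 2 by rewrite exprn_even_gt0.
have P0 : 0 < (b11 * h2 - c22 * h11) ^+ 2 + 4 * (h11 * h2 * c12 ^+ 2).
  rewrite ltr_wpDl ?sqr_ge0//; apply: mulr_gt0 => //.
  by apply: mulr_gt0 => //; exact: mulr_gt0.
have s2 : s ^+ 2 = (b11 * h2 - c22 * h11) ^+ 2 + 4 * (h11 * h2 * c12 ^+ 2).
  by rewrite sqr_sqrtr// ltW.
have s0 : s != 0 by rewrite gt_eqF// sqrtr_gt0.
(* [mu s] and [mu (- s)] are the roots [m] of [(m * h11 - b11) * (m * h2 - c22) = c12 ^+ 2], the
   characteristic equation in the basis where [h] is diagonal. *)
pose mu (t : R) := ((b11 * h2 + c22 * h11) + t) / (2 * (h11 * h2)).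
have muP t : t ^+ 2 = s ^+ 2 ->
    c12 * c12 + c22 * (mu t * h11 - b11) = mu t * h2 * (mu t * h11 - b11).
  move=> ts; apply/eqP; rewrite -subr_eq0; apply/eqP.
  have -> : c12 * c12 + c22 * (mu t * h11 - b11) - mu t * h2 * (mu t * h11 - b11) =
    ((b11 * h2 - c22 * h11) ^+ 2 + 4 * (h11 * h2 * c12 ^+ 2) - t ^+ 2) /
    (4 * (h11 * h2)).
    by rewrite /mu; field; rewrite hn h2n.
  by rewrite ts s2 subrr mul0r.
have muE t : b11 * c12 + c12 * (mu t * h11 - b11) = mu t * h11 * c12 by ring.
exists (mu s, mu (- s)), (c12 - h12 * (mu s * h11 - b11), h11 * (mu s * h11 - b11)),
  (c12 - h12 * (mu (- s) * h11 - b11), h11 * (mu (- s) * h11 - b11)); split.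
- rewrite /det2/=.
  have -> : (c12 - h12 * (mu s * h11 - b11)) * (h11 * (mu (- s) * h11 - b11)) -
    h11 * (mu s * h11 - b11) * (c12 - h12 * (mu (- s) * h11 - b11)) =
    - (c12 * h11 * s / h2).
    by rewrite /mu; field; rewrite hn h2n.
  by rewrite oppr_eq0 !mulf_neq0// invr_neq0.
- by apply: key; [exact: muE|exact: muP].
- by apply: key; [exact: muE|apply: muP; rewrite sqrrN].
Qed.

Section Linearity.
Context {R : realType} (S : surface R) (nu : S -> 'rV[R]_3).
Implicit Types (i : idx S) (p : S).
Hypothesis Snu : smooth nu.
Hypothesis nu1 : forall p, dot (nu p) (nu p) = 1.
Hypothesis nuJ : forall p, dot (nu p) (cross (td0 nu p) (td1 nu p)) != 0.

Lemma smooth_lin (W : normedModType R) (f g : S -> W) (c : R) :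
  smooth f -> smooth g -> smooth (fun p => f p + c *: g p).
Proof.
move=> Sf Sg i; apply: (smooth_onD (Sf i)).
exact: (smooth_on_scale (smooth_on_cst c) (Sg i)).
Qed.

Lemma tdiff_lin (W : normedModType R) (f g : S -> W) (c : R) p e :
  smooth f -> smooth g ->
  tdiff (fun p => f p + c *: g p) p e = tdiff f p e + c *: tdiff g p e.
Proof.
move=> Sf Sg; have [d E] := crd_atP p; set k := chart_at p in d E.
have rA := dom_relopen k.
have Sc : smooth_on (dom k) (fun x : R * R => c *: (g \o par k) x).
  exact: (smooth_on_scale (smooth_on_cst c) (Sg k)).
have H1 := derive_inD rA e (Sf k) Sc d.
have H2 := derive_in_scale rA e (smooth_on_cst c) (Sg k) d.
rewrite (derive_in_cst rA _ _ d) scale0r addr0 in H2.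
by rewrite H2 in H1.
Qed.

Lemma gmap_lin (f g : S -> R) (c : R) p : smooth f -> smooth g ->
  gmap nu (fun p => f p + c * g p) p = gmap nu f p + c *: gmap nu g p.
Proof.
move=> Sf Sg; apply/esym/(gmap_unique (@Snu) nu1 nuJ).
all: have [f0 f1 f2] := dot_gmap (@Snu) nu1 nuJ f p.
all: have [g0 g1 g2] := dot_gmap (@Snu) nu1 nuJ g p.
- by rewrite dotDl dotZl f0 g0.
- rewrite dotDl dotZl f1 g1 -!td0E.
  by rewrite -[LHS]/(tdiff f p (frame R 0) + c *: tdiff g p (frame R 0)) -tdiff_lin.
- rewrite dotDl dotZl f2 g2 -!td1E.
  by rewrite -[LHS]/(tdiff f p (frame R 1) + c *: tdiff g p (frame R 1)) -tdiff_lin.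
Qed.

Lemma hessI_lin (f g : S -> R) (c : R) p : smooth f -> smooth g ->
  hessI nu (fun p => f p + c * g p) p = hessI nu f p + c *: hessI nu g p.
Proof.
move=> Sf Sg.
have GU : round_metric nu p \in unitmx.
  by rewrite unitmxE unitfE (det_round_metric_neq0 (@Snu) nu1 nuJ).
apply: (can_inj (mulKmx GU)); rewrite [RHS]mulmxDr -[in RHS]scalemxAr.
rewrite !(hessI_dot (@Snu) nu1 nuJ)//; last exact: (smooth_lin c Sf Sg).
have E : gmap nu (fun p => f p + c * g p) = (fun p => gmap nu f p + c *: gmap nu g p).
  by apply/funext => p'; exact: gmap_lin.
have Gf := smooth_gmap (@Snu) nu1 nuJ Sf; have Gg := smooth_gmap (@Snu) nu1 nuJ Sg.
have E0 : td0 (gmap nu (fun p => f p + c * g p)) p = td0 (gmap nu f) p + c *: td0 (gmap nu g) p.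
  by rewrite E -!td0E tdiff_lin.
have E1 : td1 (gmap nu (fun p => f p + c * g p)) p = td1 (gmap nu f) p + c *: td1 (gmap nu g) p.
  by rewrite E -!td1E tdiff_lin.
by apply/matrixP => i j; rewrite !mxE E0 E1; case: ifP => _; case: ifP => _;
  rewrite dotDr dotZr.
Qed.

Lemma hessI_cst1 p : hessI nu (fun=> 1) p = 1%:M.
Proof.
have g0 : grad nu (fun=> 1) = fun=> 0.
  apply/funext => p'; rewrite /grad big1// => i _; rewrite big1// => j _.
  by rewrite tdiff_cst mulr0 scale0r.
rewrite /hessI /hess g0 (_ : \matrix_(i, j) _ = 0) ?mulmx0 ?add0r//.
by apply/matrixP => i j; rewrite !mxE tdiff_cst dot0r.
Qed.

Lemma smooth_cst (W : normedModType R) (c : W) : smooth (fun _ : S => c).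
Proof. by move=> i; exact: smooth_on_cst. Qed.

Lemma gmap_sym f p : smooth f ->
  dot (td0 nu p) (td1 (gmap nu f) p) = dot (td1 nu p) (td0 (gmap nu f) p).
Proof.
move=> Sf; have [d e] := crd_atP p; set c := chart_at p in d e.
have rA := dom_relopen c.
have SY := smooth_gmap (@Snu) nu1 nuJ Sf.
have := derive_envelope_sym rA (@Snu c) (@chart_jac_neq0 _ _ _ (@Snu) nuJ c) (Sf c) d.
have E v : tdiff (gmap nu f) p v =
    derive_in (dom c) (envelope (dom c) (nu \o par c) (f \o par c)) (crd_at p) v.
  by apply: derive_in_eq => // y dy; rewrite -(gmap_chart (@Snu) nu1 nuJ).
rewrite -!pd0E -!pd1E -!E td0E td1E => H.
by rewrite dotC -[in LHS]td0E -[in RHS]td1E -/c [RHS]dotC; exact: esym.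
Qed.

End Linearity.

(** Determinants of the images of the basis [e], [f] give [\det M = l.1 * l.2 * \det Q] and the
    value [- (l.1 + l.2) * \det Q] for the mixed discriminant; both [l.1] and [l.2] are nonzero
    because [\det M] is. *)
Lemma pencil_trace (R : realType) (Q M : 'M[R]_2) (l e f : R * R) :
  \det Q != 0 -> \det M != 0 -> det2 e f != 0 ->
  M 0 0 * e.1 + M 0 1 * e.2 = - l.1 * (Q 0 0 * e.1 + Q 0 1 * e.2) ->
  M 1 0 * e.1 + M 1 1 * e.2 = - l.1 * (Q 1 0 * e.1 + Q 1 1 * e.2) ->
  M 0 0 * f.1 + M 0 1 * f.2 = - l.2 * (Q 0 0 * f.1 + Q 0 1 * f.2) ->
  M 1 0 * f.1 + M 1 1 * f.2 = - l.2 * (Q 1 0 * f.1 + Q 1 1 * f.2) ->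
  (Q 0 0 * M 1 1 + Q 1 1 * M 0 0 - Q 0 1 * M 1 0 - Q 1 0 * M 0 1) / \det M =
    - l.1^-1 - l.2^-1 /\ \det Q / \det M = l.1^-1 * l.2^-1.
Proof.
rewrite !det2E => Q0 M0; case: l e f => [l1 l2] [x y] [z w]; rewrite /det2/=.
move: (Q 0 0) (Q 0 1) (Q 1 0) (Q 1 1) Q0 => a b c d Q0.
move: (M 0 0) (M 0 1) (M 1 0) (M 1 1) M0 => a' b' c' d' M0 D E0 E1 F0 F1.
have DM : (a' * d' - b' * c') * (x * w - y * z) =
    l1 * l2 * ((a * d - b * c) * (x * w - y * z)).
  have -> : (a' * d' - b' * c') * (x * w - y * z) =
    (a' * x + b' * y) * (c' * z + d' * w) - (c' * x + d' * y) * (a' * z + b' * w).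
    by ring.
  by rewrite E0 E1 F0 F1; ring.
have DQ : (a' * d' - b' * c') = l1 * l2 * (a * d - b * c).
  by apply: (mulIf D); rewrite DM; ring.
have [l10 l20] : l1 != 0 /\ l2 != 0.
  by split; apply/eqP => z0; move/eqP: M0; apply; rewrite DQ z0; ring.
have MD : (a * d' + d * a' - b * c' - c * b') * (x * w - y * z) =
    - (l1 + l2) * ((a * d - b * c) * (x * w - y * z)).
  have -> : (a * d' + d * a' - b * c' - c * b') * (x * w - y * z) =
    (a * x + b * y) * (c' * z + d' * w) - (c * x + d * y) * (a' * z + b' * w) +
    ((a' * x + b' * y) * (c * z + d * w) - (c' * x + d' * y) * (a * z + b * w)).
    by ring.
  by rewrite E0 E1 F0 F1; ring.
have MQ : a * d' + d * a' - b * c' - c * b' = - (l1 + l2) * (a * d - b * c).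
  by apply: (mulIf D); rewrite MD; ring.
by rewrite MQ DQ; split; field; rewrite l10 l20.
Qed.

(** * Anisotropic principal curvatures *)

Section AnisotropicCurvatures.
Context {R : realType} (T : 'rV[R]_3 -> R) (S : surface R) (nu : S -> 'rV[R]_3).
Implicit Types (i : idx S) (p : S).
Hypothesis T_norm : is_norm T.
Hypothesis T_smooth : smooth_on [set x | x != 0] T.
Hypothesis T_curv : forall x, wulff_shape T x -> 0 < wulff_curvature T x.
Hypothesis Snu : smooth nu.
Hypothesis nu1 : forall p, dot (nu p) (nu p) = 1.
Hypothesis nuJ : forall p, dot (nu p) (cross (td0 nu p) (td1 nu p)) != 0.

Local Notation xi := (wulff_field T nu).
Local Notation tau := (dual_norm T \o nu).
Local Notation M := (wulff_matrix T nu).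
Local Notation mix := (mixdisc nu).

Let Stau : smooth tau. Proof. exact: smooth_dual_norm. Qed.
Let Sxi : smooth xi. Proof. exact: smooth_wulff_field. Qed.

Lemma det_wulff_matrix_gt0 p : 0 < \det (M p).
Proof.
have D := det_wulff_matrix T_norm T_smooth T_curv (@Snu) nu1 nuJ p.
have [W _] := wulff_fieldP T_norm T_smooth T_curv nu1 p.
by rewrite -(pmulr_rgt0 _ (T_curv W)) D.
Qed.

Lemma hessI_tau p : hessI nu tau p = M p. Proof. by []. Qed.

Lemma mixdisc_tau p : mix tau tau p = 2 * \det (M p).
Proof. by rewrite det2E /mixdisc hessI_tau; ring. Qed.

Lemma aniso_traceE f p : aniso_trace T nu f p = mix f tau p / \det (M p).
Proof.
have D := lt0r_neq0 (det_wulff_matrix_gt0 p).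
have -> : aniso_trace T nu f p = \tr (hessI nu f p *m invmx (M p)) by [].
rewrite /mixdisc hessI_tau; move: (hessI nu f p) (M p) D => A B D.
rewrite /mxtrace sum2E !mulmx2E.
by have [-> -> -> ->] := invmx2E D; field.
Qed.

Lemma smooth_det_wulff_matrix : smooth (fun p => \det (M p)).
Proof.
move=> i; apply: (smooth_on_eq (f := (fun p => 2^-1 * mix tau tau p) \o par i)).
  by move=> x _; rewrite /= mixdisc_tau mulKf.
apply: smooth_onM; first exact: smooth_on_cst.
exact: (smooth_mixdisc (@Snu) nu1 nuJ Stau Stau (i := i)).
Qed.

Lemma smooth_aniso_trace f : smooth f -> smooth (aniso_trace T nu f).
Proof.
move=> Sf i; apply: (smooth_on_eq (f := (fun p => mix f tau p * (\det (M p))^-1) \o par i)).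
  by move=> x _; rewrite /= aniso_traceE.
apply: smooth_onM.
  exact: (smooth_mixdisc (@Snu) nu1 nuJ Sf Stau (i := i)).
apply: smooth_onV; last exact: smooth_det_wulff_matrix.
by move=> x _; exact: lt0r_neq0 (det_wulff_matrix_gt0 _).
Qed.

Lemma laguerre_operatorE f p : laguerre_operator T nu f p =
  mix (aniso_trace T nu f) tau p - 2 * mix f (fun=> 1) p.
Proof.
have D := lt0r_neq0 (det_wulff_matrix_gt0 p).
have K := det_wulff_matrix T_norm T_smooth T_curv (@Snu) nu1 nuJ p.
have K0 : wulff_curvature T (wulff_point T (nu p)) != 0.
  by apply/eqP => e; move/eqP: K; rewrite e mul0r eq_sym oner_eq0.
rewrite /laguerre_operator.
have -> : (wulff_curvature T (wulff_point T (nu p)))^-1 = \det (M p).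
  by apply: (mulfI K0); rewrite divff.
rewrite aniso_traceE mulrC divfK//; congr (_ - 2 * _).
rewrite /mixdisc hessI_cst1 !mxE/= !mulr1 !mulr0 !subr0 /laplacian /mxtrace sum2E.
by rewrite /hessI !mxE/= !mulr1n; ring.
Qed.

Lemma smooth_laguerre_operator f : smooth f -> smooth (laguerre_operator T nu f).
Proof.
move=> Sf i; have S1 : smooth (fun _ : S => (1 : R)) by exact: smooth_cst.
apply: (smooth_on_eq (f := (fun p => mix (aniso_trace T nu f) tau p -
    2 * mix f (fun=> 1) p) \o par i)).
  by move=> x _; rewrite /= laguerre_operatorE.
apply: smooth_onB.
  exact: (smooth_mixdisc (@Snu) nu1 nuJ (smooth_aniso_trace Sf) Stau (i := i)).
apply: smooth_onM; first exact: smooth_on_cst.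
exact: (smooth_mixdisc (@Snu) nu1 nuJ Sf S1 (i := i)).
Qed.

(* [dot (d nu) (d xi)] is the second fundamental form of the Wulff shape. *)
Lemma wulff_form p : [/\ 0 < dot (td0 nu p) (td0 xi p),
  dot (td0 nu p) (td1 xi p) = dot (td1 nu p) (td0 xi p) &
  0 < dot (td0 nu p) (td0 xi p) * dot (td1 nu p) (td1 xi p) -
      dot (td0 nu p) (td1 xi p) * dot (td0 nu p) (td1 xi p)].
Proof.
have xiE : gmap nu tau = xi.
  by apply/funext => p'; exact: (gmap_dual_norm T_norm T_smooth T_curv (@Snu) nu1 nuJ).
have sym : dot (td0 nu p) (td1 xi p) = dot (td1 nu p) (td0 xi p).
  by rewrite -xiE; exact: (gmap_sym (@Snu) nu1 nuJ p Stau).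
have H := hessI_dot (@Snu) nu1 nuJ p Stau.
have /(congr1 determinant) := H; rewrite det_mulmx hessI_tau xiE => E.
have D : 0 < dot (td0 nu p) (td0 xi p) * dot (td1 nu p) (td1 xi p) -
      dot (td0 nu p) (td1 xi p) * dot (td0 nu p) (td1 xi p).
  rewrite [X in _ - _ * X]sym; move: E; rewrite [X in _ = X]det2E !mxE/= => <-.
  rewrite mulr_gt0 ?det_wulff_matrix_gt0// (det_round_metric (@Snu) nu1).
  by rewrite exprn_even_gt0//= nuJ.
split=> //.
have := dot_tdiff_wulff_field_ge0 T_norm T_smooth T_curv (@Snu) nu1 p (frame R 0).
rewrite !td0E dotC le_eqVlt => /orP[/eqP z|//].
move: D; rewrite -z mul0r sub0r oppr_gt0 -expr2 => D.
by rewrite ltNge sqr_ge0 in D.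
Qed.

Section Envelope.
Variables (g : S -> R) (Y : S -> 'rV[R]_3).
Hypothesis Sg : smooth g.
Hypothesis YE : forall p, Y p = gmap nu g p.
Hypothesis Ynu : gauss_map Y = nu.

Let SY : smooth Y.
Proof.
have -> : Y = gmap nu g by apply/funext.
exact: smooth_gmap.
Qed.

Lemma td_envelope p :
  td0 Y p = hessI nu g p 0 0 *: td0 nu p + hessI nu g p 1 0 *: td1 nu p /\
  td1 Y p = hessI nu g p 0 1 *: td0 nu p + hessI nu g p 1 1 *: td1 nu p.
Proof.
have -> : Y = gmap nu g by apply/funext.
exact: (td_gmap (@Snu) nu1 nuJ p Sg).
Qed.

(** [anisotropic_principal_curvatures] is a [get]: a pair has to be exhibited, and another one, for
    instance in the other order, may be returned. The conclusions are symmetric in the two values,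
    and [pencil_trace] proves them for every admissible pair. *)
Lemma principal_curvaturesE p : \det (hessI nu g p) != 0 ->
  let l := anisotropic_principal_curvatures T Y p in
  aniso_trace T nu g p = - l.1^-1 - l.2^-1 /\
  (l.1^-1 - l.2^-1) ^+ 2 =
    aniso_trace T nu g p ^+ 2 - 4 * (\det (hessI nu g p) / \det (M p)).
Proof.
move=> Q0 l; set Q := hessI nu g p in Q0 *.
have M0 := lt0r_neq0 (det_wulff_matrix_gt0 p).
have CH : cahn_hoffman T Y = xi.
  by apply/funext => p'; rewrite /cahn_hoffman Ynu.
have [Y0 Y1] := td_envelope p; rewrite -/Q in Y0 Y1.
have [X0 X1] := td_wulff_field T_norm T_smooth T_curv (@Snu) nu1 nuJ p.
have [n0 n1] := dot_nu_td (@Snu) nu1 p.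
have tY e : tdiff Y p e = e.1 *: td0 Y p + e.2 *: td1 Y p by exact: tdiff_frame SY.
have tX e : tdiff xi p e = e.1 *: td0 xi p + e.2 *: td1 xi p by exact: tdiff_frame Sxi.
have coord (a b c d : R) : a *: td0 nu p + b *: td1 nu p =
    c *: td0 nu p + d *: td1 nu p -> a = c /\ b = d.
  move=> E; have := congr1 (fun w => dot (nu p) (cross w (td1 nu p))) E.
  have := congr1 (fun w => dot (nu p) (cross (td0 nu p) w)) E.
  rewrite !(crossDl, crossDr, crossZl, crossZr, crossvv, scaler0, addr0, add0r).
  by rewrite !dotZr => /(mulIf (nuJ p)) -> /(mulIf (nuJ p)) ->.
have coordE (e : R * R) (t : R) : tdiff xi p e = t *: tdiff Y p e ->
    M p 0 0 * e.1 + M p 0 1 * e.2 = t * (Q 0 0 * e.1 + Q 0 1 * e.2) /\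
    M p 1 0 * e.1 + M p 1 1 * e.2 = t * (Q 1 0 * e.1 + Q 1 1 * e.2).
  rewrite tX tY Y0 Y1 X0 X1 !lin2_comb scalerDr !scalerA => /coord[E E'].
  by split; [rewrite mulrC [M p 0 1 * _]mulrC E|rewrite mulrC [M p 1 1 * _]mulrC E'];
    ring.
have [e1 [e2 [e12 E1 E2]]] : [set l : R * R | exists e1 e2 : R * R,
    [/\ det2 e1 e2 != 0,
        tdiff (cahn_hoffman T Y) p e1 = - l.1 *: tdiff Y p e1
      & tdiff (cahn_hoffman T Y) p e2 = - l.2 *: tdiff Y p e2]] l.
  (* The eigenvectors are those of the symmetric form of [d Y] relative to the definite form of
     [d xi]. Both differentials are tangent, so equality of scalar products with the [d nu] is
     equality of vectors. *)
  apply: getPex => /=.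
  have [h0 hs hd] := wulff_form p.
  have Ysym : dot (td0 nu p) (td1 Y p) = dot (td1 nu p) (td0 Y p).
    have -> : Y = gmap nu g by apply/funext.
    exact: (gmap_sym (@Snu) nu1 nuJ p Sg).
  have [m [e [f [ef [e0 e1] [f0 f1]]]]] := pencil_eigen (dot (td0 nu p) (td0 Y p))
    (dot (td0 nu p) (td1 Y p)) (dot (td1 nu p) (td1 Y p)) h0 hd.
  have nY a b : dot (nu p) (a *: td0 Y p + b *: td1 Y p) = 0.
    by rewrite Y0 Y1 lin2_comb dotDr !dotZr n0 n1 !mulr0 addr0.
  have nX a b : dot (nu p) (a *: td0 xi p + b *: td1 xi p) = 0.
    by rewrite X0 X1 lin2_comb dotDr !dotZr n0 n1 !mulr0 addr0.
  have key (k : R) (z : R * R) :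
      dot (td0 nu p) (td0 Y p) * z.1 + dot (td0 nu p) (td1 Y p) * z.2 =
      k * (dot (td0 nu p) (td0 xi p) * z.1 + dot (td0 nu p) (td1 xi p) * z.2) ->
      dot (td0 nu p) (td1 Y p) * z.1 + dot (td1 nu p) (td1 Y p) * z.2 =
      k * (dot (td0 nu p) (td1 xi p) * z.1 + dot (td1 nu p) (td1 xi p) * z.2) ->
      tdiff Y p z = k *: tdiff xi p z.
    move=> k0 k1; rewrite tX tY; apply: (cramer3_unique (nuJ p)).
    - by rewrite dotZl !(dotC _ (nu p)) nY nX mulr0.
    - rewrite dotZl !(dotC _ (td0 nu p)) !dotDr !dotZr.
      by rewrite ![_.1 * _]mulrC ![_.2 * _]mulrC.
    - rewrite dotZl !(dotC _ (td1 nu p)) !dotDr !dotZr -Ysym -hs.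
      by rewrite ![_.1 * _]mulrC ![_.2 * _]mulrC.
  (* If [k = 0] then [d Y z = 0], so [z = 0] as [hessI nu g p] is invertible, and [z] could not
     belong to a basis. The eigenvalue can therefore be inverted, and the principal curvature is
     [- k^-1]. *)
  have kn (k : R) (z z' : R * R) : det2 z z' != 0 \/ det2 z' z != 0 ->
      tdiff Y p z = k *: tdiff xi p z -> tdiff xi p z = k^-1 *: tdiff Y p z.
    move=> zz kE; rewrite kE scalerA; have [k0|k0] := eqVneq k 0; last first.
      by rewrite mulVf// scale1r.
    have [q0 q1] : z.1 * Q 0 0 + z.2 * Q 0 1 = 0 /\ z.1 * Q 1 0 + z.2 * Q 1 1 = 0.
      apply: coord; rewrite -lin2_comb -Y0 -Y1 -tY kE k0.
      by rewrite !scale0r addr0.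
    have z0 : z.1 = 0 /\ z.2 = 0.
      move: Q0; rewrite det2E => Q0; split; apply: (mulfI Q0); rewrite mulr0.
        transitivity (Q 1 1 * (z.1 * Q 0 0 + z.2 * Q 0 1) - Q 0 1 * (z.1 * Q 1 0 + z.2 * Q 1 1)).
          by ring.
        by rewrite q0 q1; ring.
      transitivity (Q 0 0 * (z.1 * Q 1 0 + z.2 * Q 1 1) - Q 1 0 * (z.1 * Q 0 0 + z.2 * Q 0 1)).
        by ring.
      by rewrite q0 q1; ring.
    by case: zz; rewrite /det2 z0.1 z0.2 !(mul0r, mulr0) subr0 eqxx.
  exists (- m.1^-1, - m.2^-1), e, f; rewrite CH /= !opprK; split=> //.
    by apply: kn (key _ _ e0 e1); left; exact: ef.
  by apply: kn (key _ _ f0 f1); right; exact: ef.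
rewrite CH in E1 E2.
have [a0 a1] := coordE _ _ E1; have [b0 b1] := coordE _ _ E2.
rewrite aniso_traceE /mixdisc hessI_tau -/Q.
have [-> ->] := pencil_trace Q0 M0 e12 a0 a1 b0 b1.
split=> //; ring.
Qed.

End Envelope.

End AnisotropicCurvatures.

(** * Variations of the support function *)

Section LocalCalculus.
Context {R : realType} (S : surface R).
Implicit Types (i : idx S) (p : S) (W : normedModType R).

Lemma smooth_continuous W (f : S -> W) : smooth f -> continuous f.
Proof.
move=> Sf p V nV; have [d E] := crd_atP p; set c := chart_at p in d E.
have [U [g [oU Ux Hg fg]]] := Sf c _ d.
have gp : g (crd_at p) = f p by rewrite -fg//= E.
have : \forall y \near crd_at p, U y /\ V (g y).
  near=> y; split; near: y; first exact: open_nbhs_nbhs.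
  by apply: (Cn_continuous (Hg 0%N) Ux); rewrite gp.
move=> /near_open[ O [oO Ox HO]].
have [P oP EP] := within_preimage_open (@crd_continuous _ S c) oO.
have Pp : (par c @` dom c `&` P) p by rewrite -EP; split=> //; exists (crd_at p).
have : nbhs p (par c @` dom c `&` P).
  by apply: open_nbhs_nbhs; split=> //; apply: openI => //; exact: par_open.
apply: filterS => p'; rewrite -EP => -[[y dy yp] /HO[Uy Vy]].
by rewrite -yp parK// in Uy Vy; rewrite /= -yp -[f _]/((f \o par c) y) fg.
Unshelve. all: by end_near. Qed.

Lemma tdiff_near0 W (f : S -> W) (U : set S) p e : smooth f -> open U -> U p ->
  (forall p', U p' -> f p' = 0) -> tdiff f p e = 0.
Proof.
move=> Sf oU Up f0; have [d E] := crd_atP p; set c := chart_at p in d E.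
have [V oV EV] := within_preimage_open (@par_continuous _ S c) oU.
have rB : relopen (dom c `&` par c @^-1` U).
  by rewrite EV; apply: relopenIopen => //; exact: dom_relopen.
have Bx : (dom c `&` par c @^-1` U) (crd_at p) by split => //=; rewrite E.
have := derive_in_sub rB e (dom_relopen c) _ (Sf c) Bx.
move=> H; rewrite /tdiff -/c -H; last by move=> y [].
rewrite (derive_in_eq (g := fun=> 0 : W))//; first exact: (derive_in_cst rB).
by move=> y [_ /f0].
Qed.

End LocalCalculus.

Section Variation.
Context {R : realType} (S : surface R) (nu : S -> 'rV[R]_3).
Implicit Types (i : idx S) (p : S).
Hypothesis Snu : smooth nu.
Hypothesis nu1 : forall p, dot (nu p) (nu p) = 1.
Hypothesis nuJ : forall p, dot (nu p) (cross (td0 nu p) (td1 nu p)) != 0.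

Lemma gmap_near0 (f : S -> R) (U : set S) p : smooth f -> open U -> U p ->
  (forall p', U p' -> f p' = 0) -> gmap nu f p = 0.
Proof.
move=> Sf oU Up f0; apply/esym/(gmap_unique (@Snu) nu1 nuJ).
- by rewrite dot0l f0.
- by rewrite dot0l -td0E (tdiff_near0 _ Sf oU Up f0).
- by rewrite dot0l -td1E (tdiff_near0 _ Sf oU Up f0).
Qed.

Lemma hessI_near0 (f : S -> R) (U : set S) p : smooth f -> open U -> U p ->
  (forall p', U p' -> f p' = 0) -> hessI nu f p = 0.
Proof.
move=> Sf oU Up f0.
have GU : round_metric nu p \in unitmx.
  by rewrite unitmxE unitfE (det_round_metric_neq0 (@Snu) nu1 nuJ).
apply: (can_inj (mulKmx GU)); rewrite mulmx0 (hessI_dot (@Snu) nu1 nuJ)//.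
have Sg := smooth_gmap (@Snu) nu1 nuJ Sf.
have g0 p' (Up' : U p') : gmap nu f p' = 0 by exact: gmap_near0 Sf oU Up' f0.
have E0 : td0 (gmap nu f) p = 0 by rewrite -td0E (tdiff_near0 _ Sg oU Up g0).
have E1 : td1 (gmap nu f) p = 0 by rewrite -td1E (tdiff_near0 _ Sg oU Up g0).
by apply/matrixP => i j; rewrite !mxE E0 E1 if_same dot0r.
Qed.

Lemma cross_td_gmap (f : S -> R) p : smooth f ->
  cross (td0 (gmap nu f) p) (td1 (gmap nu f) p) =
  (\det (hessI nu f p) * dot (nu p) (cross (td0 nu p) (td1 nu p))) *: nu p.
Proof.
move=> Sf; have [-> ->] := td_gmap (@Snu) nu1 nuJ p Sf.
have [n0 n1] := dot_nu_td (@Snu) nu1 p.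
rewrite cross_lin2 -scalerA; congr (_ *: _); first by rewrite det2E; ring.
apply: (cramer3_unique (nuJ p)).
- by rewrite dotZl nu1 mulr1 dotC.
- by rewrite dotZl n0 mulr0 dot_crossl.
- by rewrite dotZl n1 mulr0 dot_crossr.
Qed.

(** The sign condition decides between [nu] and [- nu] as the normalized cross product. *)
Lemma gauss_map_gmap (f : S -> R) : smooth f ->
  (forall p, 0 < \det (hessI nu f p) * dot (nu p) (cross (td0 nu p) (td1 nu p))) ->
  gauss_map (gmap nu f) = nu.
Proof.
move=> Sf f0; apply/funext => p.
rewrite gauss_mapE cross_td_gmap// normalizeZ//.
by rewrite /normalize /enorm nu1 sqrtr1 invr1 scale1r.
Qed.

Lemma det_hessI_lin (f g : S -> R) (c : R) p : smooth f -> smooth g ->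
  \det (hessI nu (fun p => f p + c * g p) p) =
  \det (hessI nu f p) + c * mixdisc nu f g p + c ^+ 2 * \det (hessI nu g p).
Proof.
move=> Sf Sg; rewrite (hessI_lin (@Snu) nu1 nuJ)// /mixdisc.
by move: (hessI nu f p) (hessI nu g p) => A B; rewrite !det2E !mxE; ring.
Qed.

Lemma mixdiscC (f g : S -> R) p : mixdisc nu f g p = mixdisc nu g f p.
Proof. by rewrite /mixdisc; ring. Qed.

Lemma mixdisc_linl (f g h : S -> R) (c : R) p : smooth f -> smooth g ->
  mixdisc nu (fun p => f p + c * g p) h p = mixdisc nu f h p + c * mixdisc nu g h p.
Proof.
move=> Sf Sg; rewrite /mixdisc (hessI_lin (@Snu) nu1 nuJ)//.
by move: (hessI nu f p) (hessI nu g p) (hessI nu h p) => A B C; rewrite !mxE; ring.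
Qed.

Lemma mixdisc_near0 (f h : S -> R) (U : set S) p : smooth f -> open U -> U p ->
  (forall p', U p' -> f p' = 0) -> mixdisc nu f h p = 0.
Proof.
move=> Sf oU Up f0; rewrite /mixdisc (hessI_near0 Sf oU Up f0).
by move: (hessI nu h p) => A; rewrite !mxE; ring.
Qed.

Lemma smooth_det_hessI (f : S -> R) : smooth f -> smooth (fun p => \det (hessI nu f p)).
Proof.
move=> Sf i; apply: (smooth_on_eq (f := (fun p => 2^-1 * mixdisc nu f f p) \o par i)).
  by move=> x _; rewrite /= det2E /mixdisc; field.
apply: smooth_onM; first exact: smooth_on_cst.
exact: (smooth_mixdisc (@Snu) nu1 nuJ Sf Sf (i := i)).
Qed.

Lemma compact_bound (f : S -> R) (K : set S) : continuous f -> compact K ->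
  exists2 C, 0 <= C & forall p, K p -> `|f p| <= C.
Proof.
move=> cf cK; have : compact (f @` K).
  by apply: continuous_compact => //; exact: continuous_subspaceT.
move=> /compact_bounded[C [_ HC]]; exists (`|C| + 1) => [|p Kp].
  by rewrite addr_ge0.
by apply: (HC (`|C| + 1)) => //; rewrite ltr_pwDr// ler_norm.
Qed.

(** Off the support of [g] the determinant is unchanged. On it, dividing by [\det (hessI nu f p)]
    leaves [1 + c * b + c ^+ 2 * d] with [b] and [d] bounded by compactness, so one bound on [c]
    serves at every point. *)
Lemma det_hessI_variation (f g : S -> R) : smooth f -> smooth g ->
  compact (closure [set p | g p != 0]) ->
  (forall p, 0 < \det (hessI nu f p) * dot (nu p) (cross (td0 nu p) (td1 nu p))) ->
  exists2 e, 0 < e & forall c, `|c| < e -> forall p,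
    0 < \det (hessI nu (fun p => f p + c * g p) p) *
      dot (nu p) (cross (td0 nu p) (td1 nu p)).
Proof.
move=> Sf Sg cK f0; set K := closure _ in cK.
have D0 p : \det (hessI nu f p) != 0.
  by have := lt0r_neq0 (f0 p); rewrite mulf_eq0 negb_or => /andP[].
have SV : smooth (fun p => (\det (hessI nu f p))^-1).
  by move=> i; apply: smooth_onV; [move=> x _; exact: D0|exact: smooth_det_hessI].
have S1 : smooth (fun p => mixdisc nu f g p * (\det (hessI nu f p))^-1).
  move=> i; apply: smooth_onM (SV i).
  exact: (smooth_mixdisc (@Snu) nu1 nuJ Sf Sg (i := i)).
have S2 : smooth (fun p => \det (hessI nu g p) * (\det (hessI nu f p))^-1).
  by move=> i; apply: smooth_onM (SV i); exact: (smooth_det_hessI Sg (i := i)).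
have [B B0 HB] := compact_bound (smooth_continuous S1) cK.
have [C C0 HC] := compact_bound (smooth_continuous S2) cK.
(* If |c| (1 + B + C) < 1 then |c| <= 1, and |c b| + |c^2 d| <= |c| (B + C) < 1. *)
exists (1 + B + C)^-1; first by rewrite invr_gt0 -addrA ltr_pwDl// addr_ge0.
move=> c ce p; rewrite det_hessI_lin//.
have [Kp|nKp] := pselect (K p); last first.
  have oU : open (~` K) by rewrite openC; exact: closed_closure.
  have g0 p' : (~` K) p' -> g p' = 0.
    by move=> nK; apply/eqP; apply: contra_notT nK => nz; exact: subset_closure.
  rewrite mixdiscC (mixdisc_near0 f Sg oU nKp g0) (hessI_near0 Sg oU nKp g0).
  by rewrite det0 !mulr0 !addr0.
have := HB p Kp; have := HC p Kp.
set b := mixdisc _ _ _ _ * _; set d := \det (hessI nu g p) * _ => hd hb.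
have -> : \det (hessI nu f p) + c * mixdisc nu f g p + c ^+ 2 * \det (hessI nu g p) =
    (1 + c * b + c ^+ 2 * d) * \det (hessI nu f p).
  by rewrite /b /d; field.
rewrite -mulrA mulr_gt0//.
have pos : 0 < 1 + B + C by rewrite -addrA ltr_pwDl// addr_ge0.
have c1 : `|c| * (1 + B + C) < 1 by rewrite -ltr_pdivlMr// div1r.
have cs : `|c| <= 1.
  apply: ltW; apply: le_lt_trans c1; rewrite -[leLHS]mulr1 ler_wpM2l//.
  by rewrite -addrA lerDl addr_ge0.
have h1 : `|c * b| <= `|c| * B by rewrite normrM ler_wpM2l.
have h2 : `|c ^+ 2 * d| <= `|c| * C.
  rewrite normrM normrX ler_pM// ?exprn_ge0//.
  by rewrite expr2 -[leRHS]mulr1 ler_wpM2l.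
move: h1 h2; rewrite !ler_norml => /andP[h1 _] /andP[h2 _].
have := normr_ge0 c; move: h1 h2 c1; rewrite !mulrDr mulr1.
move: (c * b) (c ^+ 2 * d) (`|c| * B) (`|c| * C) (`|c|) => x y z w v.
by lra.
Qed.

End Variation.

(** * Ellipticity *)

(* A differential operator is a list of triples [(c, j, k)], standing for the
   sum of the [c d_0^j d_1^k]. *)
Section DifferentialOperators.
Context {R : realType} (A : set (R * R)) (rA : relopen A).

Local Notation pd0 := (pd0 A).
Local Notation pd1 := (pd1 A).
Local Notation op := (seq ((R * R -> R) * nat * nat)).
Implicit Types (s : op) (u c : R * R -> R) (x z : R * R).

Definition partial j k u := iter j pd0 (iter k pd1 u).

Fixpoint order_le m s : Prop :=
  if s is (c, j, k) :: s' then
    [/\ smooth_on A c, (j + k <= m)%N & order_le m s'] else True.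

Fixpoint apply_op s u x : R :=
  if s is (c, j, k) :: s' then c x * partial j k u x + apply_op s' u x else 0.

Fixpoint symbol m s x z : R :=
  if s is (c, j, k) :: s' then
    (if (j + k == m)%N then c x * z.1 ^+ j * z.2 ^+ k else 0) + symbol m s' x z
  else 0.

Fixpoint coefficient s j k x : R :=
  if s is (c, j', k') :: s' then
    (if (j == j') && (k == k') then c x else 0) + coefficient s' j k x
  else 0.

Lemma smooth_on_iter0 j u : smooth_on A u -> smooth_on A (iter j pd0 u).
Proof. by move=> Su; elim: j => //= j IH; exact: smooth_on_pd0. Qed.

Lemma smooth_on_iter1 k u : smooth_on A u -> smooth_on A (iter k pd1 u).
Proof. by move=> Su; elim: k => //= k IH; exact: smooth_on_pd1. Qed.

Lemma smooth_on_partial j k u : smooth_on A u -> smooth_on A (partial j k u).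
Proof. by move=> Su; apply: smooth_on_iter0; exact: smooth_on_iter1. Qed.

Lemma pd1_partial j k u x : smooth_on A u -> A x ->
  pd1 (partial j k u) x = partial j k.+1 u x.
Proof.
rewrite /partial /= => Su; elim: j x => [//|j IH] x Ax /=.
rewrite (pd_comm rA (smooth_on_partial j k Su) Ax) -!pd0E.
by apply: derive_in_eq.
Qed.

Lemma smooth_on_apply_op m s u : smooth_on A u -> order_le m s ->
  smooth_on A (apply_op s u).
Proof.
move=> Su; elim: s => [_|[[c j] k] s IH [Sc _ /IH Ss]] /=; first exact: smooth_on_cst.
by apply: smooth_onD => //; apply: smooth_onM => //; exact: smooth_on_partial.
Qed.

Lemma smooth_on_coefficient m s j k : order_le m s -> smooth_on A (coefficient s j k).
Proof.
elim: s => [_|[[c j'] k'] s IH [Sc _ /IH Ss]] /=; first exact: smooth_on_cst.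
by apply: smooth_onD => //; case: (_ && _) => //; exact: smooth_on_cst.
Qed.

Lemma coefficient_apply_op m s u x : order_le m s ->
  \sum_(j < m.+1) \sum_(k < m.+1 | (j + k <= m)%N) coefficient s j k x * partial j k u x =
  apply_op s u x.
Proof.
elim: s => [_|[[c j] k] s IH [_ jk /IH {}IH]] /=.
  by rewrite big1// => j _; rewrite big1// => k _; rewrite mul0r.
rewrite -IH -[X in X + _](_ : \sum_(j' < m.+1) \sum_(k' < m.+1 | (j' + k' <= m)%N)
    (if ((j' : nat) == j) && ((k' : nat) == k) then c x else 0) * partial j' k' u x = _); last first.
  have jm : (j < m.+1)%N by rewrite ltnS (leq_trans _ jk)// leq_addr.
  have km : (k < m.+1)%N by rewrite ltnS (leq_trans _ jk)// leq_addl.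
  rewrite (bigD1 (Ordinal jm))//= [X in _ + X]big1 ?addr0; last first.
    move=> j' nj; rewrite big1// => k' _.
    by rewrite (_ : (j' == j :> nat) = false) ?mul0r//; apply/negbTE.
  rewrite (bigD1 (Ordinal km))//= !eqxx [X in _ + X]big1 ?addr0//.
  move=> k' /andP[_ nk].
  by rewrite (_ : (k' == k :> nat) = false) ?andbF ?mul0r//; apply/negbTE.
rewrite -big_split/=; apply: eq_bigr => j' _.
by rewrite -big_split/=; apply: eq_bigr => k' _; rewrite mulrDl.
Qed.

Lemma coefficient_symbol m s x z : order_le m s ->
  \sum_(j < m.+1) coefficient s j (m - j)%N x * z.1 ^+ j * z.2 ^+ (m - j) = symbol m s x z.
Proof.
elim: s => [_|[[c j] k] s IH [_ jk /IH {}IH]] /=.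
  by rewrite big1// => j _; rewrite !mul0r.
rewrite -IH -[X in X + _](_ : \sum_(j' < m.+1)
    (if ((j' : nat) == j) && ((m - j')%N == k) then c x else 0) * z.1 ^+ j' * z.2 ^+ (m - j') = _); last first.
  have jm : (j < m.+1)%N by rewrite ltnS (leq_trans _ jk)// leq_addr.
  rewrite (bigD1 (Ordinal jm))//= eqxx [X in _ + X]big1 ?addr0; last first.
    move=> j' nj.
    by rewrite (_ : (j' == j :> nat) = false) ?mul0r//; apply/negbTE.
  have -> : (m - j == k)%N = (j + k == m)%N.
    by rewrite -(eqn_add2l j) subnKC 1?eq_sym// -ltnS.
  by case: eqP => [<-|_]; rewrite ?addKn// !mul0r.
rewrite -big_split/=; apply: eq_bigr => j' _.
by rewrite -!mulrDl.
Qed.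

(** The symbol is taken in degree [m] and is zero when the actual order is smaller, so that
    operators of different orders can be added after raising the nominal order. *)
Definition diffop m (P : (R * R -> R) -> R * R -> R) (sg : R * R -> R * R -> R) :=
  exists s, [/\ order_le m s,
    forall u, smooth_on A u -> forall x, A x -> P u x = apply_op s u x &
    forall x, A x -> forall z, symbol m s x z = sg x z].

Lemma smooth_on_diffop m P sg u : diffop m P sg -> smooth_on A u -> smooth_on A (P u).
Proof.
move=> [s [os Ps _]] Su; apply: smooth_on_eq (smooth_on_apply_op Su os) => x Ax.
by rewrite Ps.
Qed.

Lemma diffop_ext m P P' sg sg' :
  (forall u, smooth_on A u -> forall x, A x -> P u x = P' u x) ->
  (forall x, A x -> forall z, sg x z = sg' x z) -> diffop m P sg -> diffop m P' sg'.
Proof.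
move=> PP ss [s [os Ps Es]]; exists s; split=> // [u Su x Ax|x Ax z].
  by rewrite -PP// Ps.
by rewrite Es// ss.
Qed.

Lemma diffop_id : diffop 0 id (fun _ _ => 1).
Proof.
exists [:: (fun=> 1, 0%N, 0%N)]; split=> /= [|u Su x Ax|x Ax z].
- by split=> //; exact: smooth_on_cst.
- by rewrite mul1r addr0.
- by rewrite !expr0 !mulr1 addr0.
Qed.

Lemma diffopD m P Q sg sh : diffop m P sg -> diffop m Q sh ->
  diffop m (fun u x => P u x + Q u x) (fun x z => sg x z + sh x z).
Proof.
move=> [s [os Ps Es]] [t [ot Qt Et]]; exists (s ++ t); split.
- elim: s os {Ps Es} => [//|[[c j] k] s IH] /= [? ? /IH ?]; by [].
- move=> u Su x Ax; rewrite Ps// Qt//.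
  by elim: s {os Ps Es} => [|[[c j] k] s IH] /=; rewrite ?add0r// -IH addrA.
- move=> x Ax z; rewrite -Es// -Et//.
  by elim: s {os Ps Es} => [|[[c j] k] s IH] /=; rewrite ?add0r// IH addrA.
Qed.

Lemma diffopM m P sg c : smooth_on A c -> diffop m P sg ->
  diffop m (fun u x => c x * P u x) (fun x z => c x * sg x z).
Proof.
move=> Sc [s [os Ps Es]].
exists [seq ((fun x => c x * t.1.1 x), t.1.2, t.2) | t <- s]; split.
- by elim: s os {Ps Es} => [//|[[d j] k] s IH] /= [? ? /IH ?]; split=> //; exact: smooth_onM.
- move=> u Su x Ax; rewrite Ps//.
  by elim: s {os Ps Es} => [|[[d j] k] s IH] /=; rewrite ?mulr0// -IH mulrDr mulrA.
- move=> x Ax z; rewrite -Es//.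
  elim: s {os Ps Es} => [|[[d j] k] s IH] /=; rewrite ?mulr0// IH mulrDr.
  by case: ifP => _; rewrite ?mulr0// !mulrA.
Qed.

Lemma diffop_order m P sg : diffop m P sg -> diffop m.+1 P (fun _ _ => 0).
Proof.
move=> [s [os Ps Es]]; exists s; split=> //.
  by elim: s os {Ps Es} => [//|[[d j] k] s IH] /= [? ? /IH ?]; split=> //; exact: leqW.
move=> x Ax z; elim: s os {Ps Es} => [//|[[d j] k] s IH] /= [_ jk /IH ->].
by rewrite ltn_eqF ?ltnS// addr0.
Qed.

(** Leibniz' rule splits each term in two; the one in which the coefficient is differentiated has
    too low a degree to enter the symbol. *)
Lemma diffop_pd0 m P sg : diffop m P sg ->
  diffop m.+1 (fun u => pd0 (P u)) (fun x z => z.1 * sg x z).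
Proof.
move=> [s [os Ps Es]].
exists (flatten [seq [:: (pd0 t.1.1, t.1.2, t.2); (t.1.1, t.1.2.+1, t.2)] | t <- s]).
split.
- elim: s os {Ps Es} => [//|[[d j] k] s IH] /= [? ? /IH ?]; split=> //.
  + exact: smooth_on_pd0.
  + exact: leqW.
- move=> u Su x Ax; rewrite -pd0E (derive_in_eq (g := apply_op s u))//; last exact: Ps.
  elim: s os {Ps Es} => [|[[d j] k] s IH] /=; first by rewrite derive_in_cst.
  move=> [Sd _ os]; have Su' := smooth_on_partial j k Su.
  rewrite -IH// (derive_inD rA _ (smooth_onM Sd Su') (smooth_on_apply_op Su os) Ax).
  by rewrite addrA; congr (_ + _); rewrite (derive_inM rA _ Sd Su' Ax) !pd0E addrC.
- move=> x Ax z; rewrite -Es//.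
  elim: s os {Ps Es} => [|[[d j] k] s IH] /=; first by rewrite mulr0.
  move=> [_ jk /IH ->]; rewrite ltn_eqF ?ltnS// add0r addSn eqSS mulrDr.
  by case: ifP => _; rewrite ?mulr0// exprS; congr (_ + _); ring.
Qed.

Lemma diffop_pd1 m P sg : diffop m P sg ->
  diffop m.+1 (fun u => pd1 (P u)) (fun x z => z.2 * sg x z).
Proof.
move=> [s [os Ps Es]].
exists (flatten [seq [:: (pd1 t.1.1, t.1.2, t.2); (t.1.1, t.1.2, t.2.+1)] | t <- s]).
split.
- elim: s os {Ps Es} => [//|[[d j] k] s IH] /= [? ? /IH ?]; split=> //.
  + exact: smooth_on_pd1.
  + exact: leqW.
  + by split=> //; rewrite addnS ltnS.
- move=> u Su x Ax; rewrite -pd1E (derive_in_eq (g := apply_op s u))//; last exact: Ps.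
  elim: s os {Ps Es} => [|[[d j] k] s IH] /=; first by rewrite derive_in_cst.
  move=> [Sd _ os]; have Su' := smooth_on_partial j k Su.
  rewrite -IH// (derive_inD rA _ (smooth_onM Sd Su') (smooth_on_apply_op Su os) Ax).
  rewrite addrA; congr (_ + _); rewrite (derive_inM rA _ Sd Su' Ax) !pd1E addrC.
  by rewrite pd1_partial.
- move=> x Ax z; rewrite -Es//.
  elim: s os {Ps Es} => [|[[d j] k] s IH] /=; first by rewrite mulr0.
  move=> [_ jk /IH ->]; rewrite ltn_eqF ?ltnS// add0r addnS eqSS mulrDr.
  by case: ifP => _; rewrite ?mulr0// exprS; congr (_ + _); ring.
Qed.

End DifferentialOperators.

Section Ellipticity.
Context {R : realType} (A : set (R * R)) (rA : relopen A).
Variable n : R * R -> 'rV[R]_3.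

Local Notation pd0 := (pd0 A).
Local Notation pd1 := (pd1 A).
Local Notation envelope := (envelope A n).
Local Notation jac := (jac A n).
Local Notation mixed := (mixed A n).

Hypothesis Sn : smooth_on A n.
Hypothesis n1 : forall x, A x -> dot (n x) (n x) = 1.
Hypothesis J0 : forall x, A x -> jac x != 0.

Lemma diffop_dot_envelope m P sg (w : R * R -> 'rV[R]_3) : smooth_on A w ->
  diffop A m P sg ->
  diffop A m.+1 (fun u x => dot (envelope (P u) x) (w x))
    (fun x z => (jac x)^-1 * (z.1 * dot (cross (pd1 n x) (n x)) (w x) +
       z.2 * dot (cross (n x) (pd0 n x)) (w x)) * sg x z).
Proof.
move=> Sw HP; have S0 := smooth_on_pd0 rA Sn; have S1 := smooth_on_pd1 rA Sn.
have SJ := smooth_onV J0 (smooth_on_jac rA Sn).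
have H0 := diffopM (smooth_on_dot (smooth_on_cross S0 S1) Sw) (diffop_order HP).
have H1 := diffopM (smooth_on_dot (smooth_on_cross S1 Sn) Sw) (diffop_pd0 rA HP).
have H2 := diffopM (smooth_on_dot (smooth_on_cross Sn S0) Sw) (diffop_pd1 rA HP).
apply: diffop_ext (diffopM SJ (diffopD (diffopD H0 H1) H2)) => [u Su x Ax|x Ax z].
  rewrite /envelope dotZl !dotDl !dotZl; congr (_ * _).
  by rewrite ![dot _ _ * _]mulrC.
by rewrite mulr0 add0r; ring.
Qed.

(** The adjugate quadratic form of the matrix of the [d_i n . d_j Y_g], divided by [jac]. The matrix
    is, up to sign, the second fundamental form of [envelope g]. *)
Definition mixed_symbol g x z := (jac x)^-1 *
  (z.1 ^+ 2 * dot (pd1 n x) (pd1 (envelope g) x)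
   - z.1 * z.2 * (dot (pd0 n x) (pd1 (envelope g) x) + dot (pd1 n x) (pd0 (envelope g) x))
   + z.2 ^+ 2 * dot (pd0 n x) (pd0 (envelope g) x)).

(** With [Y] the envelope of [P u] and [G_0], [G_1] the derivatives of that of [g], [mixed] is
    [d_0 Y . (G_1 x n) + d_1 Y . (n x G_0)]. Moving the derivatives outside reduces it to operators
    of the form [Y . w], and the correction terms do not reach the top degree. *)
Lemma diffop_mixed m P sg (g : R * R -> R) : smooth_on A g -> diffop A m P sg ->
  diffop A m.+2 (fun u => mixed (P u) g) (fun x z => mixed_symbol g x z * sg x z).
Proof.
move=> Sg HP; have Yg := smooth_on_envelope rA Sn J0 Sg.
have G0 := smooth_on_pd0 rA Yg; have G1 := smooth_on_pd1 rA Yg.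
have SN := smooth_on_cross G1 Sn; have SM := smooth_on_cross Sn G0.
have D0 := diffop_pd0 rA (diffop_dot_envelope SN HP).
have D1 := diffop_pd1 rA (diffop_dot_envelope SM HP).
have E0 := diffop_order (diffop_dot_envelope (smooth_on_pd0 rA SN) HP).
have E1 := diffop_order (diffop_dot_envelope (smooth_on_pd1 rA SM) HP).
have cS : smooth_on A (fun=> -1 : R) by exact: smooth_on_cst.
apply: diffop_ext (diffopD (diffopD D0 D1) (diffopM cS (diffopD E0 E1))) => [u Su x Ax|x Ax z].
  have SY := smooth_on_envelope rA Sn J0 (smooth_on_diffop rA HP Su).
  rewrite -[X in X + _ + _]pd0E -[X in _ + X + _]pd1E.
  rewrite (derive_in_dot rA _ SY SN Ax) (derive_in_dot rA _ SY SM Ax).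
  rewrite !pd0E !pd1E /mixed.
  move: (pd0 (fun x => cross _ _) x) (pd1 (fun x => cross _ _) x) => w0 w1.
  move: (envelope (P u) x) (pd0 (envelope (P u)) x) (pd1 (envelope (P u)) x).
  move: (n x) (pd0 (envelope g) x) (pd1 (envelope g) x) => a b c y y0 y1.
  vec3.
have [a0 a1] := dot_n_pd rA Sn n1 Ax.
have [b0 b1] := derive_envelope_tangent rA Sn J0 Sg Ax.
rewrite /mixed_symbol !dot_cross_cross (n1 Ax) !(dotC _ (n x)) a0 a1 b0 b1.
by ring.
Qed.

Lemma mixed_symbol_neq0 g x z : A x -> z != 0 ->
  0 < dot (pd0 n x) (pd0 (envelope g) x) ->
  dot (pd0 n x) (pd1 (envelope g) x) = dot (pd1 n x) (pd0 (envelope g) x) ->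
  0 < dot (pd0 n x) (pd0 (envelope g) x) * dot (pd1 n x) (pd1 (envelope g) x) -
    dot (pd0 n x) (pd1 (envelope g) x) * dot (pd0 n x) (pd1 (envelope g) x) ->
  mixed_symbol g x z != 0.
Proof.
move=> Ax z0 a0 ab ac; rewrite /mixed_symbol mulf_neq0 ?invr_eq0 ?J0//.
move: ab ac; move: (dot _ _) (dot _ _) (dot _ _) (dot _ _) a0 => c b' b a a0 <- ac.
(* Completing the square in [z.2] leaves two squares with positive coefficients. *)
have -> : z.1 ^+ 2 * c - z.1 * z.2 * (b + b) + z.2 ^+ 2 * a =
    ((a * c - b * b) * z.1 ^+ 2 + (a * z.2 - b * z.1) ^+ 2) / a.
  by field; exact: lt0r_neq0.
rewrite mulf_neq0 ?invr_eq0 ?lt0r_neq0//.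
have [e|e] := eqVneq z.1 0.
  rewrite e expr0n mulr0 add0r mulr0 subr0 exprn_even_gt0//= mulf_neq0 ?(lt0r_neq0 a0)//.
  by apply: contra z0 => /eqP e2; rewrite (surjective_pairing z) e e2.
by rewrite ltr_wpDr ?sqr_ge0// mulr_gt0// exprn_even_gt0.
Qed.

End Ellipticity.

Section LaguerreElliptic.
Context {R : realType} (T : 'rV[R]_3 -> R) (S : surface R) (nu : S -> 'rV[R]_3).
Implicit Types (i : idx S) (p : S).
Hypothesis T_norm : is_norm T.
Hypothesis T_smooth : smooth_on [set x | x != 0] T.
Hypothesis T_curv : forall x, wulff_shape T x -> 0 < wulff_curvature T x.
Hypothesis Snu : smooth nu.
Hypothesis nu1 : forall p, dot (nu p) (nu p) = 1.
Hypothesis nuJ : forall p, dot (nu p) (cross (td0 nu p) (td1 nu p)) != 0.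

Local Notation xi := (wulff_field T nu).
Local Notation tau := (dual_norm T \o nu).
Local Notation mix := (mixdisc nu).

Let Stau : smooth tau. Proof. exact: smooth_dual_norm. Qed.
Let Sxi : smooth xi. Proof. exact: smooth_wulff_field. Qed.

Lemma quadratic_form_change (a b : R * R) (h00 h01 h11 : R) : 0 < h00 ->
  0 < h00 * h11 - h01 * h01 -> 0 < det2 a b ->
  let h (u v : R * R) := u.1 * (v.1 * h00 + v.2 * h01) + u.2 * (v.1 * h01 + v.2 * h11) in
  [/\ 0 < h a a, h a b = h b a & 0 < h a a * h b b - h a b * h a b].
Proof.
move=> p0 d0 ab h.
have E : h a a * h b b - h a b * h a b = det2 a b ^+ 2 * (h00 * h11 - h01 * h01).
  by rewrite /h /det2; ring.
split; [|by rewrite /h; ring|]; last by rewrite E mulr_gt0// exprn_gt0.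
have -> : h a a = ((a.1 * h00 + a.2 * h01) ^+ 2 + a.2 ^+ 2 * (h00 * h11 - h01 * h01)) / h00.
  by rewrite /h; field; exact: lt0r_neq0.
rewrite divr_gt0//; have [e|e] := eqVneq a.2 0.
  rewrite e !mul0r addr0 expr0n mul0r addr0 exprn_even_gt0//= mulf_neq0 ?(lt0r_neq0 p0)//.
  by apply/eqP => e1; move: ab; rewrite /det2 e e1 !mul0r subr0 ltxx.
by rewrite ltr_wpDl ?sqr_ge0// mulr_gt0// exprn_even_gt0.
Qed.

Lemma wulff_form_chart i x : dom i x ->
  [/\ 0 < dot (pd0 (dom i) (nu \o par i) x) (pd0 (dom i) (xi \o par i) x),
   dot (pd0 (dom i) (nu \o par i) x) (pd1 (dom i) (xi \o par i) x) =
   dot (pd1 (dom i) (nu \o par i) x) (pd0 (dom i) (xi \o par i) x) &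
   0 < dot (pd0 (dom i) (nu \o par i) x) (pd0 (dom i) (xi \o par i) x) *
       dot (pd1 (dom i) (nu \o par i) x) (pd1 (dom i) (xi \o par i) x) -
       dot (pd0 (dom i) (nu \o par i) x) (pd1 (dom i) (xi \o par i) x) *
       dot (pd0 (dom i) (nu \o par i) x) (pd1 (dom i) (xi \o par i) x)].
Proof.
move=> dx; have [a [b [ab H]]] := chart_change dx.
have [N0 N1] := H _ _ (@Snu); have [X0 X1] := H _ _ Sxi.
rewrite N0 N1 X0 X1.
have [h0 hs hd] := wulff_form T_norm T_smooth T_curv (@Snu) nu1 nuJ (par i x).
have [] := quadratic_form_change h0 hd ab.
rewrite !dotDl !dotZl !dotDr !dotZr -hs.
by split.
Qed.

Lemma envelope_dual_norm i x : dom i x ->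
  envelope (dom i) (nu \o par i) (tau \o par i) x = (xi \o par i) x.
Proof.
move=> dx; rewrite -(gmap_chart (@Snu) nu1 nuJ Stau dx).
exact: (gmap_dual_norm T_norm T_smooth T_curv (@Snu) nu1 nuJ).
Qed.

Lemma laguerre_linear_elliptic : linear_elliptic_operator 4 (laguerre_operator T nu).
Proof.
move=> i; have rA := dom_relopen i.
pose n := nu \o par i; pose t := tau \o par i.
have Sn : smooth_on (dom i) n by exact: Snu.
have St : smooth_on (dom i) t by exact: Stau.
have n1 : forall x, dom i x -> dot (n x) (n x) = 1 by move=> x _; exact: nu1.
have J0 := @chart_jac_neq0 _ _ _ (@Snu) nuJ i.
have SJ := smooth_onV J0 (smooth_on_jac rA Sn).
have M0 x : dom i x -> mixed (dom i) n t t x != 0.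
  move=> dx; rewrite (mixed_chart (@Snu) nu1 nuJ)// mulf_neq0 ?J0//.
  rewrite mixdisc_tau mulf_neq0 ?pnatr_eq0//.
  exact: lt0r_neq0 (det_wulff_matrix_gt0 T_norm T_smooth T_curv (@Snu) nu1 nuJ _).
have SM := smooth_onV M0 (smooth_on_mixed rA Sn J0 St St).
have H1 := diffop_mixed rA Sn n1 J0 St (diffop_id (dom i)).
(* This operator is [eta]: [2 * \det M] is [mixdisc nu tau tau], and the Jacobians cancel in the
   quotient. *)
have H2 := diffopM (smooth_on_cst (2 : R)) (diffopM SM H1).
have H3 := diffopM SJ (diffop_mixed rA Sn n1 J0 St H2).
have S1 : smooth_on (dom i) (fun=> 1 : R) by exact: smooth_on_cst.
(* The second order part [- 2 * mixdisc nu q 1]; raised twice in order, it contributes nothing to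
   the symbol. *)
have H4 := diffopM (smooth_on_cst (- 2 : R)) (diffopM SJ
  (diffop_mixed rA Sn n1 J0 S1 (diffop_id (dom i)))).
have [s [os Ps Es]] := diffopD H3 (diffop_order (diffop_order H4)).
exists (coefficient s) => d0 d1.
have -> : d0 = pd0 (dom i) by apply/funext => u; exact: pd0_fun.
have -> : d1 = pd1 (dom i) by apply/funext => u; exact: pd1_fun.
split=> [j k|f Sf x dx|x dx z z0].
- exact: (smooth_on_coefficient _ _ os).
- rewrite (coefficient_apply_op _ _ os) -(Ps _ (Sf i) x dx).
  rewrite (laguerre_operatorE T_norm T_smooth T_curv (@Snu) nu1 nuJ).
  have Sf1 : smooth (fun _ : S => (1 : R)) by exact: smooth_cst.
  have SL := smooth_aniso_trace T_norm T_smooth T_curv (@Snu) nu1 nuJ Sf.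
  have E1 : mixed (dom i) n (f \o par i) (fun=> 1) x =
    mix f (fun=> 1) (par i x) * jac (dom i) n x.
    exact: (mixed_chart (@Snu) nu1 nuJ Sf Sf1 dx).
  have E2 : mixed (dom i) n (fun y => 2 * ((mixed (dom i) n t t y)^-1 *
      mixed (dom i) n (f \o par i) t y)) t x =
      mix (aniso_trace T nu f) tau (par i x) * jac (dom i) n x.
    rewrite -(mixed_chart (@Snu) nu1 nuJ SL Stau dx).
    have E y : dom i y -> 2 * ((mixed (dom i) n t t y)^-1 *
      mixed (dom i) n (f \o par i) t y) = (aniso_trace T nu f \o par i) y.
      move=> dy; rewrite (mixed_chart (@Snu) nu1 nuJ Sf Stau dy).
      rewrite (mixed_chart (@Snu) nu1 nuJ Stau Stau dy) mixdisc_tau.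
      rewrite /= (aniso_traceE T_norm T_smooth T_curv (@Snu) nu1 nuJ).
      have D := lt0r_neq0 (det_wulff_matrix_gt0 T_norm T_smooth T_curv (@Snu) nu1 nuJ (par i y)).
      by have := J0 y dy; rewrite -/n; move: (mix _ _ _) (\det _) (jac _ _ _) D => a b c b0 c0; field; rewrite b0 c0.
    (* The argument of the outer operator equals [eta] on [dom i]; derivatives within [dom i] see
       nothing else. *)
    have EY y : dom i y -> envelope (dom i) n (fun y => 2 * ((mixed (dom i) n t t y)^-1 *
      mixed (dom i) n (f \o par i) t y)) y =
      envelope (dom i) n (aniso_trace T nu f \o par i) y.
      move=> dy; have [g0 g1 g2] := dot_envelope J0 (fun y => 2 * ((mixed (dom i) n t t y)^-1 *
        mixed (dom i) n (f \o par i) t y)) dy.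
      apply: (envelope_unique J0 dy).
      - by rewrite g0 E.
      - by rewrite g1 -!pd0E; apply: derive_in_eq.
      - by rewrite g2 -!pd1E; apply: derive_in_eq.
    rewrite /mixed -!pd0E -!pd1E.
    by rewrite (derive_in_eq (frame R 0) EY dx) (derive_in_eq (frame R 1) EY dx).
  rewrite E1 E2; have := J0 x dx; rewrite -/n.
  by move: (mix _ _ _) (mix _ _ _) (jac _ _ _) => a b c c0; field.
- rewrite (coefficient_symbol _ _ os) Es//= addr0.
  have Y0 v : derive_in (dom i) (envelope (dom i) n t) x v =
      derive_in (dom i) (xi \o par i) x v.
    by apply: derive_in_eq => // y dy; exact: envelope_dual_norm.
  have s0 : mixed_symbol (dom i) n t x z != 0.
    have E0 : pd0 (dom i) (xi \o par i) x = pd0 (dom i) (envelope (dom i) n t) x.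
      by rewrite -!pd0E -(Y0 (frame R 0)).
    have E1 : pd1 (dom i) (xi \o par i) x = pd1 (dom i) (envelope (dom i) n t) x.
      by rewrite -!pd1E -(Y0 (frame R 1)).
    have [] := wulff_form_chart dx; rewrite E0 E1 => h0 hs hd.
    exact: mixed_symbol_neq0.
  have Jx := J0 x dx; have Mx := M0 x dx.
  apply: mulf_neq0; first by rewrite invr_eq0.
  apply: mulf_neq0 => //; apply: mulf_neq0; first by rewrite pnatr_eq0.
  apply: mulf_neq0; first by rewrite invr_eq0.
  by rewrite mulr1.
Qed.

End LaguerreElliptic.

(** * Bump functions *)

Section FlatFunctions.
Context {R : realType}.

(** The functions [t ^- k * exp (- 1 / t)], extended by zero, are stable under differentiation: the
    derivative of [flat k] combines [flat k.+2] and [flat k.+1]. Regularity is thus proved for all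
    [k] at once. *)
Definition flat (k : nat) (t : R) : R :=
  if 0 < t then t^-1 ^+ k * expR (- t^-1) else 0.

Lemma flat_pos k t : 0 < t -> 0 < flat k t.
Proof. by move=> t0; rewrite /flat t0 mulr_gt0 ?expR_gt0 ?exprn_gt0 ?invr_gt0. Qed.

Lemma flat_neg k t : t <= 0 -> flat k t = 0.
Proof. by rewrite /flat leNgt => /negbTE ->. Qed.

Lemma flat_ge0 k t : 0 <= flat k t.
Proof.
by have [t0|t0] := ltP 0 t; [apply/ltW/flat_pos|rewrite flat_neg].
Qed.

Lemma flat_bound k t : flat k t <= k`!%:R.
Proof.
have [t0|t0] := ltP 0 t; last by rewrite flat_neg.
rewrite /flat t0; have s0 : 0 < t^-1 by rewrite invr_gt0.
move: (t^-1) s0 => s s0; rewrite expRN ler_pdivrMr ?expR_gt0//.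
case: k => [|k]; first by rewrite expr0 mul1r -[leLHS]addr0 (le_trans _ (expR_ge1Dx s))// lerD2l ltW.
rewrite mulrC -ler_pdivrMr ?ltr0n ?fact_gt0//.
by apply: le_trans (expR_ge1Dxn k (ltW s0)); rewrite lerDr.
Qed.

(** With [flat_bound] at [k.+2], this bounds [flat k t] by a constant times [t ^+ 2], so the
    derivative at 0 exists and vanishes. *)
Lemma flat_shift k t : flat k t = t ^+ 2 * flat k.+2 t.
Proof.
rewrite /flat; case: ifP => t0; last by rewrite mulr0.
by rewrite !exprS; field; exact: lt0r_neq0.
Qed.

Lemma flat_derive k t : differentiable (flat k) t /\
  forall v, 'D_v (flat k) t = v * (flat k.+2 t - k%:R * flat k.+1 t).
Proof.
have [t0|t0|->] := ltgtP t 0.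
- have N : \forall y \near t, (fun=> 0 : R) y = flat k y.
    near=> y; rewrite flat_neg//; near: y; apply: filterS (lt_nbhsl t0) => y; exact: ltW.
  split; first exact: near_eq_differentiable N (differentiable_cst _ _).
  move=> v; rewrite -(near_eq_derive _ N) derive_cst.
  by rewrite !flat_neg ?(ltW t0)// mulr0 subrr mulr0.
- pose g (y : R) := y^-1 ^+ k * expR (- y^-1).
  have N : \forall y \near t, g y = flat k y.
    by near=> y; rewrite /flat ifT//; near: y; exact: lt_nbhsr.
  have tn : t != 0 by exact: lt0r_neq0.
  have D : is_derive t 1 g (flat k.+2 t - k%:R * flat k.+1 t).
    have iV := is_deriveV tn (is_derive_id t 1).
    have iE : is_derive t 1 (expR \o (- (fun y : R => y^-1))) (expR (- t^-1) * - (- t ^- 2)%:A).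
      exact: is_derive1_comp (is_derive_expR _) (is_deriveN iV).
    have D0 := is_deriveM (is_deriveX k iV) iE.
    have gE : g = ((fun y : R => y^-1) ^+ k) * (expR \o (- (fun y : R => y^-1))).
      by apply/funext => y; rewrite /g exprfctE.
    rewrite gE; apply: is_derive_eq D0 _.
    rewrite /GRing.scale/= /flat t0 !mulr1 opprK fctE /= -[((- _) t)]/(- t^-1).
    move: (expR (- t^-1)) => E; rewrite -exprVn.
    case: (k) => [|k']; first by rewrite !exprS !expr0; field.
    by rewrite -pred_Sn !exprS expr0; move: (t^-1) => s; ring.
  have D' := near_eq_is_derive N D.
  have d : differentiable (flat k) t by apply/derivable1_diffP.
  split=> // v; have E : 'D_1 (flat k) t = flat k.+2 t - k%:R * flat k.+1 t by exact: derive_val.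
  have := derive_linear d v 1 0.
  rewrite addr0 -[v *: 1]/(v * 1) mulr1 E => ->.
  by rewrite [X in _ + X]deriveE// linear0 addr0.
- have H : forall e : R, 0 < e -> \forall h \near (0 : R),
      `|flat k (h + 0) - (flat k 0 + (\0 : {linear R -> R}) h)| <= e * `|h|.
    move=> e e0; near=> h; rewrite addr0 [flat k 0]flat_neg// add0r subr0.
    rewrite flat_shift normrM normrX expr2 (ger0_norm (flat_ge0 _ _)) mulrAC.
    rewrite ler_wpM2r//; apply: le_trans (_ : `|h| * (k.+2)`!%:R <= _).
      by rewrite ler_wpM2l// flat_bound.
    rewrite -ler_pdivlMr ?ltr0n ?fact_gt0//.
    near: h; apply/nbhs_ballP; exists (e / (k.+2)`!%:R) => /=.
      by rewrite divr_gt0 ?ltr0n ?fact_gt0.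
    by move=> y; rewrite /ball/= sub0r normrN => /ltW.
  have c0 : continuous (\0 : {linear R -> R}) by move=> x; exact: cvg_cst.
  have [d E] := eps_differentiable c0 H.
  split=> // v; rewrite deriveE// E/=.
  by rewrite !flat_neg// mulr0 subrr mulr0.
Unshelve. all: by end_near. Qed.

Lemma Cn_flat n k : Cn n setT (flat k).
Proof.
elim: n k => [|n IH] k.
  by move=> x _; apply: differentiable_continuous; have [] := flat_derive k x.
apply: (@CnS_of R R setT openT R n (flat k)
  (fun v t => v * (flat k.+2 t - k%:R * flat k.+1 t))).
- by move=> x _; have [] := flat_derive k x.
- by move=> x v _; have [_] := flat_derive k x; exact.
- move=> v; have cC (c : R) : Cn n (setT : set R) (fun=> c) by exact: Cn_cst.
  exact: (CnM openT (cC v) (CnB openT (IH _) (CnM openT (cC _) (IH _)))).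
Qed.

End FlatFunctions.

Section Bumps.
Context {R : realType}.

Definition square (x : R * R) (e : R) : set (R * R) :=
  `[x.1 - e, x.1 + e]%classic `*` `[x.2 - e, x.2 + e]%classic.

Definition bump (x : R * R) (e : R) (y : R * R) : R :=
  flat 0 (y.1 - (x.1 - e)) * flat 0 (x.1 + e - y.1) *
  (flat 0 (y.2 - (x.2 - e)) * flat 0 (x.2 + e - y.2)).

Lemma squareP x e y : square x e y <-> `|y.1 - x.1| <= e /\ `|y.2 - x.2| <= e.
Proof. by rewrite /square /= !in_itv/= !ler_distl. Qed.

Lemma square_sub x e e' : e <= e' -> square x e `<=` square x e'.
Proof. by move=> ee y /squareP[h1 h2]; apply/squareP; split; exact: le_trans ee. Qed.

Lemma compact_square x e : compact (square x e).
Proof. by apply: compact_setX; exact: segment_compact. Qed.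

Lemma square_near x e : 0 < e -> \forall y \near x, square x e y.
Proof.
move=> e0; apply/nbhs_ballP; exists e => //= y [y1 y2]; apply/squareP.
by rewrite (distrC y.1) (distrC y.2); split; apply: ltW; [exact: y1|exact: y2].
Qed.

Lemma bump_ge0 x e y : 0 <= bump x e y.
Proof. by rewrite !mulr_ge0// flat_ge0. Qed.

Lemma bump_gt0 x e y : `|y.1 - x.1| < e -> `|y.2 - x.2| < e -> 0 < bump x e y.
Proof.
rewrite !ltr_distl => /andP[? ?] /andP[? ?].
by rewrite /bump !mulr_gt0// flat_pos// subr_gt0.
Qed.

Lemma bump_eq0 x e y : ~ square x e y -> bump x e y = 0.
Proof.
move=> nxy; apply/eqP; apply: contra_notT nxy.
have P (s t : R) : flat 0 s * flat 0 t != 0 -> 0 < s /\ 0 < t.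
  by rewrite mulf_eq0 negb_or => /andP[s0 t0]; split; rewrite ltNge;
    [apply: contra s0|apply: contra t0] => /flat_neg ->.
rewrite mulf_eq0 negb_or => /andP[/P[h1 h2] /P[h3 h4]].
rewrite subr_gt0 in h1; rewrite subr_gt0 in h2; rewrite subr_gt0 in h3; rewrite subr_gt0 in h4.
by rewrite /square/= !in_itv/= (ltW h1) (ltW h2) (ltW h3) (ltW h4).
Qed.

Lemma smooth_on_bump (A : set (R * R)) x e : smooth_on A (bump x e).
Proof.
have S1 : smooth_on A (fun y : R * R => y.1) by apply: smooth_on_fst => y _; exists setT, id; split=> //; [exact: openT|move=> n; exact: Cn_id].
have S2 : smooth_on A (fun y : R * R => y.2) by apply: smooth_on_snd => y _; exists setT, id; split=> //; [exact: openT|move=> n; exact: Cn_id].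
have F (f : R * R -> R) : smooth_on A f -> smooth_on A (fun y => flat 0 (f y)).
  apply: (smooth_on_lift (P := setT) (F := flat 0)) => //; first exact: openT.
  by move=> O g oO _ Hg n; apply: (Cn_comp_real oO (P := setT)) => //; exact: Cn_flat.
have C (c : R) : smooth_on A (fun _ : R * R => c) by exact: smooth_on_cst.
by apply: smooth_onM; apply: smooth_onM; apply: F; exact: smooth_onB.
Qed.

End Bumps.

Section SurfaceBumps.
Context {R : realType} (S : surface R).
Implicit Types (i : idx S) (p : S) (x : R * R).

(** The doubled square leaves a margin: functions carried by [square x e] vanish near its edge, as
    needed to integrate by parts. *)
Lemma chart_square p (U : set S) : @manifold_interior R S p -> open U -> U p ->
  exists i x e, [/\ 0 < e, par i x = p, square x (2 * e) `<=` dom i &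
    forall y, square x (2 * e) y -> U (par i y)].
Proof.
move=> [i [x [dx x2 xp]]] oU Up; have [V oV EV] := dom_open i.
have [ O oO EO] := within_preimage_open (@par_continuous _ S i) oU.
have [_ Ox] : (dom i `&` O) x by rewrite -EO; split=> //=; rewrite xp.
have Vx : V x by move: dx; rewrite EV => -[].
have : \forall y \near x, (V y /\ O y) /\ 0 < y.2.
  near=> y; split; [split|]; near: y.
  - exact: open_nbhs_nbhs.
  - exact: open_nbhs_nbhs.
  - have c2 : (snd : R * R -> R) @ x --> x.2 by exact: cvg_snd.
    exact: (cvgr_gt _ c2 _ x2).
move=> /nbhs_ballP[r /= r0 H].
have sq y : square x (2 * (r / 4)) y -> (V y /\ O y) /\ 0 < y.2.
  move=> /squareP[h1 h2]; apply: H.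
  have rr : 2 * (r / 4) < r by lra.
  by split; rewrite /ball/= distrC; [exact: le_lt_trans h1 rr|exact: le_lt_trans h2 rr].
have sd : square x (2 * (r / 4)) `<=` dom i.
  by move=> y /sq[[Vy _] y2]; rewrite EV; split=> //; exact: ltW.
exists i, x, (r / 4); split=> //; first by rewrite divr_gt0.
move=> y Hy; have [[_ Oy] _] := sq y Hy.
have : (dom i `&` O) y by split=> //; exact: sd.
by rewrite -EO => -[].
Unshelve. all: by end_near. Qed.

Lemma compact_par i (A : set (R * R)) : compact A -> A `<=` dom i ->
  compact (par i @` A).
Proof.
move=> cA Ad; apply: continuous_compact => //.
exact: continuous_subspaceW Ad (@par_continuous _ S i).
Qed.

Lemma closed_par i (A : set (R * R)) : compact A -> A `<=` dom i ->
  closed (par i @` A).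
Proof.
by move=> cA Ad; apply: compact_closed; [exact: surface_hausdorff|exact: compact_par].
Qed.

Lemma par_inj i x y : dom i x -> dom i y -> par i x = par i y -> x = y.
Proof. by move=> dx dy E; rewrite -(parK dx) E parK. Qed.

(** Outside the image of the chart [crd i] is unconstrained, so the extension by zero is imposed. *)
Definition chart_bump i x e p : R :=
  if p \in par i @` square x e then bump x e (crd i p) else 0.

Lemma chart_bumpE i x e y : square x e `<=` dom i -> dom i y ->
  chart_bump i x e (par i y) = bump x e y.
Proof.
move=> sd dy; rewrite /chart_bump; case: ifPn => [_|]; first by rewrite parK.
rewrite notin_setE => ny; rewrite bump_eq0// => sy; apply: ny; by exists y.
Qed.

Lemma chart_bump_eq0 i x e p : ~ (par i @` square x e) p -> chart_bump i x e p = 0.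
Proof. by move=> np; rewrite /chart_bump ifN// notin_setE. Qed.

Lemma chart_bump_ge0 i x e p : 0 <= chart_bump i x e p.
Proof. by rewrite /chart_bump; case: ifP => // _; exact: bump_ge0. Qed.

Lemma smooth_local (W : normedModType R) (f : S -> W) :
  (forall p, exists U : set S, [/\ open U, U p &
    forall i, smooth_on (dom i `&` par i @^-1` U) (f \o par i)]) -> smooth f.
Proof.
move=> H i; apply: smooth_on_local => x dx; have [U [oU Up fU]] := H (par i x).
have [ O oO EO] := within_preimage_open (@par_continuous _ S i) oU.
have [_ Ox] : (dom i `&` O) x by rewrite -EO.
by exists O; split=> //; rewrite -EO.
Qed.

(** The image of the square is compact in a Hausdorff space, hence closed. A point outside the chart
    thus has a neighbourhood on which the bump is zero. *)
Lemma smooth_chart_bump i x e : square x e `<=` dom i -> smooth (chart_bump i x e).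
Proof.
move=> sd j; apply: smooth_on_local => y dy.
have cl := closed_par (compact_square (x := x) (e := e)) sd.
have [Ey|nEy] := pselect ((par i @` dom i) (par j y)).
  have [ O oO EO] := within_preimage_open (@par_continuous _ S j) (par_open i).
  have [_ Oy] : (dom j `&` O) y by rewrite -EO.
  exists O; split=> //; rewrite -EO.
  apply: (smooth_on_eq (f := fun z => bump x e ((crd i \o par j) z))).
    move=> z [dz [w dw wz]] /=; rewrite -wz parK// chart_bumpE//.
  apply: (@smooth_on_comp _ _ _ _ setT); last exact: smooth_on_bump.
    by [].
  exact: transition_smooth.
have [ O oO EO] := within_preimage_open (@par_continuous _ S j) (closed_openC cl).
have [_ Oy] : (dom j `&` O) y.
  by rewrite -EO; split=> //= -[w /sd dw wy]; apply: nEy; exists w.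
exists O; split=> //; rewrite -EO.
apply: (smooth_on_eq (f := fun=> 0)); last exact: smooth_on_cst.
by move=> z [dz nz] /=; rewrite chart_bump_eq0.
Qed.

(* [f] is divided by the sum of finitely many bumps covering its support. *)
Lemma localization (f : S -> R) (Z : set S) (V : S -> set S) :
  (forall p, open (V p)) -> (forall p, V p p) -> smooth f -> compact Z ->
  Z `<=` @manifold_interior R S -> closure [set p | f p != 0] `<=` Z ->
  exists (D : seq S) (g : S -> S -> R), (forall p, f p = \sum_(k <- D) g k p) /\
    forall k, k \in D -> [/\ smooth (g k), closure [set p | g k p != 0] `<=` Z &
      exists i x e, [/\ 0 < e, square x (2 * e) `<=` dom i,
        forall y, square x (2 * e) y -> V k (par i y) &
        forall p, g k p != 0 -> (par i @` square x e) p]].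
Proof.
move=> oV Vp Sf cZ Zi fZ.
have ex p : exists t : idx S * (R * R) * R, square t.1.2 t.2 `<=` dom t.1.1 /\
    (Z p -> [/\ 0 < t.2, par t.1.1 t.1.2 = p, square t.1.2 (2 * t.2) `<=` dom t.1.1 &
      forall y, square t.1.2 (2 * t.2) y -> V p (par t.1.1 y)]).
  have [Zp|nZp] := pselect (Z p); last first.
    (* Off [Z], a square of radius 0, reduced to a point of the chart, is a default that keeps
       [phi p] smooth. *)
    exists (chart_at p, crd_at p, 0); split=> //= y /squareP[].
    rewrite !normr_le0 !subr_eq0 => /eqP y1 /eqP y2.
    have [d _] := crd_atP p; suff -> : y = crd_at p by [].
    by rewrite (surjective_pairing y) y1 y2 -surjective_pairing.
  have [i [x [e [e0 xp sd sV]]]] := chart_square (Zi p Zp) (oV p) (Vp p).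
  exists (i, x, e); split=> //=; apply: subset_trans sd; apply: square_sub.
  by rewrite ler_peMl ?ltW// ltr1n.
have [t Ht] := choice ex.
pose phi p := chart_bump (t p).1.1 (t p).1.2 (t p).2.
have sq p : square (t p).1.2 (t p).2 `<=` dom (t p).1.1 by have [] := Ht p.
have Sphi p : smooth (phi p) by exact: smooth_chart_bump (sq p).
have phi0 p : Z p -> 0 < phi p p.
  move=> Zp; have [_ /(_ Zp)[e0 xp sd _]] := Ht p.
  have E : phi p (par (t p).1.1 (t p).1.2) = bump (t p).1.2 (t p).2 (t p).1.2.
    apply: chart_bumpE; first exact: sq.
    by apply: (sq p); apply/squareP; rewrite !subrr normr0 ltW.
  by rewrite -{2}xp E bump_gt0// subrr normr0.
have oP (g : S -> R) : smooth g -> open [set p | 0 < g p].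
  move=> Sg; apply: (@open_comp _ _ g [set y : R | 0 < y]); last exact: open_gt.
  by move=> p' _; exact: smooth_continuous.
have := cZ; rewrite compact_cover => /(_ S Z (fun p => [set p' | 0 < phi p p'])).
case=> [p _|p Zp|D DZ ZD]; first exact: oP.
  by exists p => //=; exact: phi0.
pose s := finmap.enum_fset D.
have sZ k : k \in s -> Z k by move=> ks; have := DZ k ks; rewrite inE.
pose Phi p := \sum_(k <- s) phi k p.
have Phi0 p : Z p -> 0 < Phi p.
  move=> /ZD[k /= kD kp]; rewrite /Phi (big_rem k)//= ltr_pwDl// sumr_ge0// => k' _.
  exact: chart_bump_ge0.
have SPhi : smooth Phi by move=> i; apply: smooth_on_sum => k; exact: Sphi.
pose r p := f p / Phi p.
have f0 p : f p != 0 -> Z p by move=> fp; apply: fZ; exact: subset_closure.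
(* Near the closed support of [f] the sum [Phi] is positive; elsewhere [f], hence the quotient, is
   locally zero. *)
have Sr : smooth r.
  apply: smooth_local => p; have [Zp|nZp] := pselect (closure [set p | f p != 0] p).
    exists [set p | 0 < Phi p]; split=> [| |i]; [exact: oP|exact/Phi0/fZ|].
    apply: smooth_onM; first by apply: smooth_on_sub (Sf i) => y [].
    apply: smooth_onV; first by move=> y [_ /= /lt0r_neq0].
    by apply: smooth_on_sub (SPhi i) => y [].
  exists (~` closure [set p | f p != 0]); split=> // [|i].
    by apply: closed_openC; exact: closed_closure.
  apply: (smooth_on_eq (f := fun=> 0)); last exact: smooth_on_cst.
  move=> y [_ ny] /=; rewrite /r; have [->|fy] := eqVneq (f (par i y)) 0.
    by rewrite mul0r.
  by exfalso; apply: ny; exact: subset_closure.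
exists s, (fun k p => phi k p * r p); split.
  move=> p; rewrite -big_distrl /= -/(Phi p) /r.
  have [->|fp] := eqVneq (f p) 0; first by rewrite mul0r mulr0.
  by rewrite mulrCA divff ?mulr1//; exact: lt0r_neq0 (Phi0 p (f0 p fp)).
move=> k ks; have Zk := sZ k ks; split.
- by move=> j; exact: smooth_onM (Sphi k j) (Sr j).
- apply: subset_trans fZ; apply: closureS => p /=.
  by apply: contra => /eqP fp; rewrite /r fp mul0r mulr0.
- have [_ /(_ Zk)[e0 _ sd sV]] := Ht k; exists (t k).1.1, (t k).1.2, (t k).2; split=> // p.
  rewrite mulf_eq0 negb_or => /andP[ph _]; apply: contrapT => np.
  by move: ph; rewrite /phi chart_bump_eq0// eqxx.
Qed.

End SurfaceBumps.

(** * Integration *)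

Section DensityTransfer.
Local Open Scope ereal_scope.
Context d d' (T : measurableType d) (U : measurableType d') (R : realType).
Variables (m : {measure set T -> \bar R}) (l : {measure set U -> \bar R}).
Variables (phi : U -> T) (A : set U) (E : set T) (w : U -> R).
Hypotheses (mA : measurable A) (mE : measurable E) (mphi : measurable_fun A phi).
Hypotheses (mw : measurable_fun A w) (w0 : forall x, A x -> (0 <= w x)%R).
Hypothesis phiE : forall x, A x -> E (phi x).
Hypothesis mE_density : forall C, measurable C ->
  m (E `&` C) = \int[l]_(x in A `&` phi @^-1` C) (w x)%:E.

Let transfer_indic (C : set T) (r : R) : measurable C -> (0 <= r)%R ->
  \int[l]_(x in A) (r * \1_C (phi x) * w x)%:E = r%:E * m (E `&` C).
Proof.
move=> mC r0; have mI : measurable_fun A (fun x => (\1_C (phi x) * w x)%R).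
  apply: measurable_funM => //.
  apply: (measurableT_comp (f := \1_C : T -> R)) => //; exact: measurable_indic.
under eq_integral do rewrite -mulrA EFinM.
rewrite ge0_integralZl//; last 2 first.
- exact/measurable_EFinP.
- by move=> x Ax; rewrite lee_fin mulr_ge0// w0.
congr (_ * _); rewrite mE_density// integral_mkcondr; apply: eq_integral => x xA.
by rewrite /patch indicE -[phi x \in C]/(x \in phi @^-1` C); case: ifP => _; rewrite ?mul1r ?mul0r.
Qed.

Import HBNNSimple.

Let transfer_nnsfun (f : {nnsfun T >-> R}) :
  \int[m]_(x in E) (f x)%:E = \int[l]_(x in A) (f (phi x) * w x)%:E.
Proof.
transitivity (\sum_(r \in range f) r%:E * m (E `&` f @^-1` [set r])).
  under eq_integral do rewrite fimfunE -fsumEFin//.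
  rewrite ge0_integral_fsum//; last 2 first.
  - move=> r; apply/measurable_EFinP; apply: measurable_funTS.
    exact: measurable_funM.
  - by move=> r x _; rewrite nnfun_muleindic_ge0.
  apply: eq_fsbigr => r _; rewrite integralZl_indic_nnsfun// integral_indic//=.
  by rewrite setIC.
have mI r : measurable_fun A (fun x => (r * \1_(f @^-1` [set r]) (phi x) * w x)%R).
  apply: measurable_funM => //; apply: measurable_funM => //.
  by apply: (measurableT_comp (f := \1_(f @^-1` [set r]) : T -> R)).
transitivity (\sum_(r \in range f)
    \int[l]_(x in A) (r * \1_(f @^-1` [set r]) (phi x) * w x)%:E).
  apply: eq_fsbigr => r rf; rewrite transfer_indic//.
  by move: rf; rewrite inE => -[t _ <-].
rewrite -ge0_integral_fsum//; last 2 first.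
- by move=> r; exact/measurable_EFinP.
- by move=> r x Ax; rewrite EFinM mule_ge0 ?lee_fin ?w0// -lee_fin nnfun_muleindic_ge0.
apply: eq_integral => x xA; rewrite fsumEFin// [in RHS]fimfunE; congr EFin.
by rewrite -mulr_fsuml.
Qed.

(** The usual passage from indicators to simple functions and then, by monotone convergence, to
    nonnegative functions. The measure is known only through its values on sets, and this turns them
    into integrals over a chart. *)
Lemma ge0_integral_density (h : T -> R) : measurable_fun E h ->
  (forall t, E t -> (0 <= h t)%R) ->
  \int[m]_(t in E) (h t)%:E = \int[l]_(x in A) (h (phi x) * w x)%:E.
Proof.
move=> mh h0; have mh' : measurable_fun E (EFin \o h) by exact/measurable_EFinP.
pose f := nnsfun_approx mE mh'.
have cf t : E t -> (f n t)%:E @[n --> \oo] --> (h t)%:E.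
  by move=> Et; apply: (cvg_nnsfun_approx mE mh') => // t' Et'; rewrite lee_fin h0.
transitivity (limn (fun n => \int[m]_(x in E) (f n x)%:E)).
  rewrite -monotone_convergence//.
  - by apply: eq_integral => t /[!inE] Et; apply/esym/cvg_lim => //; exact: cf.
  - by move=> n; apply/measurable_EFinP; apply: measurable_funTS.
  - by move=> n t _; rewrite lee_fin.
  - by move=> t _ n k nk; rewrite lee_fin; exact/lefP/nd_nnsfun_approx.
under eq_fun do rewrite transfer_nnsfun.
rewrite -monotone_convergence//.
- apply: eq_integral => x /[!inE] Ax; apply/cvg_lim => //.
  under eq_fun do rewrite EFinM.
  by rewrite EFinM; apply: cvgeZr => //; exact: cf (phiE Ax).
- move=> n; apply/measurable_EFinP; apply: measurable_funM => //.
  by apply: (measurableT_comp (f := f n)) => //; exact: measurable_funP.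
- by move=> n x Ax; rewrite lee_fin mulr_ge0// w0.
- move=> x Ax n k nk; rewrite lee_fin ler_wpM2r ?w0//.
  exact/lefP/nd_nnsfun_approx.
Qed.

(** [w] is nonnegative, so multiplication by it commutes with taking positive and negative parts. *)
Lemma integral_density (h : T -> R) : measurable_fun E h ->
  \int[m]_(t in E) (h t)%:E = \int[l]_(x in A) (h (phi x) * w x)%:E.
Proof.
move=> mh; have mh' : measurable_fun E (EFin \o h) by exact/measurable_EFinP.
have pos (g : T -> R) : measurable_fun E g ->
    \int[m]_(t in E) (Num.max (g t) 0)%:E =
    \int[l]_(x in A) (Num.max (g (phi x) * w x) 0)%:E.
  move=> mg; rewrite (@ge0_integral_density (fun t => Num.max (g t) 0%R)).
  - apply: eq_integral => x /[!inE] Ax; congr EFin.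
    by rewrite maxr_pMl ?w0// mul0r.
  - exact: measurable_maxr.
  - by move=> t _; rewrite le_max lexx orbT.
rewrite integralE [RHS]integralE; congr (_ - _).
- transitivity (\int[m]_(t in E) (Num.max (h t) 0)%:E).
    by apply: eq_integral => t _; rewrite funepos.unlock EFin_max.
  by rewrite pos//; apply: eq_integral => x _; rewrite funepos.unlock EFin_max.
- transitivity (\int[m]_(t in E) (Num.max (- h t) 0)%:E).
    by apply: eq_integral => t _; rewrite funeneg.unlock EFin_max.
  rewrite (pos (fun t => (- h t)%R))//; last exact: measurableT_comp.
  by apply: eq_integral => x _; rewrite funeneg.unlock EFin_max mulNr.
Qed.

End DensityTransfer.

(** * Borel sets and integrability in the plane *)

Section PlaneMeasure.
Context {R : realType}.

Local Notation plane := (measurableTypeR R * measurableTypeR R)%type.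
Local Notation lebesgue2 := (@lebesgue_measure R \x @lebesgue_measure R)%E.

(** Measurability refers to the product sigma-algebra; an open set is the union of the countably
    many rational boxes that it contains. *)
Lemma open_measurable_plane (U : set (R * R)) : open U -> measurable (U : set plane).
Proof.
move=> oU.
pose box (q : rat * rat * (rat * rat)) : set plane :=
  `]ratr q.1.1, ratr q.1.2[%classic `*` `]ratr q.2.1, ratr q.2.2[%classic.
have -> : U = \bigcup_q (if `[< box q `<=` U >] then box q else set0).
  apply/seteqP; split=> [x Ux|x [q _]]; last by case: asboolP => // qU /qU.
  have /nbhs_ballP[e /= e0 eU] : nbhs x U by exact: open_nbhs_nbhs.
  have gt (t : R) : t - e < t by rewrite ltrBlDr ltrDl.
  have lt (t : R) : t < t + e by rewrite ltrDl.
  have [a ha] := rat_in_itvoo (gt x.1); have [b hb] := rat_in_itvoo (lt x.1).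
  have [c hc] := rat_in_itvoo (gt x.2); have [d hd] := rat_in_itvoo (lt x.2).
  rewrite !in_itv/= in ha hb hc hd.
  exists (a, b, (c, d)) => //; case: asboolP => [_|[]].
    rewrite /box/= !in_itv/=; move: ha hb hc hd.
    by move=> /andP[_ ->] /andP[-> _] /andP[_ ->] /andP[-> _].
  move=> y; rewrite /box/= !in_itv/= => -[/andP[y1 y1'] /andP[y2 y2']].
  apply: eU; move: ha hb hc hd => /andP[ha _] /andP[_ hb] /andP[hc _] /andP[_ hd].
  by split; rewrite /ball/= ltr_distlC; apply/andP; split;
    [exact: lt_trans ha y1|exact: lt_trans y1' hb|exact: lt_trans hc y2|exact: lt_trans y2' hd].
apply: countable_bigcupT_measurable; first exact: countableP.
move=> q; case: ifP => _; last exact: measurable0.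
by apply: measurableX; exact: measurable_itv.
Qed.

Lemma within_measurable_plane (B : set (R * R)) (f : R * R -> R) :
  measurable (B : set plane) -> {within B, continuous f} ->
  measurable_fun (B : set plane) (f : plane -> measurableTypeR R).
Proof.
move=> mB cf; apply: (measurability _ (RGenOpens.measurableE R)).
move=> _ [_ [a [b ->] <-]].
have [U oU EU] := within_preimage_open cf (interval_open (a := BRight a) (b := BLeft b) isT isT).
rewrite [X in measurable X]EU; apply: measurableI => //.
exact: open_measurable_plane.
Qed.

Lemma measurable_square (x : R * R) e : measurable (square x e : set plane).
Proof. by apply: measurableX; exact: measurable_itv. Qed.

Lemma square_measure_lty (x : R * R) e : (lebesgue2 (square x e) < +oo)%E.
Proof.
rewrite product_measure1E; [|exact: measurable_itv|exact: measurable_itv].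
have H (a b : R) : (@lebesgue_measure R `[a, b]%classic < +oo)%E.
  by rewrite lebesgue_measure_itv/=; case: ifP => _; rewrite ?ltry// -EFinB ltry.
apply: lte_mul_pinfty; [exact: measure_ge0| |exact: H].
by rewrite ge0_fin_numE; [exact: H|exact: measure_ge0].
Qed.

Lemma smooth_on_continuous (V W : normedModType R) (A : set V) (f : V -> W) :
  smooth_on A f -> {within A, continuous f}.
Proof.
move=> Sf; apply/subspace_continuousP => x Ax.
have [U [g [oU Ux Hg fg]]] := Sf x Ax; have gx := Cn_continuous (Hg 0%N) Ux.
have fx : f x = g x by exact: fg.
move=> P nP; have gP : \forall y \near x, P (g y) by apply: gx; rewrite -fx.
change (\forall y \near x, A y -> P (f y)).
near=> y => Ay; rewrite fg//; near: y.
  exact: gP.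
exact: open_nbhs_nbhs.
Unshelve. all: by end_near. Qed.

Lemma within_square_integrable (x : R * R) e (f : R * R -> R) :
  {within square x e, continuous f} ->
  lebesgue2.-integrable (square x e : set plane) (EFin \o f).
Proof.
move=> cf; apply: measurable_bounded_integrable.
- exact: measurable_square.
- exact: square_measure_lty.
- exact: within_measurable_plane (measurable_square x e) cf.
- have : compact (f @` square x e).
    by apply: continuous_compact => //; exact: compact_square.
  move=> /compact_bounded[M [Mr HM]]; exists M; split=> // N MN y By.
  by apply: HM MN _ _; exists y.
Qed.

End PlaneMeasure.

(** * The divergence theorem on squares *)

Section Divergence.
Context {R : realType} (A : set (R * R)) (rA : relopen A).

Local Notation plane := (measurableTypeR R * measurableTypeR R)%type.
Local Notation lebesgue2 := (@lebesgue_measure R \x @lebesgue_measure R)%E.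

Lemma derive_line (W : normedModType R) (g : R * R -> W) (z v : R * R) (t : R) :
  derivable g (t *: v + z) v ->
  derivable (fun s : R => g (s *: v + z)) t 1 /\
  'D_1 (fun s : R => g (s *: v + z)) t = 'D_v g (t *: v + z).
Proof.
have E : (fun h : R => h^-1 *: (g ((h *: (1 : R) + t) *: v + z) - g (t *: v + z))) =
    (fun h : R => h^-1 *: (g (h *: v + (t *: v + z)) - g (t *: v + z))).
  apply/funext => h; congr (_ *: (g _ - _)).
  by rewrite scalerDl addrA -[h *: (1 : R)]/(h * 1) mulr1.
by rewrite /derivable /derive /= E.
Qed.

Lemma smooth_on_line (B : set R) (z v : R * R) : smooth_on B (fun t : R => t *: v + z).
Proof.
apply: smooth_onD; last exact: smooth_on_cst.
apply: smooth_on_scale; last exact: smooth_on_cst.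
by move=> t _; exists setT, id; split=> //; [exact: openT|move=> n; exact: Cn_id].
Qed.

(** The fundamental theorem of calculus along a segment. The margin [d] makes [P] vanish near both
    ends, which also settles the one-sided limits there. *)
Lemma integral_line (P : R * R -> R) (z v : R * R) (a b d : R) : a < b -> 0 < d ->
  (forall t, a <= t <= b -> A (t *: v + z)) -> smooth_on A P ->
  (forall t, a <= t <= b -> t < a + d \/ b - d < t -> P (t *: v + z) = 0) ->
  (\int[@lebesgue_measure R]_(t in `[a, b]) (derive_in A P (t *: v + z) v)%:E = 0)%E.
Proof.
move=> ab d0 lA SP P0; pose F t := P (t *: v + z).
have Fab : F a = 0 /\ F b = 0.
  by split; apply: P0; rewrite ?lexx ?(ltW ab)//; [left|right]; rewrite ?ltrDl ?gtrBl.
have lB t : `[a, b]%classic t -> A (t *: v + z).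
  by rewrite /= in_itv/=; exact: lA.
have Sf : smooth_on (`[a, b]%classic : set R) (fun t : R => derive_in A P (t *: v + z) v).
  apply: (@smooth_on_comp R R R `[a, b]%classic A (fun t : R => t *: v + z)
    (fun y => derive_in A P y v)); [exact: lB|exact: smooth_on_line|].
  exact: smooth_on_derive.
have D t : t \in `]a, b[ -> derivable F t 1 /\ 'D_1 F t = derive_in A P (t *: v + z) v.
  rewrite in_itv/= => /andP[at' tb].
  have At : A (t *: v + z) by apply: lA; rewrite !ltW.
  have [U [g [oU Ux Hg fg Dg]]] := smooth_on_extend rA SP At.
  have dg : derivable g (t *: v + z) v.
    by apply: diff_derivable; have [dg _] := CnSP (Hg 1%N); exact: dg.
  have [d1 e1] := derive_line dg.
  have nU : \forall s \near t, U (s *: v + z).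
    have cl : (fun s : R => s *: v + z) @ t --> t *: v + z.
      by apply: cvgD; [exact: cvgZr_tmp|exact: cvg_cst].
    by apply: cl; exact: open_nbhs_nbhs.
  have nab : \forall s \near t, a <= s <= b.
    near=> s; apply/andP; split; near: s; [exact: lt_le_nbhsr|exact: lt_le_nbhsl].
  have N : \forall s \near t, g (s *: v + z) = F s.
    by near=> s; apply/esym/fg; [near: s|apply: lA; near: s].
  split; first by have := near_eq_is_derive N (derivableP d1); case.
  by rewrite -(near_eq_derive _ N) e1 Dg.
have near0 (l : R) (G : set_system R) : Filter G -> F l = 0 ->
    (\forall t \near G, F t = 0) -> F t @[t --> G] --> F l.
  by move=> FG Fl nF; rewrite Fl; apply: cvg_near_cst.
rewrite (@continuous_FTC2 _ _ F a b ab).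
- by rewrite Fab.1 Fab.2 subee.
- exact: (smooth_on_continuous Sf).
- split; first by move=> t /D[].
  + apply: near0; first exact: Fab.1.
    near=> t; apply: P0; first (apply/andP; split; apply: ltW); last left.
    * by near: t; exact: nbhs_right_gt.
    * by near: t; exact: nbhs_right_lt.
    * by near: t; apply: nbhs_right_lt; rewrite ltrDl.
  + apply: near0; first exact: Fab.2.
    near=> t; apply: P0; first (apply/andP; split; apply: ltW); last right.
    * by near: t; exact: nbhs_left_gt.
    * by near: t; exact: nbhs_left_lt.
    * by near: t; apply: nbhs_left_gt; rewrite gtrBl.
- by move=> t /D[_ <-]; rewrite derive1E.
Unshelve. all: by end_near. Qed.

Section Square.
Variables (x : R * R) (e : R) (P : R * R -> R).
Hypothesis (e0 : 0 < e) (xA : square x (2 * e) `<=` A) (SP : smooth_on A P).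
Hypothesis P0 : forall y, square x (2 * e) y -> ~ square x e y -> P y = 0.

Let ab (t : R) : t - 2 * e < t + 2 * e.
Proof. by move: e0 => ?; lra. Qed.

Let itvE (s t : R) : s - 2 * e <= t <= s + 2 * e <-> `|t - s| <= 2 * e.
Proof. by rewrite ler_distl. Qed.

Let edge (s t : R) : t < s - 2 * e + e \/ s + 2 * e - e < t -> ~ (`|t - s| <= e).
Proof. by rewrite ler_distl => H /andP[h1 h2]; move: H e0 => [H|H] ?; lra. Qed.

Let integrable_pd v : lebesgue2.-integrable (setT : set plane)
  ((fun y => (derive_in A P y v)%:E) \_ (square x (2 * e))).
Proof.
rewrite -integrable_mkcond; last exact: measurable_square.
apply: within_square_integrable; apply: (continuous_subspaceW xA).
exact: (smooth_on_continuous (smooth_on_derive rA v SP)).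
Qed.

(** Fubini with the inner integral along the differentiated coordinate, where it vanishes; [P] is
    zero off the concentric square of half the size, so the margin is [e]. *)
Lemma integral_pd0 : (\int[lebesgue2]_(y in square x (2 * e)) (pd0 A P y)%:E = 0)%E.
Proof.
under eq_integral do rewrite -pd0E.
rewrite integral_mkcond -(integral21_prod_meas1 (integrable_pd (frame R 0))).
apply: integral0_eq => s _; rewrite /fubini_G.
have [hs|hs] := pselect (`|s - x.2| <= 2 * e); last first.
  apply: integral0_eq => t _; rewrite patchN//.
  by rewrite notin_setE => /squareP[].
have E t : t *: frame R 0 + s *: frame R 1 = (t, s) by rewrite (frame_decomp (t, s)).
have I : (\int[@lebesgue_measure R]_(t in `[(x.1 - 2 * e)%R, (x.1 + 2 * e)%R])
    (derive_in A P (t *: frame R 0 + s *: frame R 1)%R (frame R 0))%:E = 0)%E.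
  apply: (integral_line (d := e)) => // [t ht|t ht et]; rewrite E.
    by apply: xA; apply/squareP; split => //; exact/itvE.
  apply: P0; first by apply/squareP; split => //; exact/itvE.
  by move=> /squareP[h _]; exact: edge et h.
rewrite -[RHS]I [RHS]integral_mkcond; apply: eq_integral => t _; rewrite /patch.
have -> : ((t, s) \in square x (2 * e)) = (t \in `[x.1 - 2 * e, x.1 + 2 * e]%classic).
  apply/idP/idP; rewrite !inE/= in_itv/=.
    by move=> /squareP[/itvE].
  by move=> /itvE h; apply/squareP.
by case: ifP => // _; rewrite E.
Qed.

Lemma integral_pd1 : (\int[lebesgue2]_(y in square x (2 * e)) (pd1 A P y)%:E = 0)%E.
Proof.
under eq_integral do rewrite -pd1E.
rewrite integral_mkcond -(integral12_prod_meas1 (integrable_pd (frame R 1))).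
apply: integral0_eq => s _; rewrite /fubini_F.
have [hs|hs] := pselect (`|s - x.1| <= 2 * e); last first.
  apply: integral0_eq => t _; rewrite patchN//.
  by rewrite notin_setE => /squareP[].
have E t : t *: frame R 1 + s *: frame R 0 = (s, t).
  by rewrite addrC (frame_decomp (s, t)).
have I : (\int[@lebesgue_measure R]_(t in `[(x.2 - 2 * e)%R, (x.2 + 2 * e)%R])
    (derive_in A P (t *: frame R 1 + s *: frame R 0)%R (frame R 1))%:E = 0)%E.
  apply: (integral_line (d := e)) => // [t ht|t ht et]; rewrite E.
    by apply: xA; apply/squareP; split => //; exact/itvE.
  apply: P0; first by apply/squareP; split => //; exact/itvE.
  by move=> /squareP[_ h]; exact: edge et h.
rewrite -[RHS]I [RHS]integral_mkcond; apply: eq_integral => t _; rewrite /patch.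
have -> : ((s, t) \in square x (2 * e)) = (t \in `[x.2 - 2 * e, x.2 + 2 * e]%classic).
  apply/idP/idP; rewrite !inE/= in_itv/=.
    by move=> /squareP[_ /itvE].
  by move=> /itvE h; apply/squareP.
by case: ifP => // _; rewrite E.
Qed.

End Square.

End Divergence.

(** * Area measures on the surface *)

Section SurfaceMeasure.
Context {R : realType} (S : surface R).
Implicit Types (i : idx S) (p : S).

Local Notation plane := (measurableTypeR R * measurableTypeR R)%type.
Local Notation lebesgue2 := (@lebesgue_measure R \x @lebesgue_measure R)%E.
Local Notation borel := (g_sigma_algebraType (@open S)).

Lemma open_measurable_borel (U : set S) : open U -> measurable (U : set borel).
Proof. by move=> oU; exact: sub_sigma_algebra. Qed.

Lemma closed_measurable_borel (F : set S) : closed F -> measurable (F : set borel).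
Proof.
move=> cF; rewrite -(setCK F); apply: measurableC; apply: open_measurable_borel.
exact: closed_openC.
Qed.

Lemma compact_measurable_borel (K : set S) : compact K -> measurable (K : set borel).
Proof.
move=> cK; apply: closed_measurable_borel.
by apply: compact_closed => //; exact: surface_hausdorff.
Qed.

Lemma continuous_measurable_borel (B : set S) (h : S -> R) : continuous h ->
  measurable_fun (B : set borel) (h : borel -> measurableTypeR R).
Proof.
move=> ch; apply: (@measurable_funTS _ _ borel).
apply: (measurability _ (RGenOpens.measurableE R)).
move=> _ [_ [a [b ->] <-]]; rewrite setTI.
apply: open_measurable_borel; apply: open_comp; first by move=> p _; exact: ch.
exact: interval_open.
Qed.

Lemma par_measurable i (B : set (R * R)) : measurable (B : set plane) -> B `<=` dom i ->
  measurable_fun (B : set plane) (par i : plane -> borel).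
Proof.
move=> mB Bd; apply: (measurability _ (erefl (@measurable _ borel))).
move=> _ [U oU <-].
have [ O oO EO] := within_preimage_open (continuous_subspaceW Bd (@par_continuous _ S i)) oU.
by rewrite [X in measurable X]EO; apply: measurableI => //; exact: open_measurable_plane.
Qed.

Lemma within_compact_integrable (B : set (R * R)) (f : R * R -> R) :
  measurable (B : set plane) -> compact B -> (lebesgue2 B < +oo)%E ->
  {within B, continuous f} -> lebesgue2.-integrable (B : set plane) (EFin \o f).
Proof.
move=> mB cB B1 cf; apply: measurable_bounded_integrable => //.
  exact: within_measurable_plane.
have : compact (f @` B) by exact: continuous_compact.
move=> /compact_bounded[M [Mr HM]]; exists M; split=> // N MN y By.
by apply: HM MN _ _; exists y.
Qed.

Variables (Y : S -> 'rV[R]_3) (mu : {measure set borel -> \bar R}).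
Variable w : idx S -> R * R -> R.
Hypothesis mu_area : area_measure Y mu.
Hypothesis w0 : forall i x, dom i x -> 0 < w i x.
Hypothesis wc : forall i, {within dom i, continuous (w i)}.
Hypothesis wE : forall i x, dom i x ->
  Num.sqrt (\det (\matrix_(k < 2, l < 2)
    dot (derive_in (dom i) (Y \o par i) x (frame R k))
        (derive_in (dom i) (Y \o par i) x (frame R l)))) = w i x.

Lemma area_chart i (B : set (R * R)) : measurable (B : set plane) -> B `<=` dom i ->
  mu (par i @` B) = (\int[lebesgue2]_(x in B) (w i x)%:E)%E.
Proof.
move=> mB Bd; rewrite (mu_area mB Bd); apply: eq_integral => x; rewrite inE => /Bd dx.
by rewrite wE.
Qed.

(** Applied to the part of [B] sent into a given Borel set, the area formula says that [mu] has
    density [w i] in the chart. *)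
Lemma area_transfer i (B : set (R * R)) (h : S -> R) : compact B ->
  measurable (B : set plane) -> B `<=` dom i -> continuous h ->
  (\int[mu]_(p in par i @` B) (h p)%:E =
   \int[lebesgue2]_(x in B) (h (par i x) * w i x)%:E)%E.
Proof.
move=> cB mB Bd ch.
apply: (@integral_density _ _ borel plane R mu lebesgue2 (par i) B (par i @` B) (w i)).
- exact: mB.
- by apply: compact_measurable_borel; exact: compact_par.
- exact: par_measurable.
- by apply: within_measurable_plane => //; exact: continuous_subspaceW Bd (wc (i := i)).
- by move=> x /Bd dx; exact/ltW/w0.
- by move=> x Bx; exists x.
- move=> C mC; rewrite -area_chart.
  + congr (mu _); apply/seteqP; split=> [p [[x Bx <-] Cx]|p [x [Bx Cx] <-]].
      by exists x.
    by split => //; exists x.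
  + by have := par_measurable mB Bd; apply.
  + by move=> x [/Bd].
- exact: continuous_measurable_borel.
Qed.

(** Local finiteness of [mu]. Since [p] may be a boundary point, the coordinate square is cut by the
    closed half-plane, which keeps it compact and inside the chart. *)
Lemma compact_nbhs p : exists E U : set S, [/\ open U, U p, U `<=` E,
  measurable (E : set borel) & (mu E < +oo)%E].
Proof.
have [d E] := crd_atP p; set i := chart_at p in d E.
have [V oV EV] := dom_open i.
have : \forall y \near crd_at p, V y.
  by apply: open_nbhs_nbhs; split => //; move: d; rewrite EV => -[].
move=> /nbhs_ballP[r /= r0 HV].
pose B := square (crd_at p) (r / 2) `&` @halfplane R.
have sV : square (crd_at p) (r / 2) `<=` V.
  move=> y /squareP[h1 h2]; apply: HV; have rr : r / 2 < r by lra.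
  by split; rewrite /ball/= distrC; [exact: le_lt_trans h1 rr|exact: le_lt_trans h2 rr].
have Bd : B `<=` dom i by move=> y [/sV Vy y2]; rewrite EV.
have cH : closed (@halfplane R).
  have -> : @halfplane R = snd @^-1` [set t : R | 0 <= t] by [].
  by apply: preimage_closed; [move=> y _; exact: cvg_snd|exact: closed_ge].
have cB : compact B by apply: compact_closedI => //; exact: compact_square.
have mB : measurable (B : set plane).
  apply: measurableI; first exact: measurable_square.
  rewrite -(setCK (@halfplane R)); apply: measurableC; apply: open_measurable_plane.
  exact: closed_openC.
have B1 : (lebesgue2 B < +oo)%E.
  apply: le_lt_trans (square_measure_lty (crd_at p) (r / 2)).
  by apply: le_measure; rewrite ?inE//; [exact: measurable_square|move=> y []].
have : \forall y \near crd_at p, square (crd_at p) (r / 2) y.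
  by apply: square_near; rewrite divr_gt0.
move=> /near_open[ O [oO Op OB]].
have [P oP EP] := within_preimage_open (@crd_continuous _ S i) oO.
exists (par i @` B), (par i @` dom i `&` P); split.
- by apply: openI => //; exact: par_open.
- by rewrite -EP; split => //; exists (crd_at p).
- move=> p'; rewrite -EP => -[[y dy <-]] /=; rewrite parK// => Oy.
  by exists y => //; split; [exact: OB|move: dy; rewrite EV => -[]].
- by apply: compact_measurable_borel; exact: compact_par.
- rewrite area_chart//.
  have := within_compact_integrable mB cB B1 (continuous_subspaceW Bd (wc (i := i))).
  by move=> /(integrable_fin_num mB); rewrite fin_numElt => /andP[].
Qed.

Lemma compact_measure_lty (K : set S) : compact K -> (mu K < +oo)%E.
Proof.
move=> cK; have [E HE] := choice compact_nbhs; have [U HU] := choice HE.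
have := cK; rewrite compact_cover => /(_ S setT U).
case=> [p _|p Kp|D DZ KD]; first by have [] := HU p.
  by exists p => //; have [] := HU p.
pose s := finmap.enum_fset D.
have [F [mF F1 EF]] : exists F : set S, [/\ measurable (F : set borel), (mu F < +oo)%E &
    forall k, k \in s -> E k `<=` F].
  elim: (s : seq S) => [|k r [F [mF F1 EF]]].
    by exists set0; split; [exact: measurable0|rewrite measure0; exact: ltry|].
  have [_ _ _ mE E1] := HU k; exists (E k `|` F); split.
  - exact: measurableU.
  - by apply: le_lt_trans (measureU2 _ mE mF) _; rewrite lte_add_pinfty.
  - move=> k'; rewrite inE => /orP[/eqP -> p Ep|/EF k'F p /k'F Fp]; first by left.
    by right.
apply: le_lt_trans F1; apply: le_measure; rewrite ?inE//.
  exact: compact_measurable_borel.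
move=> p /KD[k kD Up]; have [_ _ UE _ _] := HU k.
exact: EF kD _ (UE _ Up).
Qed.

Lemma smooth_integrable (K : set S) (h : S -> R) : compact K -> continuous h ->
  mu.-integrable (K : set borel) (EFin \o h).
Proof.
move=> cK ch; apply: measurable_bounded_integrable.
- exact: compact_measurable_borel.
- exact: compact_measure_lty.
- exact: continuous_measurable_borel.
- have [C _ HC] := compact_bound ch cK; exists C; split; first exact: num_real.
  by move=> M CM p Kp; exact: le_trans (HC p Kp) (ltW CM).
Qed.

End SurfaceMeasure.

(** * The first variation *)

Section FirstVariation.
Context {R : realType} (T : 'rV[R]_3 -> R) (S : surface R) (nu : S -> 'rV[R]_3).
Implicit Types (i : idx S) (p : S).
Hypothesis T_norm : is_norm T.
Hypothesis T_smooth : smooth_on [set x | x != 0] T.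
Hypothesis T_curv : forall x, wulff_shape T x -> 0 < wulff_curvature T x.
Hypothesis Snu : smooth nu.
Hypothesis nu1 : forall p, dot (nu p) (nu p) = 1.
Hypothesis nuJ : forall p, dot (nu p) (cross (td0 nu p) (td1 nu p)) != 0.

Local Notation plane := (measurableTypeR R * measurableTypeR R)%type.
Local Notation lebesgue2 := (@lebesgue_measure R \x @lebesgue_measure R)%E.
Local Notation borel := (g_sigma_algebraType (@open S)).
Local Notation xi := (wulff_field T nu).
Local Notation tau := (dual_norm T \o nu).
Local Notation M := (wulff_matrix T nu).
Local Notation mix := (mixdisc nu).

Let Stau : smooth tau. Proof. exact: smooth_dual_norm. Qed.
Let Sxi : smooth xi. Proof. exact: smooth_wulff_field. Qed.
Let M0 p : 0 < \det (M p). Proof. exact: det_wulff_matrix_gt0. Qed.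
Let SM : smooth (fun p => \det (M p)). Proof. exact: smooth_det_wulff_matrix. Qed.
Let S1 : smooth (fun _ : S => (1 : R)). Proof. exact: smooth_cst. Qed.

(** Required to apply the assumption on [dA] to the Cahn-Hoffman field; [wulff_matrix] is the
    invertible matrix between [d xi] and [d nu]. *)
Lemma wulff_field_immersion : immersion xi.
Proof.
move=> p e; rewrite (tdiff_frame p e Sxi) => E.
have [X0 X1] := td_wulff_field T_norm T_smooth T_curv (@Snu) nu1 nuJ p.
have D : dot (nu p) (cross (td0 xi p) (td1 xi p)) != 0.
  rewrite X0 X1 cross_lin2 dotZr mulf_neq0 ?nuJ//.
  have := lt0r_neq0 (M0 p); rewrite det2E; apply: contra => /eqP h.
  by rewrite -h; apply/eqP; ring.
have E1 : e.1 = 0.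
  apply: (mulIf D); rewrite mul0r -[RHS](dot0r (nu p)) -(cross0l (td1 xi p)) -E.
  by rewrite crossDl !crossZl crossvv scaler0 addr0 dotZr.
have E2 : e.2 = 0.
  apply: (mulIf D); rewrite mul0r -[RHS](dot0r (nu p)) -(cross0r (td0 xi p)) -E.
  by rewrite crossDr !crossZr crossvv scaler0 add0r dotZr.
by rewrite (surjective_pairing e) E1 E2.
Qed.

(** The density of [dW], that is [1 / K_W] times the round area; [jac] may have either sign, hence
    the absolute value. *)
Definition wulff_density i x : R := \det (M (par i x)) * `|jac (dom i) (nu \o par i) x|.

Lemma wulff_density_gt0 i x : dom i x -> 0 < wulff_density i x.
Proof.
move=> dx; rewrite mulr_gt0 ?M0// normr_gt0.
exact: (chart_jac_neq0 (@Snu) nuJ dx).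
Qed.

Lemma wulff_density_continuous i : {within dom i, continuous (wulff_density i)}.
Proof.
have SJ := smooth_on_jac (dom_relopen i) (@Snu i).
have := smooth_on_continuous (smooth_onM (SM (i := i)) SJ).
move=> /subspace_continuousP H; apply/subspace_continuousP => x dx.
have E : wulff_density i = fun y => `|\det (M (par i y)) * jac (dom i) (nu \o par i) y|.
  by apply/funext => y; rewrite normrM gtr0_norm.
by rewrite E; apply: cvg_norm; exact: H.
Qed.

Lemma dot_cross_wulff_field i x : dom i x ->
  [/\ dot (nu (par i x)) (pd0 (dom i) (xi \o par i) x) = 0,
      dot (nu (par i x)) (pd1 (dom i) (xi \o par i) x) = 0 &
      dot (nu (par i x)) (cross (pd0 (dom i) (xi \o par i) x) (pd1 (dom i) (xi \o par i) x)) =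
      \det (M (par i x)) * jac (dom i) (nu \o par i) x].
Proof.
move=> dx; have rA := dom_relopen i; have J0 := @chart_jac_neq0 _ _ _ (@Snu) nuJ i.
have [] := derive_envelope_tangent rA (@Snu i) J0 (Stau (i := i)) dx.
have := mixed_chart (@Snu) nu1 nuJ Stau Stau dx; rewrite mixdisc_tau /mixed.
have E v : derive_in (dom i) (envelope (dom i) (nu \o par i) (tau \o par i)) x v =
    derive_in (dom i) (xi \o par i) x v.
  apply: derive_in_eq => // y dy.
  exact: (envelope_dual_norm T_norm T_smooth T_curv (@Snu) nu1 nuJ dy).
have -> : pd0 (dom i) (envelope (dom i) (nu \o par i) (tau \o par i)) x =
    pd0 (dom i) (xi \o par i) x by rewrite -!pd0E; exact: E (frame R 0).
have -> : pd1 (dom i) (envelope (dom i) (nu \o par i) (tau \o par i)) x =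
    pd1 (dom i) (xi \o par i) x by rewrite -!pd1E; exact: E (frame R 1).
rewrite dotDr => H h0 h1; split; [exact: h0|exact: h1|].
have two : (2 : R) != 0 by rewrite pnatr_eq0.
by apply: (mulfI two); rewrite mulrA -H /=; ring.
Qed.

(** The Gram determinant is the squared length of a cross product of tangent vectors, hence the
    square of its component along [nu]. *)
Lemma wulff_densityE i x : dom i x ->
  Num.sqrt (\det (\matrix_(k < 2, l < 2)
    dot (derive_in (dom i) (xi \o par i) x (frame R k))
        (derive_in (dom i) (xi \o par i) x (frame R l)))) = wulff_density i x.
Proof.
move=> dx; have [h0 h1 h2] := dot_cross_wulff_field dx.
have -> : wulff_density i x = `|\det (M (par i x)) * jac (dom i) (nu \o par i) x|.
  by rewrite normrM gtr0_norm.
rewrite -h2 -sqrtr_sqr det2E !mxE !pd0E !pd1E; congr Num.sqrt.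
move: h0 h1; move: (pd0 _ _ x) (pd1 _ _ x) => a b h0 h1.
have := det_tangent (cross a b) (nu1 (par i x)) h0 h1.
rewrite dot_cross_cross (dotC (cross a b) (nu _)) (dotC b a) => ->.
by rewrite expr2.
Qed.

Variables (q : S -> R) (mu : {measure set borel -> \bar R}).
Hypothesis Sq : smooth q.
Hypothesis mu_area : area_measure xi mu.

Local Notation eta := (aniso_trace T nu q).
Local Notation F := (laguerre_operator T nu q).

Let Seta : smooth eta. Proof. exact: smooth_aniso_trace. Qed.
Let SF : smooth F. Proof. exact: smooth_laguerre_operator. Qed.

(** The coefficient of [t] in the integrand for [q + t f], before the factor [4^-1] of the
    functional. *)
Definition variation_density (f : S -> R) p : R :=
  2 * eta p * (mix f tau p / \det (M p)) - 4 * (mix f q p / \det (M p)).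

(* The part of [variation_density f] that is a divergence in every chart *)
Definition variation_exact (f : S -> R) p : R :=
  variation_density f p - 2 * (f p * F p / \det (M p)).

Lemma smooth_variation_density f : smooth f -> smooth (variation_density f).
Proof.
move=> Sf i.
have SV : smooth_on (dom i) (fun x => (\det (M (par i x)))^-1).
  by apply: smooth_onV (SM (i := i)) => x _; exact: lt0r_neq0 (M0 _).
have Sm g : smooth g -> smooth_on (dom i) (mix f g \o par i).
  by move=> Sg; exact: (smooth_mixdisc (@Snu) nu1 nuJ Sf Sg (i := i)).
apply: smooth_onB; apply: smooth_onM.
- exact: smooth_onM (smooth_on_cst _) (Seta (i := i)).
- exact: smooth_onM (Sm _ Stau) SV.
- exact: smooth_on_cst.
- exact: smooth_onM (Sm _ Sq) SV.
Qed.

Lemma smooth_laguerre_density (f : S -> R) : smooth f -> smooth (fun p => f p * F p / \det (M p)).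
Proof.
move=> Sf i; apply: smooth_onM (smooth_onM (Sf i) (SF (i := i))) _.
by apply: smooth_onV (SM (i := i)) => x _; exact: lt0r_neq0 (M0 _).
Qed.

Lemma smooth_variation_exact f : smooth f -> smooth (variation_exact f).
Proof.
move=> Sf i; apply: smooth_onB; first exact: smooth_variation_density.
apply: smooth_onM; first exact: smooth_on_cst.
exact: smooth_laguerre_density.
Qed.

Lemma variation_exact_near0 (f : S -> R) (U : set S) p : smooth f -> open U -> U p ->
  (forall p', U p' -> f p' = 0) -> variation_exact f p = 0.
Proof.
move=> Sf oU Up f0; rewrite /variation_exact /variation_density.
rewrite (mixdisc_near0 (@Snu) nu1 nuJ tau Sf oU Up f0).
by rewrite (mixdisc_near0 (@Snu) nu1 nuJ q Sf oU Up f0) f0//; ring.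
Qed.

Lemma variation_exactD (f g : S -> R) p : smooth f -> smooth g ->
  variation_exact (fun p => f p + g p) p = variation_exact f p + variation_exact g p.
Proof.
move=> Sf Sg; rewrite /variation_exact /variation_density.
have E : (fun p => f p + g p) = (fun p => f p + 1 * g p).
  by apply/funext => p'; rewrite mul1r.
rewrite E !(mixdisc_linl (@Snu) nu1 nuJ)// !mul1r.
by ring.
Qed.

Section ChartIntegral.
Variables (i : idx S) (x : R * R) (e s : R) (f : S -> R).
Hypotheses (e0 : 0 < e) (xd : square x (2 * e) `<=` dom i) (Sf : smooth f).
Hypothesis fE : forall p, f p != 0 -> (par i @` square x e) p.
Hypothesis sJ : forall y, square x (2 * e) y -> 0 < s * jac (dom i) (nu \o par i) y.

Let rA := dom_relopen i.
Let n := nu \o par i.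
Let env (g : S -> R) := envelope (dom i) n (g \o par i).
Let J0 := @chart_jac_neq0 _ _ _ (@Snu) nuJ i.

Let flux0 (h g : S -> R) y : R := dot (env h y) (cross (env f y) (pd1 (dom i) (env g) y)).
Let flux1 (h g : S -> R) y : R := dot (env h y) (cross (env f y) (pd0 (dom i) (env g) y)).

Let Senv g : smooth g -> smooth_on (dom i) (env g).
Proof. by move=> Sg; exact: (smooth_on_envelope rA (@Snu i) J0 (Sg i)). Qed.

Let Sflux0 h g : smooth h -> smooth g -> smooth_on (dom i) (flux0 h g).
Proof.
move=> Sh Sg; apply: smooth_on_dot (Senv Sh) _; apply: smooth_on_cross (Senv Sf) _.
by apply: smooth_on_pd1 => //; exact: Senv.
Qed.

Let Sflux1 h g : smooth h -> smooth g -> smooth_on (dom i) (flux1 h g).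
Proof.
move=> Sh Sg; apply: smooth_on_dot (Senv Sh) _; apply: smooth_on_cross (Senv Sf) _.
by apply: smooth_on_pd0 => //; exact: Senv.
Qed.

Let env0 y : square x (2 * e) y -> ~ square x e y -> env f y = 0.
Proof.
move=> sy nsy; have dy := xd sy.
have sd : square x e `<=` dom i.
  apply: subset_trans xd; apply: square_sub; move: e0 => ?; lra.
rewrite /env -(gmap_chart (@Snu) nu1 nuJ Sf dy).
apply: (gmap_near0 (@Snu) nu1 nuJ (U := ~` (par i @` square x e))) => //.
- by apply: closed_openC; apply: closed_par sd; exact: compact_square.
- by move=> [z sz zy]; apply: nsy; rewrite -(par_inj (sd z sz) dy zy).
- by move=> p' np; apply/eqP; apply: contra_notT np; exact: fE.
Qed.

Let flux_eq (h g : S -> R) : smooth h -> smooth g -> forall y, dom i y ->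
  (h (par i y) * mix f g (par i y) - f (par i y) * mix h g (par i y)) *
    jac (dom i) n y = pd0 (dom i) (flux0 h g) y - pd1 (dom i) (flux1 h g) y.
Proof.
move=> Sh Sg y dy.
have := mixed_exact rA (@Snu i) (fun z _ => nu1 (par i z)) J0 (Sf (i := i)) (Sg i) (Sh i) dy.
rewrite (mixed_chart (@Snu) nu1 nuJ Sf Sg dy) (mixed_chart (@Snu) nu1 nuJ Sh Sg dy).
move=> H; apply: etrans H; rewrite -/n.
move: (mix f g _) (mix h g _) (jac _ _ _) => a b c.
by rewrite /=; ring.
Qed.

(** Two exact forms are combined: one exchanges [eta] and [f] against [tau], the other 1 and [f]
    against [q]. As [s] has the constant sign of [jac] on the square, the absolute value in the
    density is the constant factor [Num.sg s]. *)
Let variation_exact_chart y : square x (2 * e) y ->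
  variation_exact f (par i y) * wulff_density i y = Num.sg s *
   (2 * (pd0 (dom i) (flux0 eta tau) y - pd1 (dom i) (flux1 eta tau) y) -
    4 * (pd0 (dom i) (flux0 (fun=> 1) q) y - pd1 (dom i) (flux1 (fun=> 1) q) y)).
Proof.
move=> sy; have dy := xd sy.
have E1 := flux_eq Seta Stau dy; have E2 := flux_eq S1 Sq dy.
rewrite -E1 -E2 /wulff_density /variation_exact /variation_density.
rewrite (laguerre_operatorE T_norm T_smooth T_curv (@Snu) nu1 nuJ).
have Jn : `|jac (dom i) n y| = Num.sg s * jac (dom i) n y.
  have := sJ sy; rewrite -/n; have [s0|s0|->] := ltgtP s 0; last by rewrite mul0r ltxx.
    by rewrite nmulr_rgt0// => j0; rewrite ltr0_sg// ltr0_norm// mulN1r.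
  by rewrite pmulr_rgt0// => j0; rewrite gtr0_sg// gtr0_norm// mul1r.
rewrite -/n Jn (mixdiscC nu q (fun=> 1)).
have D := lt0r_neq0 (M0 (par i y)).
move: (mix f tau _) (mix f q _) (mix eta tau _) (mix (fun=> 1) q _) => a b c d.
move: (f (par i y)) (eta (par i y)) (jac _ _ _) (Num.sg s) (\det _) D => f' h J sg D D0.
by rewrite /=; field.
Qed.

Lemma integral_variation_exact_chart :
  (\int[mu]_(p in par i @` square x (2 * e)) (variation_exact f p)%:E = 0)%E.
Proof.
have Sv := smooth_variation_exact Sf.
rewrite (area_transfer mu_area (@wulff_density_gt0) (@wulff_density_continuous)
  (@wulff_densityE) (@compact_square _ x (2 * e)) (measurable_square x (2 * e)) xd
  (smooth_continuous Sv)).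
have I (g : R * R -> R) : smooth_on (dom i) g ->
    lebesgue2.-integrable (square x (2 * e) : set plane) (EFin \o g).
  move=> Sg; apply: within_square_integrable.
  exact: continuous_subspaceW xd (smooth_on_continuous Sg).
have Z0 h g : smooth h -> smooth g ->
    (\int[lebesgue2]_(y in square x (2 * e)) (pd0 (dom i) (flux0 h g) y)%:E = 0)%E.
  move=> Sh Sg; apply: (integral_pd0 rA e0 xd (Sflux0 Sh Sg)) => y sy nsy.
  by rewrite /flux0 env0// cross0l dot0r.
have Z1 h g : smooth h -> smooth g ->
    (\int[lebesgue2]_(y in square x (2 * e)) (pd1 (dom i) (flux1 h g) y)%:E = 0)%E.
  move=> Sh Sg; apply: (integral_pd1 rA e0 xd (Sflux1 Sh Sg)) => y sy nsy.
  by rewrite /flux1 env0// cross0l dot0r.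
have I0 h g : smooth h -> smooth g ->
    lebesgue2.-integrable (square x (2 * e) : set plane) (EFin \o pd0 (dom i) (flux0 h g)).
  by move=> Sh Sg; apply: I; apply: smooth_on_pd0 => //; exact: Sflux0.
have I1 h g : smooth h -> smooth g ->
    lebesgue2.-integrable (square x (2 * e) : set plane) (EFin \o pd1 (dom i) (flux1 h g)).
  by move=> Sh Sg; apply: I; apply: smooth_on_pd1 => //; exact: Sflux1.
have mB := measurable_square x (2 * e).
have D h g : smooth h -> smooth g -> (\int[lebesgue2]_(y in square x (2 * e))
    ((pd0 (dom i) (flux0 h g) y)%:E - (pd1 (dom i) (flux1 h g) y)%:E) = 0)%E.
  move=> Sh Sg; rewrite (integralB mB (I0 _ _ Sh Sg) (I1 _ _ Sh Sg)).
  by rewrite (Z0 _ _ Sh Sg) (Z1 _ _ Sh Sg) subee.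
have ID h g : smooth h -> smooth g -> lebesgue2.-integrable (square x (2 * e) : set plane)
    ((EFin \o pd0 (dom i) (flux0 h g)) \- (EFin \o pd1 (dom i) (flux1 h g)))%E.
  move=> Sh Sg; have := integrableB mB (I0 _ _ Sh Sg) (I1 _ _ Sh Sg).
  exact.
transitivity (\int[lebesgue2]_(y in square x (2 * e)) ((Num.sg s * 2)%:E *
   ((pd0 (dom i) (flux0 eta tau) y)%:E - (pd1 (dom i) (flux1 eta tau) y)%:E) +
   (- (Num.sg s * 4))%:E *
   ((pd0 (dom i) (flux0 (fun=> 1%R) q) y)%:E - (pd1 (dom i) (flux1 (fun=> 1%R) q) y)%:E)))%E.
  apply: eq_integral => y /[!inE] sy; rewrite variation_exact_chart// -!EFinB -!EFinM -EFinD.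
  by congr EFin; ring.
rewrite integralD//; [|exact: integrableZl (ID _ _ Seta Stau)|exact: integrableZl (ID _ _ S1 Sq)].
rewrite !integralZl//; [|exact: (ID _ _ S1 Sq)|exact: (ID _ _ Seta Stau)].
by rewrite (D _ _ Seta Stau) (D _ _ S1 Sq) !mule0 adde0.
Qed.

End ChartIntegral.

Hypothesis qJ : forall p, 0 < \det (hessI nu q p) * dot (nu p) (cross (td0 nu p) (td1 nu p)).

Let integrable_mu (K : set S) (h : S -> R) : compact K -> continuous h ->
  mu.-integrable (K : set borel) (EFin \o h).
Proof.
move=> cK ch.
exact: (smooth_integrable mu_area (@wulff_density_continuous)
  (@wulff_densityE) cK ch).
Qed.

(** [K] and the image of the doubled square each contain a closed set carrying [f], off which
    [variation_exact f] vanishes, so the two integrals agree. *)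
Let integral_variation_exact_local (Z K : set S) (f : S -> R) : smooth f ->
  closure [set p | f p != 0] `<=` Z -> Z `<=` K ->
  (exists i x e, [/\ 0 < e, square x (2 * e) `<=` dom i,
    exists s, forall y, square x (2 * e) y -> 0 < s * jac (dom i) (nu \o par i) y &
    forall p, f p != 0 -> (par i @` square x e) p]) ->
  (\int[mu]_(p in K) (variation_exact f p)%:E = 0)%E.
Proof.
move=> Sf fZ ZK [i [x [e [e0 xd [s sJ] fE]]]].
rewrite -(integral_variation_exact_chart e0 xd Sf fE sJ).
rewrite integral_mkcond [RHS]integral_mkcond; apply: eq_integral => p _.
have off (F : set S) : closed F -> (forall p, f p != 0 -> F p) -> p \notin F ->
    variation_exact f p = 0.
  move=> cF fF; rewrite notin_setE => nF.
  apply: (variation_exact_near0 (U := ~` F)) => //; first exact: closed_openC.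
  by move=> p' nF'; apply/eqP; apply: contra_notT nF'; exact: fF.
have v0 : p \notin K -> variation_exact f p = 0.
  move=> nK; apply: (off (closure [set p | f p != 0])); first exact: closed_closure.
    exact: subset_closure.
  by rewrite notin_setE => /fZ/ZK Kp; move: nK; rewrite notin_setE.
have v1 : p \notin par i @` square x (2 * e) -> variation_exact f p = 0.
  apply: off; first by apply: closed_par => //; exact: compact_square.
  move=> p' /fE[y sy <-]; exists y => //; apply: square_sub sy; move: e0 => ?; lra.
rewrite /patch; case: ifPn => [_|/v0 ->]; case: ifPn => // /v1 -> //.
Qed.

(** [variation_exact] is additive in [f], so [f] may be cut into pieces, each carried by a square on
    which [jac] keeps its sign. *)
Lemma integral_variation_exact (K : set S) (f : S -> R) : smooth f ->
  compact (closure [set p | f p != 0]) ->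
  closure [set p | f p != 0] `<=` @manifold_interior R S ->
  compact K -> closure [set p | f p != 0] `<=` K ->
  (\int[mu]_(p in K) (variation_exact f p)%:E = 0)%E.
Proof.
move=> Sf cZ Zi cK ZK.
(* On [V p] the determinant of [hessI nu q] keeps its sign; by [qJ] so does the determinant of [nu],
   [td0 nu], [td1 nu], and with it [jac] in any chart. *)
pose V p := [set p' | 0 < \det (hessI nu q p) * \det (hessI nu q p')].
have Sdet := smooth_det_hessI (@Snu) nu1 nuJ Sq.
have oV p : open (V p).
  apply: (@open_comp _ _ (fun p' => \det (hessI nu q p) * \det (hessI nu q p')) [set y : R | 0 < y]); last exact: open_gt.
  move=> p' _; apply: (@smooth_continuous _ _ R) => j.
  exact: smooth_onM (smooth_on_cst _) (Sdet j).
have Vp p : V p p.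
  rewrite /V /= -expr2 exprn_even_gt0//=.
  by have := lt0r_neq0 (qJ p); rewrite mulf_eq0 negb_or => /andP[].
have [D [g [fg Hg]]] := localization oV Vp Sf cZ Zi (@subset_refl _ _).
have piece k : k \in D -> (\int[mu]_(p in K) (variation_exact (g k) p)%:E = 0)%E.
  move=> /Hg[Sg gZ [i [x [e [e0 xd xV gE]]]]].
  apply: (integral_variation_exact_local Sg gZ ZK); exists i, x, e; split=> //.
  exists (\det (hessI nu q k)) => y sy; have dy := xd y sy.
  have [a [b [ab -> _]]] := chart_jac (@Snu) dy.
  have H1 := xV y sy; have H2 := qJ (par i y); rewrite /V /= in H1.
  rewrite mulrCA mulr_gt0//; move: H1 H2.
  move: (\det _) (\det _) (dot _ _) => v u w uv vw.
  have v0 : v != 0 by apply/eqP => z; move: vw; rewrite z mul0r ltxx.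
  have v2 : 0 < v ^+ 2 by rewrite exprn_even_gt0.
  rewrite -(pmulr_rgt0 _ v2); have -> : v ^+ 2 * (u * w) = (u * v) * (v * w) by ring.
  exact: mulr_gt0.
have -> : f = fun p => \sum_(k <- D) g k p by apply/funext.
have mK := compact_measurable_borel cK.
(* Smoothness of the partial sums is carried along, since additivity of [variation_exact] depends on
   it. *)
suff [] : smooth (fun p => \sum_(k <- D) g k p) /\
    (\int[mu]_(p in K) (variation_exact (fun p => \sum_(k <- D) g k p) p)%:E = 0)%E by [].
have : forall k, k \in D -> smooth (g k) /\
    (\int[mu]_(p in K) (variation_exact (g k) p)%:E = 0)%E.
  by move=> k kD; split; [have [] := Hg k kD|exact: piece].
elim: D {fg Hg piece} => [_|k D IH HD].
  have -> : (fun p => \sum_(k <- [::]) g k p) = fun=> 0 by apply/funext => p; rewrite big_nil.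
  have S0 : smooth (fun _ : S => (0 : R)) by exact: smooth_cst.
  split=> //; apply: integral0_eq => p _; congr EFin.
  by apply: (variation_exact_near0 (U := setT)) => //; exact: openT.
have [Sk Ik] := HD k (mem_head _ _).
have [SD ID] : smooth (fun p => \sum_(k <- D) g k p) /\
    (\int[mu]_(p in K) (variation_exact (fun p => \sum_(k <- D) g k p) p)%:E = 0)%E.
  by apply: IH => k' k'D; apply: HD; rewrite inE k'D orbT.
have -> : (fun p => \sum_(k' <- k :: D) g k' p) = fun p => g k p + \sum_(k' <- D) g k' p.
  by apply/funext => p; rewrite big_cons.
split; first by move=> i; exact: smooth_onD (Sk i) (SD i).
under eq_integral do rewrite variation_exactD// EFinD.
rewrite integralD//; [by rewrite Ik ID adde0| |]; apply: integrable_mu => //;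
  apply: smooth_continuous; exact: smooth_variation_exact.
Qed.

Lemma integral_variation (K : set S) (f : S -> R) : smooth f ->
  compact (closure [set p | f p != 0]) ->
  closure [set p | f p != 0] `<=` @manifold_interior R S ->
  compact K -> closure [set p | f p != 0] `<=` K ->
  (\int[mu]_(p in K) (variation_density f p)%:E =
   2%:E * \int[mu]_(p in K) (f p * F p / \det (M p))%:E)%E.
Proof.
move=> Sf cZ Zi cK ZK; have mK := compact_measurable_borel cK.
have I1 : mu.-integrable (K : set borel) (EFin \o variation_exact f).
  by apply: integrable_mu => //; apply: smooth_continuous; exact: smooth_variation_exact.
have I2 : mu.-integrable (K : set borel) (EFin \o (fun p => f p * F p / \det (M p))).
  by apply: integrable_mu => //; apply: smooth_continuous; exact: smooth_laguerre_density.
have E p : ((variation_density f p)%:E =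
    (variation_exact f p)%:E + 2%:E * (f p * F p / \det (M p))%:E)%E.
  by rewrite -EFinM -EFinD subrK.
under eq_integral do rewrite E.
rewrite integralD//; last exact: integrableZl.
by rewrite integralZl// integral_variation_exact// add0e.
Qed.

Lemma square_measure_gt0 (x : R * R) e : 0 < e -> (0 < lebesgue2 (square x e))%E.
Proof.
move=> e0; rewrite product_measure1E; [|exact: measurable_itv|exact: measurable_itv].
have H (t : R) : (0 < @lebesgue_measure R `[(t - e)%R, (t + e)%R]%classic)%E.
  rewrite lebesgue_measure_itv/= lte_fin; have h : t - e < t + e by move: e0 => ?; lra.
  by rewrite h -EFinB lte_fin subr_gt0.
by apply: mule_gt0; exact: H.
Qed.

(** A boundary point is pushed into the half-plane along [frame R 1]. *)
Lemma manifold_interior_dense (U : set S) p : open U -> U p ->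
  exists2 p', U p' & @manifold_interior R S p'.
Proof.
move=> oU Up; have [d E] := crd_atP p; set i := chart_at p in d E.
have [ O oO EO] := within_preimage_open (@par_continuous _ S i) oU.
have [V oV EV] := dom_open i.
have [_ Ox] : (dom i `&` O) (crd_at p) by rewrite -EO; split=> //=; rewrite E.
have [Vx x2] : (V `&` @halfplane R) (crd_at p) by rewrite -EV.
have : \forall t \near (0 : R), O (t *: frame R 1 + crd_at p) /\ V (t *: frame R 1 + crd_at p).
  by near=> t; split; near: t; apply: cvg_line; exact: open_nbhs_nbhs.
move=> /nbhs_ballP[r /= r0 H].
have r2 : 0 < r / 2 by rewrite divr_gt0.
have rr : r / 2 < r by move: r0 => ?; lra.
have [Oy Vy] : O ((r / 2) *: frame R 1 + crd_at p) /\ V ((r / 2) *: frame R 1 + crd_at p).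
  by apply: H; rewrite /ball/= sub0r normrN gtr0_norm.
have y2 : 0 < ((r / 2) *: frame R 1 + crd_at p).2.
  have -> : ((r / 2) *: frame R 1 + crd_at p).2 = r / 2 + (crd_at p).2.
    have F1 : frame R 1 = (0, 1) by rewrite [RHS]frame_decomp /= scale0r add0r scale1r.
    by rewrite -[LHS]/((r / 2) * (frame R 1).2 + (crd_at p).2) F1 mulr1.
  by rewrite ltr_wpDr.
have dy : dom i ((r / 2) *: frame R 1 + crd_at p) by rewrite EV; split=> //; exact: ltW.
exists (par i ((r / 2) *: frame R 1 + crd_at p)).
  have : (dom i `&` O) ((r / 2) *: frame R 1 + crd_at p) by [].
  by rewrite -EO => -[].
by exists i, ((r / 2) *: frame R 1 + crd_at p).
Unshelve. all: by end_near. Qed.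

Lemma square_par_interior i x e : 0 < e -> square x (2 * e) `<=` dom i ->
  par i @` square x e `<=` interior (par i @` square x (2 * e)).
Proof.
move=> e0 xd p [y sy yp].
have sy2 : square x (2 * e) y by apply: square_sub sy; move: e0 => ?; lra.
have : \forall z \near y, square x (2 * e) z.
  apply/nbhs_ballP; exists e => //= z [z1 z2]; apply/squareP.
  move: sy => /squareP[y1 y2]; move: z1 z2; rewrite /ball/= => z1 z2.
  have T3 (a b c : R) : `|a - b| <= e -> `|a - c| < e -> `|c - b| <= 2 * e.
    move=> h1 h2; rewrite -(subrKA a) (le_trans (ler_normD _ _))//.
    by rewrite distrC mulr2n mulrDl mul1r lerD// ltW.
  by split; [exact: T3 y1 z1|exact: T3 y2 z2].
move=> /near_open[ O [oO Oy OB]].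
have [P oP EP] := within_preimage_open (@crd_continuous _ S i) oO.
rewrite /interior; apply: (filterS (P := par i @` dom i `&` P)).
  move=> p'; rewrite -EP => -[[z dz <-]] /=; rewrite parK// => Oz.
  by exists z => //; exact: OB.
apply: open_nbhs_nbhs; split; first by apply: openI => //; exact: par_open.
by rewrite -EP -yp; split => /=; [exists y => //; exact: xd|rewrite parK//; exact: xd].
Qed.

Lemma square_par_manifold_interior i x e : 0 < e -> square x (2 * e) `<=` dom i ->
  par i @` square x e `<=` @manifold_interior R S.
Proof.
move=> e0 xd p [y sy yp]; exists i, y; move: (sy) => /squareP[y1 y2].
split=> //; first by apply: xd; apply: square_sub sy; move: e0 => ?; lra.
(* Lowered by [e], the point stays in the doubled square, hence in the half-plane, so
   [y.2 >= e > 0]. *)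
have : square x (2 * e) (y.1, y.2 - e).
  apply/squareP => /=; split; first by move: e0 y1 => ? /le_trans; apply; lra.
  move: y2; rewrite !ler_norml => /andP[h1 h2]; move: e0 => ?.
  by apply/andP; split; lra.
move=> /xd; have [V _ ->] := dom_open i.
by move=> [_]; rewrite /halfplane/= subr_ge0; exact: lt_le_trans.
Qed.

(** The open set where [F] is nonzero meets the interior of the surface, so it contains a square
    around an interior point. There [f * F / \det M] is nonnegative, and a positive lower bound on a
    set of positive measure contradicts the vanishing of its integral. *)
Lemma laguerre_operator_eq0 :
  (forall f : S -> R, smooth f -> compact (closure [set p | f p != 0]) ->
    closure [set p | f p != 0] `<=` @manifold_interior R S ->
    forall K : set S, compact K -> closure [set p | f p != 0] `<=` interior K ->
    (\int[mu]_(p in K) (variation_density f p)%:E = 0)%E) ->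
  forall p, F p = 0.
Proof.
move=> H p0; apply/eqP; apply: contrapT => /negP Fp0.
pose U := [set p | F p != 0].
have cF : continuous F by exact: smooth_continuous.
have oU : open U.
  by apply: (@open_comp _ _ F [set y : R | y != 0]) => [p' _|]; [exact: cF|exact: open_neq].
have [p Up ip] := manifold_interior_dense oU Fp0.
have [i [x [e [e0 xp xd xU]]]] := chart_square ip oU Up.
have sd : square x e `<=` dom i.
  by apply: subset_trans xd; apply: square_sub; move: e0 => ?; lra.
have Sb := smooth_chart_bump sd.
pose f p := chart_bump i x e p * F p.
have Sf : smooth f by move=> j; exact: smooth_onM (Sb j) (SF (i := j)).
have clE : closed (par i @` square x e) by apply: closed_par => //; exact: compact_square.
have fE : closure [set p | f p != 0] `<=` par i @` square x e.
  rewrite [X in _ `<=` X](iffLR (closure_id _) clE); apply: closureS => p' /=.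
  by move=> fp; apply: contrapT => np; move: fp; rewrite /f chart_bump_eq0// mul0r eqxx.
have cf : compact (closure [set p | f p != 0]).
  apply: (subclosed_compact (@closed_closure _ _) _ fE).
  by apply: compact_par => //; exact: compact_square.
pose K := par i @` square x (2 * e).
have cK : compact K by apply: compact_par => //; exact: compact_square.
have fi := subset_trans fE (square_par_manifold_interior e0 xd).
have fK := subset_trans fE (square_par_interior e0 xd).
have fK' : closure [set p | f p != 0] `<=` K by exact: subset_trans fK (@interior_subset _ _).
have := H f Sf cf fi K cK fK; rewrite integral_variation//.
pose h p := f p * F p / \det (M p).
have ch : continuous h by apply: smooth_continuous; exact: smooth_laguerre_density.
have hE p' : h p' = chart_bump i x e p' * F p' ^+ 2 / \det (M p').
  by rewrite /h /f expr2 mulrA.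
have h0 p' : 0 <= h p'.
  by rewrite hE divr_ge0 ?(ltW (M0 _))// mulr_ge0 ?chart_bump_ge0 ?sqr_ge0.
(* The bump vanishes at the edge of [square x e]; on the concentric square of half the size [h] has
   a positive minimum. *)
pose B := square x (e / 2).
have e2 : 0 < e / 2 by rewrite divr_gt0.
have Bs : B `<=` square x (2 * e) by apply: square_sub; move: e0 => ?; lra.
have Bd : B `<=` dom i by exact: subset_trans Bs xd.
have cB : compact B by exact: compact_square.
have mB : measurable (B : set plane) by exact: measurable_square.
have Bx : B x by apply/squareP; rewrite !subrr normr0; split; exact: ltW.
have cE : compact (par i @` B) by exact: compact_par.
have mE := compact_measurable_borel cE.
have mK := compact_measurable_borel cK.
have [c cE' hc] := compact_EVT_min (f := h) (ex_intro _ (par i x) (ex_intro2 _ _ x Bx erefl)) cE (continuous_subspaceT ch).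
have hc0 : 0 < h c.
  move: cE'; rewrite inE => -[y By <-]; rewrite hE divr_gt0 ?M0// mulr_gt0//.
    rewrite chart_bumpE//; last exact: Bd.
    have ee : e / 2 < e by move: e0 => ?; lra.
    by move: By => /squareP[h1 h2]; apply: bump_gt0; [exact: le_lt_trans h1 ee|exact: le_lt_trans h2 ee].
  by rewrite exprn_even_gt0//= (xU y (Bs y By)).
have wc := continuous_subspaceW Bd (@wulff_density_continuous i).
have [b Bb wb] := compact_EVT_min (ex_intro _ x Bx) cB wc.
have wb0 : 0 < wulff_density i b by apply: wulff_density_gt0; apply: Bd; move: Bb; rewrite inE.
have muE : (0 < mu (par i @` B))%E.
  rewrite (area_chart mu_area (@wulff_densityE) mB Bd).
  apply: (@lt_le_trans _ _ (\int[lebesgue2]_(y in B) (wulff_density i b)%:E)%E).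
    by rewrite integral_cst//; apply: mule_gt0; [rewrite lte_fin|exact: square_measure_gt0].
  apply: ge0_le_integral => //.
  - by move=> y _; rewrite lee_fin ltW.
  - by apply/measurable_EFinP; exact: within_measurable_plane mB wc.
  - by move=> y By; rewrite lee_fin wb// inE.
have : (0 < \int[mu]_(p in K) (h p)%:E)%E.
  apply: (@lt_le_trans _ _ (\int[mu]_(p in par i @` B) (h c)%:E)%E).
    by rewrite integral_cst//; apply: mule_gt0; [rewrite lte_fin|exact: muE].
  apply: (@le_trans _ _ (\int[mu]_(p in par i @` B) (h p)%:E)%E).
    apply: ge0_le_integral => //.
    - by move=> p' _; rewrite lee_fin ltW.
    - by apply/measurable_EFinP; exact: continuous_measurable_borel.
    - by move=> p' Ep'; rewrite lee_fin hc// inE.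
  apply: ge0_subset_integral => //.
  - by apply/measurable_EFinP; exact: continuous_measurable_borel.
  - by move=> p' _; rewrite lee_fin.
  - by move=> p' [y By <-]; exists y => //; exact: Bs.
move=> pos z; have : (0 < 2%:E * \int[mu]_(p in K) (h p)%:E)%E by apply: mule_gt0.
by rewrite z ltxx.
Qed.

End FirstVariation.

Lemma is_derive_quadratic (R : realType) (a b c : R) (f : R -> R) :
  (\forall t \near (0 : R), a + t * b + t ^+ 2 * c = f t) ->
  is_derive (0 : R) (1 : R) f b.
Proof.
move=> N; apply: near_eq_is_derive N _.
pose g (t : R) := b + t * c.
have dg : {for 0, continuous g}.
  apply: cvgD; first exact: cvg_cst.
  by apply: cvgM; [exact: cvg_id|exact: cvg_cst].
have H : (fun h : R => h^-1 *: ((a + (h *: (1 : R) + 0) * b + (h *: (1 : R) + 0) ^+ 2 * c) -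
    (a + 0 * b + 0 ^+ 2 * c))) @ 0^' --> b.
  have g0 : g @ 0^' --> b.
    have -> : b = g 0 by rewrite /g mul0r addr0.
    exact: cvg_within_filter dg.
  apply: cvg_trans g0; apply: near_eq_cvg; near=> h.
  have h0 : h != 0 by near: h; exact: nbhs_dnbhs_neq.
  by rewrite /g /GRing.scale/= mulr1 addr0; field.
by split; [apply/cvg_ex; exists b|apply/cvg_lim].
Unshelve. all: by end_near. Qed.

Lemma Rintegral_quadratic d (U : measurableType d) (R : realType)
    (m : {measure set U -> \bar R}) (D : set U) (a b c : U -> R) (t : R) :
  measurable D -> m.-integrable D (EFin \o a) -> m.-integrable D (EFin \o b) ->
  m.-integrable D (EFin \o c) ->
  Rintegral m D (fun x => a x + (t * b x + t ^+ 2 * c x)) =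
  Rintegral m D a + (t * Rintegral m D b + t ^+ 2 * Rintegral m D c).
Proof.
move=> mD Ia Ib Ic.
have IZ k (f : U -> R) : m.-integrable D (EFin \o f) ->
    m.-integrable D (EFin \o (fun x => k * f x)).
  move=> If; have -> : EFin \o (fun x => k * f x) = (fun x => k%:E * (EFin \o f) x)%E.
    by apply/funext => x; rewrite /= EFinM.
  exact: integrableZl.
have Itb := IZ t b Ib; have Itc := IZ (t ^+ 2) c Ic.
have Ibc : m.-integrable D (EFin \o (fun x => t * b x + t ^+ 2 * c x)).
  have -> : EFin \o (fun x => t * b x + t ^+ 2 * c x) =
      ((EFin \o (fun x => t * b x)%R) \+ (EFin \o (fun x => t ^+ 2 * c x)%R))%E.
    by apply/funext => x; rewrite /= EFinD.
  exact: integrableD.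
rewrite RintegralD//.
by rewrite RintegralD// !RintegralZl.
Qed.

(** * Critical points of the Laguerre functional *)

Section Criticality.
Context {R : realType} (T : 'rV[R]_3 -> R) (S : surface R) (X : S -> 'rV[R]_3).
Implicit Types (i : idx S) (p : S).
Hypothesis T_norm : is_norm T.
Hypothesis T_smooth : smooth_on [set x | x != 0] T.
Hypothesis T_curv : forall x, wulff_shape T x -> 0 < wulff_curvature T x.
Hypothesis SX : smooth X.
Hypothesis X_imm : immersion X.
Hypothesis X_curved : forall p, gauss_curvature X p != 0.

Local Notation borel := (g_sigma_algebraType (@open S)).
Local Notation nu := (gauss_map X).
Local Notation q := (support_function X).
Local Notation xi := (wulff_field T nu).
Local Notation tau := (dual_norm T \o nu).
Local Notation M := (wulff_matrix T nu).
Local Notation mix := (mixdisc nu).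

Let Snu : smooth nu. Proof. exact: smooth_gauss_map. Qed.
Let nu1 p : dot (nu p) (nu p) = 1. Proof. exact: gauss_map_unit. Qed.
Let nuJ p : dot (nu p) (cross (td0 nu p) (td1 nu p)) != 0.
Proof. exact: gauss_map_immersive. Qed.
Let Sq : smooth q. Proof. exact: smooth_support_function. Qed.
Let qX : gmap nu q = X.
Proof. by apply/funext => p; exact: gmap_support_function. Qed.

(** The product is the length of [cross (td0 X p) (td1 X p)], because [X] is [gmap nu q] and has
    [nu] itself, not [- nu], as its Gauss map. *)
Lemma support_jac_gt0 p :
  0 < \det (hessI nu q p) * dot (nu p) (cross (td0 nu p) (td1 nu p)).
Proof.
have := cross_td_gmap (@Snu) nu1 nuJ p Sq; rewrite qX cross_td_gauss_map.
have key (a b : R) (n : 'rV[R]_3) : dot n n = 1 -> a *: n = b *: n -> a = b.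
  by move=> n1 /(congr1 (dot n)); rewrite !dotZr n1 !mulr1.
move=> /(key _ _ _ (nu1 p)) <-.
by rewrite enorm_gt0// cross_td_neq0.
Qed.

Let Q0 p : \det (hessI nu q p) != 0.
Proof. by have := lt0r_neq0 (support_jac_gt0 p); rewrite mulf_eq0 negb_or => /andP[]. Qed.

Lemma aniso_trace_support p : let l := anisotropic_principal_curvatures T X p in
  aniso_trace T nu q p = - l.1^-1 - l.2^-1.
Proof.
have XE p' : X p' = gmap nu q p' by rewrite qX.
by have [] := principal_curvaturesE T_norm T_smooth T_curv (@Snu) nu1 nuJ Sq XE erefl (Q0 p).
Qed.

Variable dA : (S -> 'rV[R]_3) -> {measure set borel -> \bar R}.
Hypothesis dA_area : forall Y : S -> 'rV[R]_3,
  smooth Y -> immersion Y -> area_measure Y (dA Y).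

Let mu := dA xi.
Let mu_area : area_measure xi mu.
Proof.
apply: dA_area; first exact: smooth_wulff_field.
exact: wulff_field_immersion.
Qed.

Let integrable_mu (K : set S) (h : S -> R) : compact K -> smooth h ->
  mu.-integrable (K : set borel) (EFin \o h).
Proof.
move=> cK /smooth_continuous ch.
exact: (smooth_integrable mu_area
  (wulff_density_continuous T_norm T_smooth T_curv (@Snu) nu1 nuJ)
  (wulff_densityE T_norm T_smooth T_curv (@Snu) nu1 nuJ) cK ch).
Qed.

(* The integrand of the Laguerre functional for the support function [f]; its
   polarization at [q] is [variation_density]. *)
Definition laguerre_integrand (f : S -> R) p : R :=
  (mix f tau p / \det (M p)) ^+ 2 - 4 * (\det (hessI nu f p) / \det (M p)).

Lemma smooth_laguerre_integrand f : smooth f -> smooth (laguerre_integrand f).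
Proof.
move=> Sf i; have SM := smooth_det_wulff_matrix T_norm T_smooth T_curv (@Snu) nu1 nuJ.
have Stau := smooth_dual_norm T_norm T_smooth T_curv (@Snu) nu1.
have SV : smooth_on (dom i) (fun x => (\det (M (par i x)))^-1).
  apply: smooth_onV (SM i) => x _.
  exact: lt0r_neq0 (det_wulff_matrix_gt0 T_norm T_smooth T_curv (@Snu) nu1 nuJ _).
have Sm := smooth_onM (smooth_mixdisc (@Snu) nu1 nuJ Sf Stau (i := i)) SV.
apply: smooth_onB; first exact: (smooth_onM Sm Sm).
apply: smooth_onM; first exact: smooth_on_cst.
exact: smooth_onM (smooth_det_hessI (@Snu) nu1 nuJ Sf (i := i)) SV.
Qed.

(** For small [t] the varied surface keeps its Gauss map, hence its Cahn-Hoffman field and the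
    measure [mu], and the integrand is a polynomial of degree two in [t]. The functional is
    therefore quadratic near 0, and no differentiation under the integral sign is involved. *)
Lemma laguerre_quadratic (f : S -> R) (K : set S) : smooth f ->
  compact (closure [set p | f p != 0]) -> compact K ->
  \forall t \near (0 : R),
    4^-1 * Rintegral mu K (laguerre_integrand q) +
    t * (4^-1 * Rintegral mu K (variation_density T nu q f)) +
    t ^+ 2 * (4^-1 * Rintegral mu K (laguerre_integrand f)) =
    laguerre T dA (laguerre_variation X f t) K.
Proof.
move=> Sf cf cK; have mK := compact_measurable_borel cK.
have [e e0 He] := det_hessI_variation (@Snu) nu1 nuJ Sq Sf cf support_jac_gt0.
near=> t.
have te : `|t| < e.
  by near: t; apply/nbhs_ballP; exists e => //= t'; rewrite /ball/= sub0r normrN.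
pose g p := q p + t * f p.
have Sg : smooth g by exact: smooth_lin.
have YE p : laguerre_variation X f t p = gmap nu g p by [].
have Ynu : gauss_map (laguerre_variation X f t) = nu.
  have -> : laguerre_variation X f t = gmap nu g by apply/funext.
  by apply: gauss_map_gmap => // p; exact: He.
have CH : cahn_hoffman T (laguerre_variation X f t) = xi.
  by apply/funext => p; rewrite /cahn_hoffman Ynu.
rewrite /laguerre CH -/mu.
have Sd := smooth_variation_density T_norm T_smooth T_curv (@Snu) nu1 nuJ Sq Sf.
have E p : (let l := anisotropic_principal_curvatures T (laguerre_variation X f t) p in
    (l.1^-1 - l.2^-1) ^+ 2) =
    laguerre_integrand q p + (t * variation_density T nu q f p + t ^+ 2 * laguerre_integrand f p).
  have g0 : \det (hessI nu g p) != 0.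
    by have := lt0r_neq0 (He t te p); rewrite mulf_eq0 negb_or => /andP[].
  have [_ H] := principal_curvaturesE T_norm T_smooth T_curv (@Snu) nu1 nuJ Sg YE Ynu g0.
  apply: etrans H _.
  rewrite (aniso_traceE T_norm T_smooth T_curv (@Snu) nu1 nuJ).
  have EM : mix g tau p = mix q tau p + t * mix f tau p.
    by apply: (mixdisc_linl (@Snu) nu1 nuJ).
  have ED : \det (hessI nu g p) =
      \det (hessI nu q p) + t * mix q f p + t ^+ 2 * \det (hessI nu f p).
    by apply: (det_hessI_lin (@Snu) nu1 nuJ).
  rewrite EM ED.
  rewrite /variation_density /laguerre_integrand (mixdiscC nu q f).
  rewrite (aniso_traceE T_norm T_smooth T_curv (@Snu) nu1 nuJ).
  have D := lt0r_neq0 (det_wulff_matrix_gt0 T_norm T_smooth T_curv (@Snu) nu1 nuJ p).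
  move: (mix _ _ _) (mix _ _ _) (mix _ _ _) (\det (M p)) D => a b c d d0.
  by move: (\det _) (\det _) => u v; field.
have EI : Rintegral mu K (fun p => let l := anisotropic_principal_curvatures T
    (laguerre_variation X f t) p in (l.1^-1 - l.2^-1) ^+ 2) =
    Rintegral mu K (fun p => laguerre_integrand q p +
      (t * variation_density T nu q f p + t ^+ 2 * laguerre_integrand f p)).
  by congr (Rintegral mu K _); apply/funext => p; exact: E.
rewrite EI.
have Id := integrable_mu cK Sd.
have Iq := integrable_mu cK (smooth_laguerre_integrand Sq).
have If := integrable_mu cK (smooth_laguerre_integrand Sf).
rewrite (Rintegral_quadratic t mK Iq Id If).
move: (Rintegral mu K _) (Rintegral mu K _) (Rintegral mu K _) => a b c; ring.
Unshelve. all: by end_near. Qed.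

(** The derivative always exists and is a quarter of the integral of [variation_density], so
    criticality is the vanishing of these integrals. *)
Lemma laguerre_criticalP :
  laguerre_critical T dA X <-> forall p, laguerre_operator T nu q p = 0.
Proof.
have intE (K : set S) (f : S -> R) : compact K -> smooth f ->
    (\int[mu]_(p in K) (variation_density T nu q f p)%:E)%E =
    (Rintegral mu K (variation_density T nu q f))%:E.
  move=> cK Sf; rewrite /Rintegral fineK//.
  have mK := compact_measurable_borel cK.
  apply: integrable_fin_num => //; apply: integrable_mu => //.
  exact: smooth_variation_density.
split=> [crit|F0 f Sf /= cf fi K cK fK].
  apply: (laguerre_operator_eq0 T_norm T_smooth T_curv (@Snu) nu1 nuJ Sq mu_area support_jac_gt0).
  move=> f Sf cf fi K cK fK.
  have D0 := crit f Sf cf fi K cK fK.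
  have D1 := is_derive_quadratic (laguerre_quadratic Sf cf cK).
  rewrite intE//; congr EFin.
  have : 4^-1 * Rintegral mu K (variation_density T nu q f) = 0.
    have -> : 4^-1 * Rintegral mu K (variation_density T nu q f) =
        'D_1 (fun eps => laguerre T dA (laguerre_variation X f eps) K) 0 by rewrite derive_val.
    exact: derive_val.
  by move=> /eqP; rewrite mulf_eq0 invr_eq0 pnatr_eq0/= => /eqP.
have D1 := is_derive_quadratic (laguerre_quadratic Sf cf cK).
apply: is_derive_eq D1 _.
have := integral_variation T_norm T_smooth T_curv (@Snu) nu1 nuJ Sq mu_area support_jac_gt0 Sf cf fi cK
  (subset_trans fK (@interior_subset _ _)).
rewrite intE// [X in (_ * X)%E]integral0_eq => [|p _]; last by rewrite F0 mulr0 mul0r.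
by rewrite mule0 => -[->]; rewrite mulr0.
Qed.

End Criticality.

Theorem theorem4p1 (R : realType) (T : 'rV[R]_3 -> R)
    (T_norm : is_norm T) (T_wulff : smooth_positively_curved_wulff T)
    (S : surface R)
    (dA : (S -> 'rV[R]_3) ->
          {measure set (g_sigma_algebraType (@open S)) -> \bar R})
    (dA_area : forall Y : S -> 'rV[R]_3,
        smooth Y -> immersion Y -> area_measure Y (dA Y))
    (X : S -> 'rV[R]_3) (X_smooth : smooth X) (X_immersion : immersion X)
    (X_curved : forall p, gauss_curvature X p != 0) :
  let nu := gauss_map X in
  let q := support_function X in
  [/\ laguerre_critical T dA X <-> (forall p, laguerre_operator T nu q p = 0),
      forall p, let l := anisotropic_principal_curvatures T X p in
        aniso_trace T nu q p = - l.1^-1 - l.2^-1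
    & linear_elliptic_operator 4 (laguerre_operator T nu)].
Proof.
move=> nu q; have [T_smooth T_curv] := T_wulff; split.
- exact: (laguerre_criticalP T_norm T_smooth T_curv X_smooth X_immersion X_curved dA_area).
- exact: (aniso_trace_support T_norm T_smooth T_curv X_smooth X_immersion X_curved).
- apply: (laguerre_linear_elliptic T_norm T_smooth T_curv (smooth_gauss_map X_smooth X_immersion)).
  + exact: gauss_map_unit.
  + exact: (gauss_map_immersive X_smooth X_immersion X_curved).
Qed.
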